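(* Let $b>0$, let $\Gamma\subset\mathbb{R}^2$ be a $C^{1,1}$-smooth Jordan curve, and let $\upsilon\in L^p(\Gamma;\mathbb{R})$ for some $p>1$ satisfy $\upsilon\ge0$ on $\Gamma$ and $\upsilon\not\equiv0$. Then $$\ker(T_0(\upsilon\delta_\Gamma))=\{0\}.$$
   Context: Let $b>0$, $A(x)=\frac b2(-x_2,x_1)$ for $x=(x_1,x_2)\in\mathbb{R}^2$, and $\Pi(A)=-i\nabla-A$. Let $\mathrm{H}^1_A(\mathbb{R}^2)=\{u\in L^2(\mathbb{R}^2):\Pi(A)u\in L^2(\mathbb{R}^2)^2\}$ with norm squared $\|u\|_{L^2}^2+\|\Pi(A)u\|_{L^2}^2$. A $C^{1,1}$-smooth Jordan curve $\Gamma\subset\mathbb{R}^2$ is a simple closed curve mapped onto the unit circle by a $C^{1,1}$-smooth diffeomorphism. $\tau:\mathrm{H}^1_A(\mathbb{R}^2)\to\mathrm{H}^{1/2}(\Gamma)$ is the Dirichlet trace operator, i.e. the continuous extension of the restriction map $u\mapsto u|_\Gamma$; $ds$ is arc length. $H_0=(-i\nabla-A)^2$ is the Landau Hamiltonian, the self-adjoint operator in $L^2(\mathbb{R}^2)$ associated with the closed form $\int_{\mathbb{R}^2}|\Pi(A)u|^2\,dx$, $u\in\mathrm{H}^1_A(\mathbb{R}^2)$. Its spectrum consists of the infinitely degenerate eigenvalues $\Lambda_q=b(2q+1)$, $q\in\mathbb{Z}_+=\{0,1,2,\dots\}$; in particular $\Lambda_0=b$. $p_q$ is the orthogonal projection in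 $L^2(\mathbb{R}^2)$ onto $\ker(H_0-\Lambda_q)$. The Berezin–Toeplitz type operator $T_q(\upsilon\delta_\Gamma)=(\tau p_q)^*\upsilon(\tau p_q)$ is the bounded self-adjoint operator in the Hilbert space $p_qL^2(\mathbb{R}^2)$ associated with the quadratic form $u\mapsto\int_\Gamma\upsilon|\tau u|^2\,ds$, $u\in p_qL^2(\mathbb{R}^2)$. *)

(* Defs.v *)
From HB Require Import structures.
From mathcomp Require Import all_boot all_order all_algebra.
From mathcomp Require Import all_classical all_reals all_analysis.
From mathcomp Require Import complex.

Set Implicit Arguments.
Unset Strict Implicit.
Unset Printing Implicit Defensive.

Import Order.TTheory GRing.Theory Num.Theory.
Import numFieldNormedType.Exports.

Local Open Scope classical_set_scope.
Local Open Scope ring_scope.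
Local Open Scope complex_scope.

(* The unqualified [Re] and [Im] are valued in R[i], these ones in R. *)
Local Notation Re := complex.Re.
Local Notation Im := complex.Im.

Local Notation Line R := (measurableTypeR R).
Local Notation Plane R := (measurableTypeR R * measurableTypeR R)%type.

(* Elements of L^2(R^2) and of the spaces on Gamma are represented by Borel
   functions; the identification of almost everywhere equal functions is
   always written explicitly with {ae _, _}. *)

Section ComplexL2.
Context {R : realType}.

Definition sqmod (z : R[i]) : R := Re z ^+ 2 + Im z ^+ 2.

Definition Cmeasurable d (T : measurableType d) (D : set T) (u : T -> R[i]) :=
  measurable_fun D (fun x => Re (u x)) /\ measurable_fun D (fun x => Im (u x)).

Definition Cintegral d (T : measurableType d) (mu : {measure set T -> \bar R})
    (D : set T) (u : T -> R[i]) : R[i] :=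
  (\int[mu]_(x in D) Re (u x)) +i* (\int[mu]_(x in D) Im (u x)).

Definition leb1 : {measure set (Line R) -> \bar R} := @lebesgue_measure R.

Definition leb2 : {measure set (Plane R) -> \bar R} :=
  (@lebesgue_measure R \x @lebesgue_measure R)%E.

Definition sqnormL2 (u : R * R -> R[i]) : \bar R :=
  (\int[leb2]_x (sqmod (u x))%:E)%E.

Definition L2 : set (R * R -> R[i]) :=
  [set u : R * R -> R[i] |
    Cmeasurable (setT : set (Plane R)) u /\ (sqnormL2 u < +oo)%E].

Definition L2_zero : set (R * R -> R[i]) :=
  [set u | L2 u /\ {ae leb2, forall x, u x = 0}].

Definition inner (u v : R * R -> R[i]) : R[i] :=
  Cintegral leb2 setT (fun x => u x * (v x)^*).

End ComplexL2.

Section TestFunctions.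
Context {R : realType}.

Definition basis_vec (j : 'I_2) : R * R := if j == 0 then (1, 0) else (0, 1).

Definition partial (j : 'I_2) (f : R * R -> R) : R * R -> R :=
  fun x => 'D_(basis_vec j) f x.

Fixpoint Ck (k : nat) (f : R * R -> R) : Prop :=
  if k is k'.+1 then
    continuous f /\
    forall j, (forall x, derivable f x (basis_vec j)) /\ Ck k' (partial j f)
  else continuous f.

Definition test_fun : set (R * R -> R) :=
  [set f | (forall k, Ck k f) /\ compact (closure [set x | f x != 0])].

Definition Ctest_fun : set (R * R -> R[i]) :=
  [set u | test_fun (fun x => Re (u x)) /\ test_fun (fun x => Im (u x))].

End TestFunctions.

Section MagneticSobolev.
Context {R : realType}.
Variable b : R.

Definition vpot (x : R * R) (j : 'I_2) : R :=
  b / 2 * (if j == 0 then - x.2 else x.1).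

(* [g] is the distribution [(- i d_j - A_j) u]. Real test functions suffice
   by linearity. *)
Definition weak_Pi (j : 'I_2) (u g : R * R -> R[i]) : Prop :=
  forall phi, test_fun phi ->
    Cintegral leb2 setT (fun x => g x * (phi x)%:C) =
    Cintegral leb2 setT
      (fun x => u x * ('i * (partial j phi x)%:C - (vpot x j * phi x)%:C)).

Definition H1A : set (R * R -> R[i]) :=
  [set u | L2 u /\ forall j, exists g, L2 g /\ weak_Pi j u g].

(* For [u] in H1A this is the j-th component of Pi(A)u, which is unique up to
   a null set. *)
Definition PiA (j : 'I_2) (u : R * R -> R[i]) : R * R -> R[i] :=
  xget (fun=> 0) [set g | L2 g /\ weak_Pi j u g].

Definition sqnormH1A (u : R * R -> R[i]) : \bar R :=
  (sqnormL2 u + \sum_(j < 2) sqnormL2 (PiA j u))%E.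

Definition landau_form (u v : R * R -> R[i]) : R[i] :=
  \sum_(j < 2) inner (PiA j u) (PiA j v).

End MagneticSobolev.

(* Graph of the operator associated, in the closed subspace [E] of L^2, with
   the sesquilinear form [q] of domain [D] included in [E]: [u] is mapped to
   [f]. *)
Definition form_operator (R : realType) (D E : set (R * R -> R[i]))
    (q : (R * R -> R[i]) -> (R * R -> R[i]) -> R[i])
    (u f : R * R -> R[i]) : Prop :=
  [/\ D u, E f & forall v, D v -> q u v = inner f v].

Section Landau.
Context {R : realType}.
Variable b : R.

Definition landau_hamiltonian := form_operator (H1A b) L2 (landau_form b).

Definition landau_level (q : nat) : R := b * (2 * q + 1)%:R.

(* The range p_q L^2 of the projection p_q, i.e. ker (H_0 - Lambda_q). *)
Definition landau_space (q : nat) : set (R * R -> R[i]) :=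
  [set u | landau_hamiltonian u (fun x => (landau_level q)%:C * u x)].

End Landau.

Section Curve.
Context {R : realType}.

Definition unit_circle : set (R * R) := [set x | x.1 ^+ 2 + x.2 ^+ 2 = 1].

Definition angular (h : R * R -> R * R) (t : R) : R * R := h (cos t, sin t).

(* [h] is a C^{1,1} diffeomorphism of the unit circle onto [Gamma] (the
   inverse of the diffeomorphism of Gamma onto the circle), expressed in the
   angular coordinate of the circle. *)
Definition C11_circle_diffeo (Gamma : set (R * R)) (h : R * R -> R * R) : Prop :=
  [/\ set_bij unit_circle Gamma h,
      forall t, derivable (angular h) t 1,
      exists k : R, k.-lipschitz (derive1 (angular h))
    & forall t, derive1 (angular h) t != 0].

Variable h : R * R -> R * R.
Let gamma := angular h.
Let I : set R := `[0, 2 * pi].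

(* The norm of [R * R] is the sup norm, hence the explicit Euclidean one. *)
Definition euclid (x : R * R) : R := Num.sqrt (x.1 ^+ 2 + x.2 ^+ 2).

Definition speed (t : R) : R := euclid (derive1 gamma t).

Definition arc_integral (f : R * R -> \bar R) : \bar R :=
  (\int[leb1]_(t in I) (f (gamma t) * (speed t)%:E))%E.

Definition arc_Cintegral (f : R * R -> R[i]) : R[i] :=
  Cintegral leb1 I (fun t => f (gamma t) * (speed t)%:C).

(* As the speed does not vanish, null sets for arc length are the null sets
   of the parameter. *)
Definition arc_ae (P : R * R -> Prop) : Prop :=
  {ae leb1, forall t, I t -> P (gamma t)}.

Definition LpGamma (p : R) : set (R * R -> R) :=
  [set f : R * R -> R |
    measurable_fun (I : set (Line R)) (f \o gamma) /\
    (arc_integral (fun x => (`|f x| `^ p)%:E) < +oo)%E].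

(* Sobolev-Slobodeckij norm on the one-dimensional manifold Gamma. *)
Definition sqnormHhalf (g : R * R -> R[i]) : \bar R :=
  (arc_integral (fun x => (sqmod (g x))%:E) +
   arc_integral (fun x => arc_integral (fun y =>
     (sqmod (g x - g y) / euclid (x - y) ^+ 2)%:E)))%E.

Definition Hhalf : set (R * R -> R[i]) :=
  [set g : R * R -> R[i] |
    Cmeasurable (I : set (Line R)) (g \o gamma) /\ (sqnormHhalf g < +oo)%E].

(* Extension by continuity, from H1A to H^{1/2}(Gamma), of the restriction of
   smooth compactly supported functions, which are dense in H1A. *)
Definition is_trace (b : R) (u g : R * R -> R[i]) : Prop :=
  [/\ H1A b u, Hhalf g &
      exists phi : nat -> R * R -> R[i],
        [/\ forall n, Ctest_fun (phi n),
            (fun n => sqnormH1A b (fun x => phi n x - u x)) @ \oo --> 0%E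
          & (fun n => sqnormHhalf (fun x => phi n x - g x)) @ \oo --> 0%E]].

Definition trace (b : R) (u : R * R -> R[i]) : R * R -> R[i] :=
  xget (fun=> 0) [set g | is_trace b u g].

(* The sesquilinear form of the quadratic form [int_Gamma ups |tau u|^2 ds]. *)
Definition toeplitz_form (b : R) (ups : R * R -> R) (u v : R * R -> R[i]) :
    R[i] :=
  arc_Cintegral (fun x => (ups x)%:C * trace b u x * (trace b v x)^*).

Definition toeplitz (b : R) (ups : R * R -> R) (q : nat) :=
  form_operator (landau_space b q) (landau_space b q) (toeplitz_form b ups).

Definition toeplitz_ker (b : R) (ups : R * R -> R) (q : nat) :
    set (R * R -> R[i]) :=
  [set u | toeplitz b ups q u (fun=> 0)].

End Curve.

(* Main.v *)
From HB Require Import structures.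
Require Import Defs.
From mathcomp Require Import all_boot all_order all_algebra.
From mathcomp Require Import all_classical all_reals all_analysis.
From mathcomp Require Import complex.
From mathcomp Require Import measurable_realfun ring lra.

Set Implicit Arguments.
Unset Strict Implicit.
Unset Printing Implicit Defensive.

Import Order.TTheory GRing.Theory Num.Theory.
Import numFieldNormedType.Exports.

Local Open Scope classical_set_scope.
Local Open Scope ring_scope.

Local Notation Plane R := (measurableTypeR R * measurableTypeR R)%type.
Local Notation Re := complex.Re.
Local Notation Im := complex.Im.

(** A null function is in the kernel because all the forms involved vanish on
    it. For the converse let u be in the kernel. Taking u as second argument in
    the form gives that the integral over the curve of ups |tau u|^2 is 0. As
    ups >= 0, the trace of u vanishes almost everywhere on the set where
    ups > 0, and this set is not null. The theorem follows from two facts: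
    functions of the lowest Landau level are, up to a Gaussian factor, entire
    holomorphic functions of z = x_1 + i x_2; and their traces are their
    restrictions. An entire function with a cluster point of zeros is 0.

    The first fact. Let D = Pi_1 + i Pi_2 and D' = Pi_1 - i Pi_2. Since
    [Pi_1, Pi_2] = i b, one has D' D = H_0 - b, so D' (D u) = 0 as a
    distribution ([adjoint_eq]). Thus conj(D u) exp(- b |x|^2 / 4) is weakly
    holomorphic and in L^2, hence 0 by Liouville ([liouville_L2],
    [annihilated]). Now D u = 0 says that u exp(b |x|^2 / 4) is weakly
    holomorphic ([ground_holomorphic]).

    Weakly holomorphic means orthogonal to (d_1 + i d_2) phi for all test
    functions phi. Such functions are studied with a Cauchy kernel smoothed in
    the disc |z - w|^2 < d and cut off at distance r. This yields a mean value
    formula whose averages do not depend on d ([mean_value]); letting d tend to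
    0 recovers the function almost everywhere ([averages_limit]). An average at
    a fixed scale is a smooth representative ([regular_ae]); the bound O(1/r)
    for the Cauchy integral of an L^2 function is the Liouville theorem; and
    the geometric expansion of the kernel, at arbitrarily large r, gives unique
    continuation from a cluster point of zeros ([unique_continuation]). All of
    this is collected in [ground_smooth].

    The second fact. On a short piece of the curve one coordinate moves with
    speed bounded below, and the integral of |psi|^2 over it is at most a
    constant times the squared magnetic Sobolev norm of psi ([trace_piece]). Hence the
    trace is unique up to null sets of the curve ([trace_unique]). Cutoffs of
    the smooth representative show that its restriction is a trace
    ([smooth_is_trace]), so it is the trace ([trace_smooth]).

    Finally, a set of parameters that is not null has a cluster point, and the
    parametrisation is locally injective, so the representative has a cluster
    point of zeros in the plane ([zeros_cluster]). *)

(** * Measurability and integration on the plane *)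

Section Toolkit.
Context {R : realType}.
Implicit Types f g : R * R -> R.

Definition meas2 f := measurable_fun (setT : set (Plane R)) f.

Definition aep (P : R * R -> Prop) := {ae @leb2 R, forall x, P x}.

Lemma aep_all (P : R * R -> Prop) : (forall x, P x) -> aep P.
Proof. by move=> h; exact: aeW. Qed.

Lemma aep_sub (P Q : R * R -> Prop) : (forall x, P x -> Q x) -> aep P -> aep Q.
Proof. exact: (@filterS _ _ (ae_filter_ringOfSetsType (@leb2 R))). Qed.

Lemma aep_and (P Q : R * R -> Prop) : aep P -> aep Q -> aep (fun x => P x /\ Q x).
Proof. exact: (@filterI _ _ (ae_filter_ringOfSetsType (@leb2 R))). Qed.

Lemma aep_bigcap (P : nat -> R * R -> Prop) : (forall n, aep (P n)) ->
  aep (fun x => forall n, P n x).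
Proof.
move=> h.
change ((@leb2 R).-negligible (~` [set x : Plane R | forall n, P n x])).
rewrite (_ : ~` _ = \bigcup_n ~` [set x | P n x]).
  by apply: negligible_bigcup => n; exact: h.
by apply/seteqP; split => x /= => [/existsNP[n nP]|[n _ nP]]; [exists n|move/(_ n)].
Qed.

Definition integ f := (@leb2 R).-integrable (setT : set (Plane R)) (EFin \o f).

Definition I2 f : R := \int[@leb2 R]_(x in (setT : set (Plane R))) f x.

(** The sigma-algebra is the product one, so an open set has to be written as
    a union of the countably many squares with rational centre and radius that
    it contains. *)
Lemma measurable_plane_open (U : set (R * R)) : open U ->
  measurable (U : set (Plane R)).
Proof.
move=> oU.
pose B (q : rat * rat * rat) : set (Plane R) :=
  ball (ratr q.1.1 : R) (ratr q.2) `*` ball (ratr q.1.2 : R) (ratr q.2).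
have mB q : measurable (B q).
  by apply: measurableX; apply: open_measurable; exact: ball_open.
have -> : U = \bigcup_q (if `[< B q `<=` U >] then B q else set0).
  apply/seteqP; split => [x Ux|x [q _]]; last by case: asboolP => // + Bx; apply.
  have /nbhs_ballP[e /= e0 xeU] : nbhs x U by exact: open_nbhs_nbhs.
  have [r re] := rat_in_itvoo (divr_gt0 e0 (ltr0n R 2)).
  move: re; rewrite in_itv/= => /andP[r0 re].
  have wide (t : R) : t - ratr r < t + ratr r by lra.
  have [p1 +] := rat_in_itvoo (wide x.1); have [p2 +] := rat_in_itvoo (wide x.2).
  rewrite !in_itv/= => /andP[p2l p2r] /andP[p1l p1r].
  exists (p1, p2, r) => //; rewrite ifT; last first.
    apply/asboolP => y [/= y1 y2]; apply: xeU; split => /=.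
    + by move: y1; rewrite /ball/= !ltr_norml => /andP[? ?]; apply/andP; split; lra.
    + by move: y2; rewrite /ball/= !ltr_norml => /andP[? ?]; apply/andP; split; lra.
  by split => /=; rewrite /ball/= ltr_norml; apply/andP; split; lra.
apply: countable_bigcupT_measurable => //.
by move=> q; case: asboolP.
Qed.

Lemma continuous_meas2 f : continuous f -> meas2 f.
Proof.
move=> cf; apply: (measurability _ (RGenOpens.measurableE R)).
move=> _ [_ [a [b ->] <-]]; rewrite setTI; apply: measurable_plane_open.
by move: cf => /continuousP; apply; exact: interval_open.
Qed.


Lemma meas2_EFin f : meas2 f ->
  measurable_fun (setT : set (Plane R)) (EFin \o f).
Proof. by move=> mf; apply/measurable_EFinP. Qed.

Lemma integD f g : integ f -> integ g -> integ (fun x => f x + g x).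
Proof. by move=> hf hg; exact: (integrableD measurableT hf hg). Qed.

Lemma integB f g : integ f -> integ g -> integ (fun x => f x - g x).
Proof. by move=> hf hg; exact: (integrableB measurableT hf hg). Qed.

Lemma integZ (c : R) f : integ f -> integ (fun x => c * f x).
Proof. by move=> hf; exact: (integrableZl measurableT c hf). Qed.

Lemma integN f : integ f -> integ (fun x => - f x).
Proof. by move=> hf; exact: (integrableN hf). Qed.

Lemma integ_meas f : integ f -> meas2 f.
Proof. by move=> /integrableP[/measurable_EFinP]. Qed.

Lemma integ_le f g : meas2 f -> (forall x, `|f x| <= g x) -> integ g -> integ f.
Proof.
move=> mf fg; apply: le_integrable => //; first exact/measurable_EFinP.
by move=> x _ /=; rewrite lee_fin (le_trans (fg x))// ler_norm.
Qed.

Lemma integ_norm f : integ f -> integ (fun x => `|f x|).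
Proof. by move=> hf; exact: (integrable_norm hf). Qed.

Lemma I2D f g : integ f -> integ g -> I2 (fun x => f x + g x) = I2 f + I2 g.
Proof. by move=> hf hg; rewrite /I2 RintegralD. Qed.

Lemma I2B f g : integ f -> integ g -> I2 (fun x => f x - g x) = I2 f - I2 g.
Proof. by move=> hf hg; rewrite /I2 RintegralB. Qed.

Lemma I2Z (c : R) f : integ f -> I2 (fun x => c * f x) = c * I2 f.
Proof. by move=> hf; rewrite /I2 RintegralZl. Qed.

Lemma I2N f : integ f -> I2 (fun x => - f x) = - I2 f.
Proof.
move=> hf; rewrite -mulN1r -I2Z//.
by congr I2; apply/funext => x; rewrite mulN1r.
Qed.

Lemma le_I2 f g : integ f -> integ g -> (forall x, f x <= g x) -> I2 f <= I2 g.
Proof. by move=> hf hg fg; apply: le_Rintegral. Qed.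

Lemma I2_norm f : integ f -> `|I2 f| <= I2 (fun x => `|f x|).
Proof. by move=> hf; exact: le_normr_Rintegral. Qed.

Lemma I2_ge0 f : (forall x, 0 <= f x) -> 0 <= I2 f.
Proof. by move=> f0; apply: Rintegral_ge0. Qed.

Lemma I2_EFin f : integ f -> (I2 f)%:E = (\int[@leb2 R]_x (f x)%:E)%E.
Proof. by move=> hf; rewrite /I2 /Rintegral fineK//; exact: integrable_fin_num. Qed.

Lemma I2_ae f g : meas2 f -> meas2 g -> aep (fun x => f x = g x) ->
  I2 f = I2 g.
Proof.
move=> mf mg fg; congr fine; apply: ae_eq_integral => //.
- exact/measurable_EFinP.
- exact/measurable_EFinP.
- by apply: aep_sub fg => x /= -> _.
Qed.

Lemma integ_ae f g : integ f -> meas2 g -> aep (fun x => f x = g x) ->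
  integ g.
Proof.
move=> /integrableP[mf fi] mg fg; apply/integrableP; split.
  exact/measurable_EFinP.
suff <- : (\int[@leb2 R]_x `|(EFin \o f) x| = \int[@leb2 R]_x `|(EFin \o g) x|)%E by [].
apply: ge0_ae_eq_integral => //.
- by apply: measurableT_comp => //; exact/measurable_EFinP.
- by apply: measurableT_comp => //; exact/measurable_EFinP.
- by apply: aep_sub fg => x /= -> _.
Qed.

Lemma I2_cvg (F : nat -> R * R -> R) f g : (forall n, meas2 (F n)) ->
  meas2 f -> aep (fun x => F ^~ x @ \oo --> f x) ->
  integ g -> (forall n x, `|F n x| <= g x) -> I2 (F n) @[n --> \oo] --> I2 f.
Proof.
move=> mF mf Ff hg Fg.
have [|||||fi _ h] := @dominated_convergence _ _ _ (@leb2 R) setT measurableT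
    (fun n => EFin \o F n) (EFin \o f) (EFin \o g).
- by move=> n; apply/measurable_EFinP; exact: mF.
- by apply/measurable_EFinP; exact: mf.
- by apply: aep_sub Ff => x h _; apply/fine_cvgP; split; [exact: nearW|exact: h].
- exact: hg.
- by apply: aeW => x n _ /=; rewrite lee_fin.
apply: (fine_cvg (f := fun n => (\int[@leb2 R]_x (F n x)%:E)%E)).
by rewrite [X in _ --> X](_ : _ = (\int[@leb2 R]_x (f x)%:E)%E)//; exact: I2_EFin.
Qed.


(** The truncation is to a ball of the sup norm of the plane, that is, to a
    box, on which Lebesgue measure is a product. *)
Definition trunc (r : R) f (x : R * R) := if `|x| <= r then f x else 0.

(** Local integrability. Functions of this class are what distributional
    identities are about: every product with a test function is integrable. *)
Definition loci f := meas2 f /\ forall r, integ (trunc r f).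

Lemma meas2_trunc r f : meas2 f -> meas2 (trunc r f).
Proof.
move=> mf; apply: measurable_fun_if => //; last exact: measurable_funTS.
apply: measurable_fun_ler => //.
by apply: continuous_meas2; exact: norm_continuous.
Qed.

Lemma meas2_cst c : meas2 (fun=> c).
Proof. exact: measurable_cst. Qed.

Lemma leb2X (A B : set (measurableTypeR R)) : measurable A -> measurable B ->
  @leb2 R (A `*` B) = (@lebesgue_measure R A * @lebesgue_measure R B)%E.
Proof. exact: product_measure1E. Qed.

Lemma integ_trunc1 r : integ (trunc r (fun=> 1)).
Proof.
apply/integrableP; split; first by apply: meas2_EFin; apply: meas2_trunc; exact: meas2_cst.
pose B : set (measurableTypeR R) := [set` `[- `|r|, `|r|]]%R.
have mB : measurable B by exact: measurable_itv.
apply: (@le_lt_trans _ _ (\int[@leb2 R]_x (\1_(B `*` B : set (Plane R)) x)%:E)%E).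
  apply: ge0_le_integral => //.
  - apply: measurableT_comp => //.
    by apply: meas2_EFin; apply: meas2_trunc; exact: meas2_cst.
  - by apply: meas2_EFin; apply: measurable_indic; exact: measurableX.
  - move=> x _ /=; rewrite lee_fin /trunc; case: ifPn => xr; last by rewrite normr0.
    rewrite normr1 indicE mem_set//; move: xr; rewrite prod_normE ge_max.
    move=> /andP[x1 x2].
    by split; rewrite /B /= in_itv/= -ler_norml (le_trans _ (ler_norm r)).
rewrite integral_indic//; last exact: measurableX.
rewrite (_ : _ `&` _ = B `*` B); last by rewrite setIT.
rewrite leb2X// !lebesgue_measure_itv /=.
by case: ifPn => _; rewrite -?EFinB -?EFinM ?mule0 ltry.
Qed.

Lemma meas2M f g : meas2 f -> meas2 g -> meas2 (fun x => f x * g x).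
Proof. exact: measurable_funM. Qed.

Lemma meas2D f g : meas2 f -> meas2 g -> meas2 (fun x => f x + g x).
Proof. exact: measurable_funD. Qed.

Lemma meas2N f : meas2 f -> meas2 (fun x => - f x).
Proof. by move=> mf; exact: (measurableT_comp _ mf). Qed.

Lemma compact_box (r : R) : compact (`[- r, r]%classic `*` `[- r, r]%classic : set (R * R)).
Proof. by apply: compact_setX; exact: segment_compact. Qed.

Lemma box_normE (r : R) (x : R * R) :
  (`[- r, r]%classic `*` `[- r, r]%classic) x <-> `|x| <= r.
Proof.
rewrite prod_normE ge_max; split => /= [[]|/andP[]]; rewrite !in_itv /= !ler_norml.
  by move=> -> ->.
by move=> -> ->.
Qed.

Lemma continuous_bounded_box f (r : R) : continuous f ->
  exists2 M : R, 0 <= M & forall x : R * R, `|x| <= r -> `|f x| <= M.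
Proof.
move=> cf; have : compact (f @` (`[- r, r]%classic `*` `[- r, r]%classic)).
  by apply: continuous_compact; [exact: continuous_subspaceT|exact: compact_box].
move=> /compact_bounded[M [_ /(_ (Num.max (M + 1) 0)) h]].
exists (Num.max (M + 1) 0) => [|x xr]; first by rewrite le_max lexx orbT.
apply: h; first by rewrite lt_max ltrDl ltr01.
by exists x => //; exact/box_normE.
Qed.

Lemma loci_integM f (phi : R * R -> R) r : loci f -> continuous phi ->
  (forall x, phi x != 0 -> `|x| <= r) -> integ (fun x => f x * phi x).
Proof.
move=> [mf fr] cphi sphi.
have [M M0 phiM] := continuous_bounded_box r cphi.
apply: (@integ_le _ (fun x => M * `|trunc r f x|)).
- by apply: meas2M => //; exact: continuous_meas2.
- move=> x; rewrite normrM mulrC /trunc.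
  have [->|/sphi xr] := eqVneq (phi x) 0; first by rewrite normr0 mul0r mulr_ge0.
  by rewrite xr ler_wpM2r// phiM.
- exact/integZ/integ_norm.
Qed.

Lemma lociD f g : loci f -> loci g -> loci (fun x => f x + g x).
Proof.
move=> [mf fr] [mg gr]; split=> [|r]; first exact: meas2D.
apply: eq_integrable (integD (fr r) (gr r)) => //= x _ /=.
by rewrite /trunc; case: ifPn => // _; rewrite addr0.
Qed.

Lemma lociM f (phi : R * R -> R) : loci f -> continuous phi ->
  loci (fun x => f x * phi x).
Proof.
move=> [mf fr] cphi; split=> [|r].
  by apply: meas2M => //; exact: continuous_meas2.
have [M M0 phiM] := continuous_bounded_box r cphi.
apply: (@integ_le _ (fun x => M * `|trunc r f x|)).
- by apply: meas2_trunc; apply: meas2M => //; exact: continuous_meas2.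
- move=> x; rewrite /trunc; case: ifPn => [xr|_]; last by rewrite normr0 mulr0.
  by rewrite normrM mulrC ler_wpM2r// phiM.
- exact/integZ/integ_norm.
Qed.

Lemma lociN f : loci f -> loci (fun x => - f x).
Proof.
move=> hf; rewrite (_ : (fun x => _) = (fun x => f x * -1)).
  by apply: (lociM hf) => x; exact: cvg_cst.
by apply/funext => x; rewrite mulrN1.
Qed.

Lemma lociB f g : loci f -> loci g -> loci (fun x => f x - g x).
Proof. by move=> hf hg; apply: lociD => //; exact: lociN. Qed.

Lemma loci_cst c : loci (fun=> c).
Proof.
split=> [|r]; first exact: meas2_cst.
apply: eq_integrable (integZ c (integ_trunc1 r)) => //= x _ /=.
by rewrite /trunc; case: ifPn; rewrite ?mulr1 ?mulr0.
Qed.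

Lemma continuous_loci f : continuous f -> loci f.
Proof.
move=> cf; rewrite (_ : f = (fun x => 1 * f x)).
  exact: lociM (loci_cst 1) cf.
by apply/funext => x; rewrite mul1r.
Qed.

(** On a box, |f| <= 1 + f^2 and the constant 1 is integrable. *)
Lemma integ_sq_loci f : meas2 f -> integ (fun x => f x ^+ 2) -> loci f.
Proof.
move=> mf f2; split=> // r.
apply: (@integ_le _ (fun x => trunc r (fun=> 1) x + f x ^+ 2)).
- exact: meas2_trunc.
- move=> x; rewrite /trunc; case: ifPn => [_|_].
  + rewrite -[f x ^+ 2]real_normK ?num_real//; nra.
  + by rewrite normr0 add0r sqr_ge0.
- by apply: integD => //; exact: integ_trunc1.
Qed.

End Toolkit.

(** * Smooth functions, cutoffs and test functions *)

Section Smooth.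
Context {R : realType}.
Implicit Types f g : R * R -> R.

Lemma is_derive_line (V : normedModType R) (f : V -> R) (x v : V) (d : R) :
  is_derive x v f d <-> is_derive (0 : R) 1 (fun h : R => f (h *: v + x)) d.
Proof.
have E : (fun h : R => h^-1 *: ((f \o shift x) (h *: v) - f x)) =
  (fun h : R => h^-1 *: (((fun h : R => f (h *: v + x)) \o shift 0) (h *: 1) -
                         f (0 *: v + x))).
  by apply/funext => h /=; rewrite addr0 scale0r add0r [_%:A]mulr1.
rewrite /derivable /derive.
split => -[h1 h2]; apply: DeriveDef; move: h1 h2; rewrite /derivable /derive.
- by rewrite E.
- by rewrite E.
- by rewrite -E.
- by rewrite -E.
Qed.

Lemma is_derive_slice1 f (s y d : R) :
  is_derive (s, y) (basis_vec 0) f d -> is_derive s (1 : R) (fun s => f (s, y)) d.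
Proof.
move=> /is_derive_line h; apply/is_derive_line.
rewrite (_ : (fun _ => _) = (fun h : R => f (h *: basis_vec 0 + (s, y))))//.
apply/funext => t; congr (f _).
by apply: injective_projections; rewrite /= ?scaler0 ?add0r.
Qed.

Lemma is_derive_slice2 f (s x d : R) :
  is_derive (x, s) (basis_vec 1) f d -> is_derive s (1 : R) (fun s => f (x, s)) d.
Proof.
move=> /is_derive_line h; apply/is_derive_line.
rewrite (_ : (fun _ => _) = (fun h : R => f (h *: basis_vec 1 + (x, s))))//.
apply/funext => t; congr (f _).
by apply: injective_projections; rewrite /= ?scaler0 ?add0r.
Qed.

Lemma is_derive_comp1 (V : normedModType R) (g : R -> R) (f : V -> R) (x v : V)
    (a b : R) : is_derive (f x) 1 g a -> is_derive x v f b ->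
  is_derive x v (fun x => g (f x)) (a * b).
Proof.
move=> ga /is_derive_line fb; apply/is_derive_line.
apply: (is_derive1_comp (f := g)) => //.
by rewrite scale0r add0r.
Qed.

Definition smooth f := forall k, Ck k f.

Lemma smooth_continuous f : smooth f -> continuous f.
Proof. by move=> /(_ 0). Qed.

Lemma smooth_derivable f x j : smooth f -> derivable f x (basis_vec j).
Proof. by move=> /(_ 1)[_ /(_ j)[]]. Qed.

Lemma smooth_partial f j : smooth f -> smooth (partial j f).
Proof. by move=> sf k; have [_ /(_ j)[]] := sf k.+1. Qed.

Lemma smooth_is_derive f x j : smooth f ->
  is_derive x (basis_vec j) f (partial j f x).
Proof. by move=> sf; exact/derivableP/smooth_derivable. Qed.

Lemma CkW k f : Ck k.+1 f -> Ck k f.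
Proof.
elim: k f => [|k IH] f; first by case.
by move=> [cf h]; split=> // j; have [h1 h2] := h j; split=> //; exact: IH.
Qed.

Lemma partialE f j (d : R * R -> R) :
  (forall x, is_derive x (basis_vec j) f (d x)) -> partial j f = d.
Proof. by move=> h; apply/funext => x; exact: derive_val. Qed.

(** The class C^k is defined with the total operator of partial
    differentiation. This form takes explicit derivatives instead, which is
    what inductions on k for products, inverses and compositions provide. *)
Lemma Ck_S k f (d : 'I_2 -> R * R -> R) : continuous f ->
  (forall j x, is_derive x (basis_vec j) f (d j x)) -> (forall j, Ck k (d j)) ->
  Ck k.+1 f.
Proof.
move=> cf h1 h2; split=> // j; split; last by rewrite (partialE (h1 j)).
by move=> x; exact: ex_derive.
Qed.

Lemma CkS_is_derive k f j x : Ck k.+1 f ->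
  is_derive x (basis_vec j) f (partial j f x).
Proof. by move=> [_ /(_ j)[h _]]; exact/derivableP. Qed.

Lemma CkS_partial k f j : Ck k.+1 f -> Ck k (partial j f).
Proof. by move=> [_ /(_ j)[]]. Qed.

Lemma Ck_continuous k f : Ck k f -> continuous f.
Proof. by case: k => // k []. Qed.

Lemma CkD k f g : Ck k f -> Ck k g -> Ck k (fun x => f x + g x).
Proof.
elim: k f g => [|k IH] f g hf hg.
  by move=> x; apply: cvgD; [exact: hf|exact: hg].
apply: (@Ck_S _ _ (fun j x => partial j f x + partial j g x)).
- by move=> x; apply: cvgD; [exact: (Ck_continuous hf)|exact: (Ck_continuous hg)].
- move=> j x; have h1 := CkS_is_derive j x hf; have h2 := CkS_is_derive j x hg.
  exact: (is_deriveD (f := f) (g := g)).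
- by move=> j; apply: IH; exact: CkS_partial.
Qed.

Lemma CkM k f g : Ck k f -> Ck k g -> Ck k (fun x => f x * g x).
Proof.
elim: k f g => [|k IH] f g hf hg.
  by move=> x; apply: cvgM; [exact: hf|exact: hg].
apply: (@Ck_S _ _ (fun j x => f x * partial j g x + g x * partial j f x)).
- by move=> x; apply: cvgM; [exact: (Ck_continuous hf)|exact: (Ck_continuous hg)].
- move=> j x; have h1 := CkS_is_derive j x hf; have h2 := CkS_is_derive j x hg.
  exact: (is_deriveM (f := f) (g := g)).
- by move=> j; apply: CkD; apply: IH; try exact: CkS_partial; exact: CkW.
Qed.

Lemma Ck_cst k (c : R) : Ck k (fun=> c).
Proof.
elim: k c => [|k IH] c; first by move=> x; exact: cvg_cst.
apply: (@Ck_S _ _ (fun _ _ => 0)) => //.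
by move=> x; exact: cvg_cst.
Qed.

Lemma CkV k f : (forall x, f x != 0) -> Ck k f -> Ck k (fun x => (f x)^-1).
Proof.
move=> f0; elim: k => [|k IH] hf.
  by move=> x; apply: cvgV => //; exact: hf.
apply: (@Ck_S _ _ (fun j x => -1 * ((f x)^-1 * (f x)^-1) * partial j f x)).
- by move=> x; apply: cvgV => //; exact: (Ck_continuous hf).
- move=> j x; have fd := CkS_is_derive j x hf.
  apply: is_derive_eq.
    apply: DeriveDef; first by apply: derivableV => //; exact: ex_derive.
    by rewrite deriveV//; exact: ex_derive.
  by rewrite -exprVn expr2 mulN1r.
- move=> j; apply: CkM; last exact: CkS_partial.
  by apply: CkM; [exact: Ck_cst|apply: CkM; apply: IH; exact: CkW].
Qed.

Lemma smoothD f g : smooth f -> smooth g -> smooth (fun x => f x + g x).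
Proof. by move=> hf hg k; exact: CkD. Qed.

Lemma smoothM f g : smooth f -> smooth g -> smooth (fun x => f x * g x).
Proof. by move=> hf hg k; exact: CkM. Qed.

Lemma smooth_cst c : smooth (fun=> c).
Proof. by move=> k; exact: Ck_cst. Qed.

Lemma smoothV f : (forall x, f x != 0) -> smooth f -> smooth (fun x => (f x)^-1).
Proof. by move=> f0 hf k; exact: CkV. Qed.

Lemma smoothN f : smooth f -> smooth (fun x => - f x).
Proof.
move=> hf; rewrite (_ : (fun x => _) = (fun x => -1 * f x)).
  by apply: smoothM => //; exact: smooth_cst.
by apply/funext => x; rewrite mulN1r.
Qed.

Lemma smoothB f g : smooth f -> smooth g -> smooth (fun x => f x - g x).
Proof. by move=> hf hg; apply: smoothD => //; exact: smoothN. Qed.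

Lemma is_derive_affine (c d x : R) : is_derive x 1 (fun h : R => h * c + d) c.
Proof.
have h1 := is_deriveM (is_derive_id x (1 : R)) (is_derive_cst c x (1 : R)).
have h2 := is_deriveD h1 (is_derive_cst d x (1 : R)).
apply: (is_derive_eq h2).
by rewrite scaler0 add0r addr0 /cst /GRing.scale /= mulr1.
Qed.

Lemma is_derive_fst (x v : R * R) : is_derive x v (fun x : R * R => x.1) v.1.
Proof.
apply/is_derive_line; rewrite (_ : (fun h => _) = (fun h : R => h * v.1 + x.1))//.
exact: is_derive_affine.
Qed.

Lemma is_derive_snd (x v : R * R) : is_derive x v (fun x : R * R => x.2) v.2.
Proof.
apply/is_derive_line; rewrite (_ : (fun h => _) = (fun h : R => h * v.2 + x.2))//.
exact: is_derive_affine.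
Qed.

Lemma smooth_fst : smooth (fun x => x.1).
Proof.
case=> [|k]; first by move=> x; exact: cvg_fst.
apply: (@Ck_S _ _ (fun j _ => (basis_vec j).1)).
- by move=> x; exact: cvg_fst.
- by move=> j x; exact: is_derive_fst.
- by move=> j; exact: Ck_cst.
Qed.

Lemma smooth_snd : smooth (fun x => x.2).
Proof.
case=> [|k]; first by move=> x; exact: cvg_snd.
apply: (@Ck_S _ _ (fun j _ => (basis_vec j).2)).
- by move=> x; exact: cvg_snd.
- by move=> j x; exact: is_derive_snd.
- by move=> j; exact: Ck_cst.
Qed.

(** Smoothness on the line, through iterated derivatives; composing with a
    function of this kind preserves smoothness on the plane. *)
Definition smooth1 (g : R -> R) := forall n x, derivable (derive1n n g) x 1.

Lemma smooth1_derive1 (g : R -> R) : smooth1 g -> smooth1 (derive1 g).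
Proof. by move=> hg n x; rewrite -derive1Sn; exact: hg. Qed.

Lemma smooth1_is_derive (g : R -> R) (x : R) : smooth1 g ->
  is_derive x 1 g (derive1 g x).
Proof. by move=> hg; rewrite derive1E; apply/derivableP; exact: (hg 0). Qed.

Lemma smooth1_continuous (g : R -> R) : smooth1 g -> continuous g.
Proof.
by move=> hg x; apply/differentiable_continuous/derivable1_diffP; exact: (hg 0).
Qed.

Lemma smooth_comp1 (g : R -> R) f : smooth1 g -> smooth f ->
  smooth (fun x => g (f x)).
Proof.
move=> hg hf k; elim: k g hg => [|k IH] g hg.
  by move=> x; apply: (continuous_comp (f := f) (g := g) (smooth_continuous hf (x := x)));
    exact: smooth1_continuous.
apply: (@Ck_S _ _ (fun j x => derive1 g (f x) * partial j f x)).
- by move=> x; apply: (continuous_comp (f := f) (g := g) (smooth_continuous hf (x := x)));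
    exact: smooth1_continuous.
- move=> j x; apply: is_derive_comp1; [exact: smooth1_is_derive|exact: smooth_is_derive].
- by move=> j; apply: CkM; [apply: IH; exact: smooth1_derive1|exact: smooth_partial].
Qed.

Lemma smooth1_expR : smooth1 (@expR R).
Proof.
have E : derive1 (@expR R) = expR.
  by apply/funext => x; rewrite derive1E derive_val.
move=> n x; suff -> : derive1n n (@expR R) = expR by [].
by elim: n => // n IH; rewrite derive1nS IH.
Qed.


(** A quadratic remainder forces differentiability; explicit remainder bounds
    are easier to obtain than limits of difference quotients for the flat
    functions and for convolutions. *)
Lemma is_derive_quad (f : R -> R) (x d C : R) :
  (forall h, `|h| <= 1 -> `|f (x + h) - f x - h * d| <= C * h ^+ 2) ->
  is_derive x 1 f d.
Proof.
move=> hC; have C0 : 0 <= C.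
  by have := hC 1; rewrite normr1 lexx expr1n mulr1 => /(_ isT); exact: le_trans.
suff h : (fun h : R => h^-1 *: ((f \o shift x) (h *: 1) - f x)) @ 0^' --> d.
  by apply: DeriveDef; [apply: cvgP h|exact: cvg_lim h].
apply/cvgrPdist_le => e e0; near=> h.
have h0 : h != 0 by near: h; exact: nbhs_dnbhs_neq.
have h1 : `|h| <= 1.
  by near: h; apply: dnbhs0_le.
have he : `|h| <= e / (C + 1).
  by near: h; apply: dnbhs0_le; rewrite divr_gt0// ltr_wpDl.
rewrite /= [_%:A]mulr1 [_ *: _]mulrC.
have -> : d - (f (h + x) - f x) / h = - (f (x + h) - f x - h * d) / h.
  by rewrite (addrC h x); field.
rewrite normrM normrN normfV ler_pdivrMr ?normr_gt0//.
apply: (le_trans (hC h h1)); rewrite -[h ^+ 2]real_normK ?num_real// expr2 mulrA.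
rewrite ler_wpM2r//.
move: he; rewrite ler_pdivlMr ?ltr_wpDl// => he.
by apply: le_trans he; rewrite mulrC ler_wpM2l// lerDl.
Unshelve. all: by end_near. Qed.

(** The functions p(1/t) exp(-1/t), extended by 0 to t <= 0. The point of
    allowing a polynomial p is that the class is closed under differentiation,
    which proves smoothness by induction. *)
Definition flat (p : {poly R}) (t : R) : R :=
  if 0 < t then p.[t^-1] * expR (- t^-1) else 0.

Lemma pow_expRN_bounded n : exists C : R, forall y : R, 0 <= y ->
  y ^+ n * expR (- y) <= C.
Proof.
exists (n`!%:R) => y y0; rewrite expRN ler_pdivrMr ?expR_gt0//.
case: n => [|n]; first by rewrite expr0 fact0 mul1r -expR0 ler_expR.
have := expR_ge1Dxn n y0; rewrite -lerBrDl => /le_trans -/(_ (expR y)) h.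
rewrite mulrC -ler_pdivrMr ?ltr0n ?fact_gt0//.
by apply: h; rewrite lerBlDr lerDl.
Qed.

(** The exponential beats every polynomial; applied at y = 1/t this gives the
    decay of flat functions at 0. *)
Lemma poly_expRN_bounded (p : {poly R}) : exists2 C : R, 0 <= C &
  forall y : R, 0 <= y -> `|p.[y] * expR (- y)| <= C.
Proof.
have [C hC] := choice (@pow_expRN_bounded).
exists (\sum_(i < size p) `|p`_i| * `|C i|) => [|y y0].
  by apply: sumr_ge0 => i _; rewrite mulr_ge0.
rewrite horner_coef mulr_suml; apply: (le_trans (ler_norm_sum _ _ _)).
apply: ler_sum => i _; rewrite -mulrA normrM ler_wpM2l//.
rewrite ger0_norm ?mulr_ge0 ?exprn_ge0 ?expR_ge0//.
exact: le_trans (hC i y y0) (ler_norm _).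
Qed.

(** For t > 0, the derivative of p(1/t) exp(-1/t) is (1/t)^2 (p - p')(1/t)
    exp(-1/t). At t = 0 the function is bounded by C t^2, because y^2 p(y)
    exp(-y) is bounded. *)
Lemma is_derive_flat (p : {poly R}) (t : R) :
  is_derive t 1 (flat p) (flat ('X^2 * (p - p^`())) t).
Proof.
have [t0|t0|->] := ltgtP t 0.
- rewrite /flat ltNge (ltW t0) /=.
  apply: (@near_eq_is_derive _ _ _ (cst 0)).
  near=> s; rewrite ifF//; apply/negbTE; rewrite -leNgt ltW//.
  by near: s; exact: lt_nbhsl.
- rewrite /flat t0.
  apply: (@near_eq_is_derive _ _ _ (fun s : R => p.[s^-1] * expR (- s^-1))).
    near=> s; rewrite ifT//.
    by near: s; exact: lt_nbhsr.
  have d1 : is_derive t 1 (fun s : R => s^-1) (- t ^- 2).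
    have := @is_deriveV _ id t 1 1 (lt0r_neq0 t0).
    by move=> h; apply: is_derive_eq; rewrite ?scaler1 /GRing.scale /= ?mulr1.
  have d2 : is_derive t 1 (fun s : R => p.[s^-1]) (p^`().[t^-1] * - t ^- 2).
    by apply: (is_derive_comp1 (g := horner p)).
  have d3 : is_derive t 1 (fun s : R => expR (- s^-1)) (expR (- t^-1) * (t ^- 2)).
    apply: is_derive_comp1.
    by have := is_deriveN d1; rewrite opprK.
  have d4 := is_deriveM d2 d3.
  apply: (is_derive_eq d4).
  rewrite !hornerE /GRing.scale /= exprVn; ring.
- rewrite /flat ltxx.
  have [C C0 hC] := poly_expRN_bounded ('X^2 * p).
  apply: (@is_derive_quad _ _ _ C) => h h1.
  rewrite add0r ltxx mulr0 !subr0.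
  have [h0|h0] := ltP 0 h; last by rewrite normr0 mulr_ge0 ?sqr_ge0.
  have := hC h^-1; rewrite invr_ge0 (ltW h0) => /(_ isT).
  rewrite hornerM hornerXn -mulrA normrM ger0_norm ?exprn_ge0 ?invr_ge0 ?(ltW h0)//.
  by rewrite exprVn mulrC ler_pdivrMr ?exprn_gt0.
Unshelve. all: by end_near. Qed.

Lemma smooth1_flat p : smooth1 (flat p).
Proof.
move=> n; have [q ->] : exists q, derive1n n (flat p) = flat q.
  elim: n => [|n [q IH]]; first by exists p.
  exists ('X^2 * (q - q^`())); rewrite derive1nS IH.
  by apply/funext => x; rewrite derive1E; exact: (@derive_val _ _ _ _ _ _ _ (is_derive_flat q x)).
by move=> x; exact: (@ex_derive _ _ _ _ _ _ _ (is_derive_flat q x)).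
Qed.

Definition bump (t : R) : R := flat 1 t.

Lemma bumpE t : bump t = if 0 < t then expR (- t^-1) else 0.
Proof. by rewrite /bump /flat hornerC mul1r. Qed.

Lemma bump_ge0 t : 0 <= bump t.
Proof. by rewrite bumpE; case: ifP => // _; exact: expR_ge0. Qed.

Lemma bump_gt0 t : 0 < t -> 0 < bump t.
Proof. by rewrite bumpE => ->; exact: expR_gt0. Qed.

Lemma bump_eq0 t : t <= 0 -> bump t = 0.
Proof. by rewrite bumpE leNgt => /negbTE ->. Qed.

Lemma derive1_bump t : derive1 bump t = flat 'X^2 t.
Proof.
rewrite derive1E; have h := is_derive_flat 1 t.
change ('D_1 (flat 1) t = flat 'X^2 t).
by rewrite (@derive_val _ _ _ _ _ _ _ h) derivC subr0 mulr1.
Qed.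

Lemma derive1_bump_ge0 t : 0 <= derive1 bump t.
Proof.
rewrite derive1_bump /flat; case: ifP => // _.
by rewrite hornerXn mulr_ge0 ?expR_ge0// sqr_ge0.
Qed.

Lemma smooth1_bump : smooth1 bump.
Proof. exact: smooth1_flat. Qed.


(** A smooth transition, 0 where f <= 0 and 1 where f >= 1. The denominator is
    positive since f and 1 - f cannot both be nonpositive. *)
Definition step f (x : R * R) : R := bump (f x) / (bump (f x) + bump (1 - f x)).

Lemma step_den_gt0 (t : R) : 0 < bump t + bump (1 - t).
Proof.
have [t0|t0] := ltP 0 t; first by rewrite ltr_pwDl ?bump_gt0 ?bump_ge0.
by rewrite ltr_wpDl ?bump_ge0// bump_gt0; lra.
Qed.

Lemma smooth_step f : smooth f -> smooth (step f).
Proof.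
move=> sf; have sb := smooth_comp1 smooth1_bump sf.
apply: smoothM => //; apply: smoothV => [x|].
  by rewrite gt_eqF// step_den_gt0.
apply: smoothD => //; apply: smooth_comp1 smooth1_bump _.
by apply: smoothB => //; exact: smooth_cst.
Qed.

Lemma step_eq0 f x : f x <= 0 -> step f x = 0.
Proof. by move=> fx; rewrite /step bump_eq0// mul0r. Qed.

Lemma step_eq1 f x : 1 <= f x -> step f x = 1.
Proof.
move=> fx; rewrite /step [bump (1 - _)]bump_eq0 ?addr0 ?divff//; last lra.
by rewrite gt_eqF// bump_gt0; lra.
Qed.

Lemma step_ge0 f x : 0 <= step f x.
Proof. by rewrite divr_ge0 ?bump_ge0// ltW// step_den_gt0. Qed.

Lemma step_le1 f x : step f x <= 1.
Proof. by rewrite ler_pdivrMr ?step_den_gt0// mul1r lerDl bump_ge0. Qed.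

Definition supp_box (r : R) f := forall x, f x != 0 -> `|x| <= r.

Lemma supp_box_eq0 r f x : supp_box r f -> r < `|x| -> f x = 0.
Proof. by move=> h; rewrite ltNge; apply: contraNeq; exact: h. Qed.

Lemma near_norm_gt (V : normedModType R) (r : R) (x : V) : r < `|x| -> \near x, r < `|x|.
Proof.
move=> rx; have : open [set y : V | r < `|y|].
  rewrite (_ : [set y | _] = (@Num.norm _ V) @^-1` `]r, +oo[%classic).
    by apply: open_comp; [move=> y _; exact: norm_continuous|exact: rray_open].
  by apply/seteqP; split => y /=; rewrite in_itv/= andbT.
by move=> oU; apply: (@open_nbhs_nbhs _ _ [set y : V | r < `|y|]); split.
Qed.

(** Outside of the box, f vanishes on a whole neighbourhood. *)
Lemma supp_box_partial r f j : supp_box r f -> supp_box r (partial j f).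
Proof.
move=> h x; rewrite leNgt; apply: contraNN => rx.
rewrite /partial (@near_eq_derive _ _ _ f (cst 0)) ?derive_cst//.
have := near_norm_gt rx; apply: filterS => y; exact: supp_box_eq0.
Qed.

(** Compactness of the closure of the support is replaced by the inclusion of
    the support in a box, whose stability under products, sums and derivatives
    is immediate. *)
Lemma test_funP f : test_fun f <-> smooth f /\ exists r : R, supp_box r f.
Proof.
split=> -[sf]; [move=> cf|move=> [r hr]]; split=> //.
  have [M [_ hM]] := compact_bounded cf; exists (M + 1) => x fx.
  by apply: hM; [rewrite ltrDl|apply: subset_closure].
have : closed (`[- r, r]%classic `*` `[- r, r]%classic : set (R * R)).
  have hd : hausdorff_space (R * R)%type by exact: norm_hausdorff.
  exact: (compact_closed hd (@compact_box R r)).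
move=> cB; apply: (subclosed_compact (@closed_closure _ _) (@compact_box R r)).
rewrite ((closure_id _).1 cB).
by apply: closure_subset => x /= /hr /box_normE.
Qed.

Lemma test_smooth f : test_fun f -> smooth f.
Proof. by move=> /test_funP[]. Qed.

Lemma test_partial j f : test_fun f -> test_fun (partial j f).
Proof.
move=> /test_funP[sf [r hr]]; apply/test_funP; split; first exact: smooth_partial.
by exists r; exact: supp_box_partial.
Qed.

Lemma test_mulr f g : test_fun f -> smooth g -> test_fun (fun x => f x * g x).
Proof.
move=> /test_funP[sf [r hr]] sg; apply/test_funP; split; first exact: smoothM.
by exists r => x; rewrite mulf_eq0 negb_or => /andP[/hr].
Qed.

Lemma test_mull f g : smooth f -> test_fun g -> test_fun (fun x => f x * g x).
Proof.
move=> sf tg; rewrite (_ : (fun x => _) = (fun x => g x * f x)); first exact: test_mulr.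
by apply/funext => x; rewrite mulrC.
Qed.

Lemma testD f g : test_fun f -> test_fun g -> test_fun (fun x => f x + g x).
Proof.
move=> /test_funP[sf [r hr]] /test_funP[sg [q hq]]; apply/test_funP.
split; first exact: smoothD.
exists (Num.max r q) => x; rewrite le_max; apply: contraTT; rewrite negb_or -!ltNge.
by move=> /andP[rx qx]; rewrite (supp_box_eq0 hr rx) (supp_box_eq0 hq qx) addr0 eqxx.
Qed.

Lemma testN f : test_fun f -> test_fun (fun x => - f x).
Proof.
move=> tf; rewrite (_ : (fun x => _) = (fun x => f x * -1)).
  by apply: test_mulr => //; exact: smooth_cst.
by apply/funext => x; rewrite mulrN1.
Qed.

Lemma testB f g : test_fun f -> test_fun g -> test_fun (fun x => f x - g x).
Proof. by move=> hf hg; apply: testD => //; exact: testN. Qed.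

Lemma test0 : test_fun (fun=> 0 : R).
Proof.
by apply/test_funP; split; [exact: smooth_cst|exists 0 => x; rewrite eqxx].
Qed.

Lemma partialD j f g : smooth f -> smooth g ->
  partial j (fun x => f x + g x) = fun x => partial j f x + partial j g x.
Proof.
move=> sf sg; apply: partialE => x.
have h1 := smooth_is_derive x j sf; have h2 := smooth_is_derive x j sg.
exact: (is_deriveD (f := f) (g := g)).
Qed.

Lemma partialM j f g : smooth f -> smooth g ->
  partial j (fun x => f x * g x) = fun x => f x * partial j g x + g x * partial j f x.
Proof.
move=> sf sg; apply: partialE => x.
have h1 := smooth_is_derive x j sf; have h2 := smooth_is_derive x j sg.
exact: (is_deriveM (f := f) (g := g)).
Qed.

Lemma partial_cst j (c : R) : partial j (fun=> c) = fun=> 0.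
Proof. by apply: partialE => x; exact: is_derive_cst. Qed.

Lemma partialZ j (c : R) f : smooth f ->
  partial j (fun x => c * f x) = fun x => c * partial j f x.
Proof.
move=> sf; rewrite (partialM j (smooth_cst c) sf) partial_cst.
by apply/funext => x; rewrite mulr0 addr0.
Qed.

Lemma partialN j f : smooth f -> partial j (fun x => - f x) = fun x => - partial j f x.
Proof.
move=> sf; apply: partialE => x; have h1 := smooth_is_derive x j sf.
exact: (is_deriveN (f := f)).
Qed.

Lemma partialB j f g : smooth f -> smooth g ->
  partial j (fun x => f x - g x) = fun x => partial j f x - partial j g x.
Proof.
by move=> sf sg; rewrite (partialD j sf (smoothN sg)) (partialN j sg).
Qed.

Lemma partial_comp1 j (g : R -> R) f : smooth1 g -> smooth f ->
  partial j (fun x => g (f x)) = fun x => derive1 g (f x) * partial j f x.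
Proof.
move=> sg sf; apply: partialE => x.
by apply: is_derive_comp1; [exact: smooth1_is_derive|exact: smooth_is_derive].
Qed.

Lemma partialV j f : (forall x, f x != 0) -> smooth f ->
  partial j (fun x => (f x)^-1) = fun x => - partial j f x / f x ^+ 2.
Proof.
move=> f0 sf; apply: partialE => x; have fd := smooth_is_derive x j sf.
apply: is_derive_eq.
  apply: DeriveDef; first by apply: derivableV => //; exact: ex_derive.
  by rewrite deriveV//; exact: ex_derive.
by rewrite (@derive_val _ _ _ _ _ _ _ fd) [_ *: _]mulNr mulNr mulrC.
Qed.

Lemma partial_fst j : partial j (fun x : R * R => x.1) = fun=> (basis_vec j).1.
Proof. by apply: partialE => x; exact: is_derive_fst. Qed.

Lemma partial_snd j : partial j (fun x : R * R => x.2) = fun=> (basis_vec j).2.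
Proof. by apply: partialE => x; exact: is_derive_snd. Qed.

End Smooth.

(** * Integration by parts and the fundamental lemma of the calculus of variations *)

Section Parts.
Context {R : realType}.
Implicit Types f g : R * R -> R.

Lemma ftc_interval (k k' : R -> R) (a b : R) : a < b -> continuous k' ->
  (forall x : R, is_derive x 1 k (k' x)) ->
  (\int[@lebesgue_measure R]_(x in `[a, b]) (k' x)%:E = (k b - k a)%:E)%E.
Proof.
move=> ab ck' dk; rewrite EFinB; apply: continuous_FTC2 => //.
- exact: continuous_subspaceT.
- have ck : continuous k.
    move=> x; apply/differentiable_continuous/derivable1_diffP.
    exact: (@ex_derive _ _ _ _ _ _ _ (dk x)).
  split; first by move=> x _; exact: (@ex_derive _ _ _ _ _ _ _ (dk x)).
  + by apply: cvg_at_right_filter; exact: ck.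
  + by apply: cvg_at_left_filter; exact: ck.
- by move=> x _; rewrite derive1E; exact: (@derive_val _ _ _ _ _ _ _ (dk x)).
Qed.

Lemma int_derive_compact (k k' : R -> R) (r : R) : continuous k' ->
  (forall x : R, is_derive x 1 k (k' x)) -> (forall x, r < `|x| -> k x = 0) ->
  (forall x, r < `|x| -> k' x = 0) ->
  (\int[@lebesgue_measure R]_x (k' x)%:E = 0)%E.
Proof.
move=> ck' dk k0 k'0; pose q : R := `|r| + 1.
have rq : r < q by rewrite ltr_pwDr// ler_norm.
have q0 : 0 < q by rewrite ltr_pwDr.
transitivity (\int[@lebesgue_measure R]_(x in `[(- q)%R, q]) (k' x)%:E)%E.
  rewrite [RHS]integral_mkcond; apply: eq_integral => x _.
  rewrite patchE; case: ifPn => // xq; rewrite k'0//; apply: lt_trans rq _.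
  by rewrite ltNge; apply: contra xq; rewrite inE/= in_itv/= ler_norml.
rewrite (@ftc_interval k)//; last lra.
by rewrite !k0 ?subr0// ?normrN ger0_norm// ltW.
Qed.

Lemma continuous_slice1 f y : continuous f -> continuous (fun s : R => f (s, y)).
Proof.
move=> cf s; apply: (@continuous_comp _ _ _ (fun s : R => (s, y)) f); last exact: cf.
exact: (cvg_pair cvg_id (cvg_cst y)).
Qed.

Lemma continuous_slice2 f x : continuous f -> continuous (fun s : R => f (x, s)).
Proof.
move=> cf s; apply: (@continuous_comp _ _ _ (fun s : R => (x, s)) f); last exact: cf.
exact: (cvg_pair (cvg_cst x) cvg_id).
Qed.

Lemma integ_continuous f r : continuous f -> supp_box r f -> integ f.
Proof.
move=> cf hr; rewrite (_ : f = fun x => 1 * f x).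
  exact: (loci_integM (loci_cst 1) cf hr).
by apply/funext => x; rewrite mul1r.
Qed.

Lemma test_integ f : test_fun f -> integ f.
Proof.
move=> /test_funP[sf [r hr]]; exact: integ_continuous (smooth_continuous sf) hr.
Qed.

(** Fubini, and the fundamental theorem of calculus on every line of direction
    j: the primitive vanishes at both ends of a long segment. *)
Lemma I2_partial j f : test_fun f -> I2 (partial j f) = 0.
Proof.
move=> tf; have /test_funP[sf [r hr]] := tf.
have sd := smooth_partial j sf; have cd := smooth_continuous sd.
have hd : supp_box r (partial j f) by exact: supp_box_partial.
have id := test_integ (test_partial j tf).
apply: EFin_inj; rewrite (I2_EFin id).
have [j0|j1] : j = 0 \/ j = 1 by case: j {sd cd hd id} => -[|[|//]] i; [left|right]; apply/val_inj.
- transitivity (\int[lebesgue_measure]_y (fubini_G (@lebesgue_measure R) (EFin \o partial j f) y))%E.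
    by rewrite integral21_prod_meas1.
  rewrite integral0_eq// => y _; rewrite /fubini_G j0.
  apply: (@int_derive_compact (fun s => f (s, y)) _ r).
  + by rewrite -j0; exact: continuous_slice1.
  + by move=> s; apply: is_derive_slice1; exact: smooth_is_derive.
  + by move=> s rs; apply: (supp_box_eq0 hr); rewrite prod_normE lt_max rs.
  + by move=> s rs; rewrite -j0; apply: (supp_box_eq0 hd); rewrite prod_normE lt_max rs.
- transitivity (\int[lebesgue_measure]_y (fubini_F (@lebesgue_measure R) (EFin \o partial j f) y))%E.
    by rewrite integral12_prod_meas1.
  rewrite integral0_eq// => y _; rewrite /fubini_F j1.
  apply: (@int_derive_compact (fun s => f (y, s)) _ r).
  + by rewrite -j1; exact: continuous_slice2.
  + by move=> s; apply: is_derive_slice2; exact: smooth_is_derive.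
  + by move=> s rs; apply: (supp_box_eq0 hr); rewrite prod_normE lt_max rs orbT.
  + by move=> s rs; rewrite -j1; apply: (supp_box_eq0 hd); rewrite prod_normE lt_max rs orbT.
Qed.

Definition IE g (S : set (R * R)) : R := I2 (fun x => g x * \1_S x).

Lemma integ_indic g (S : set (Plane R)) : integ g -> measurable S ->
  integ (fun x => g x * \1_S x).
Proof.
move=> ig mS; apply: (@integ_le _ _ (fun x => `|g x|)).
- by apply: meas2M; [exact: integ_meas|exact: measurable_indic].
- by move=> x; rewrite normrM ler_piMr// indicE; case: (_ \in _); rewrite ?normr0 ?normr1.
- exact: integ_norm.
Qed.

Lemma IE_setC g (S K : set (Plane R)) : integ g -> measurable S -> measurable K ->
  IE g K = 0 -> IE g (S `&` K) = 0 -> IE g (~` S `&` K) = 0.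
Proof.
move=> ig mS mK g0 gS; rewrite /IE.
rewrite (_ : (fun x => _) = (fun x => g x * \1_K x - g x * \1_(S `&` K) x)).
  rewrite I2B ?[I2 _]g0 ?[X in _ - X]gS ?subrr//; apply: integ_indic => //.
  exact: measurableI.
apply/funext => x; rewrite -mulrBr; congr (_ * _).
by rewrite !indicE !in_setI in_setC; case: (x \in S); case: (x \in K);
  rewrite ?subr0 ?subrr.
Qed.

Lemma IE_bigcup g (F : nat -> set (Plane R)) : integ g ->
  (forall n, measurable (F n)) -> trivIset setT F -> (forall n, IE g (F n) = 0) ->
  IE g (\bigcup_n F n) = 0.
Proof.
move=> ig mF tF F0.
have mU : measurable (\bigcup_n F n) by exact: bigcup_measurable.
apply: EFin_inj; rewrite (I2_EFin (integ_indic ig mU)).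
transitivity (\int[@leb2 R]_(x in \bigcup_n F n) (g x)%:E)%E.
  rewrite [RHS]integral_mkcond; apply: eq_integral => x _.
  by rewrite patchE indicE; case: ifPn; rewrite ?mulr1 ?mulr0.
rewrite integral_bigcup//; last exact: integrableS ig.
rewrite eseries0// => n _ _; 
have := I2_EFin (integ_indic ig (mF n)); rewrite [I2 _]F0 => E0; rewrite [RHS]E0 {E0}.
rewrite integral_mkcond; apply: eq_integral => x _.
by rewrite patchE indicE; case: ifPn; rewrite ?mulr1 ?mulr0.
Qed.

Lemma IE_ae0 g : integ g -> (forall S : set (Plane R), measurable S -> IE g S = 0) ->
  aep (fun x => g x = 0).
Proof.
move=> ig h.
have : ae_eq (@leb2 R) setT (EFin \o g) (cst 0%E).
  apply: integral_ae_eq => // E _ mE; rewrite integral0.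
  have := I2_EFin (integ_indic ig mE); rewrite [I2 _]h// => E0; rewrite [RHS]E0 {E0}.
  rewrite integral_mkcond; apply: eq_integral => x _.
  by rewrite patchE indicE; case: ifPn; rewrite ?mulr1 ?mulr0.
by apply: aep_sub => x /(_ I) [].
Qed.

(** The pi-lambda theorem in one coordinate: the half-open intervals form a
    pi-system generating the Borel sets of the line, and the sets A satisfying
    the conclusion form a lambda-system. The whole line belongs to it because
    g is supported in a box, so that the interval ]-|r| - 1, |r|] already
    gives the integral of g over K. *)
Lemma IE_stage g (r : R) (p : R * R -> R) (K : set (Plane R)) : integ g ->
  supp_box r g -> meas2 p -> (forall x, `|p x| <= `|x|) -> measurable K ->
  (forall a b : R, IE g (p @^-1` `]a, b] `&` K) = 0) ->
  forall A : set (measurableTypeR R), measurable A -> IE g (p @^-1` A `&` K) = 0.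
Proof.
move=> ig hr mp pn mK h A mA.
have mpA (B : set (measurableTypeR R)) : measurable B -> measurable (p @^-1` B : set (Plane R)).
  by move=> mB; rewrite -[X in measurable X]setTI; exact: mp.
have K0 : IE g K = 0.
  rewrite -(h (- `|r| - 1) `|r|); congr I2; apply/funext => x.
  have [->|/hr xr] := eqVneq (g x) 0; first by rewrite !mul0r.
  congr (_ * _); rewrite !indicE in_setI [X in X && _]mem_set//=.
  have := le_trans (le_trans (pn x) xr) (ler_norm r).
  by rewrite ler_norml in_itv/= => /andP[? ->]; rewrite andbT; lra.
apply: (@dynkin_induction _ (measurableTypeR R) (@ocitv R) (fun A => IE g (p @^-1` A `&` K) = 0)) => //.
- exact: ocitvI.
- by rewrite preimage_setT setTI.
- by move=> _ [ab _ <-]; exact: h.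
- by move=> S mS S0; rewrite preimage_setC; apply: IE_setC => //; exact: mpA.
- move=> F mF tF F0; rewrite preimage_bigcup setI_bigcupl; apply: IE_bigcup => //.
  + by move=> n; apply: measurableI => //; exact: mpA.
  + by apply: trivIset_setIr; move=> i k _ _ [x [Fix Fkx]];
    exact: (tF i k I I (ex_intro _ (p x) (conj Fix Fkx))).
Qed.

(** One coordinate after the other, half-open rectangles are replaced by
    measurable rectangles; a last use of the pi-lambda theorem reaches the
    product sigma-algebra. *)
Lemma IE_rect_ae0 g r : integ g -> supp_box r g ->
  (forall a b c d : R, IE g (`]a, b]%classic `*` `]c, d]%classic) = 0) ->
  aep (fun x => g x = 0).
Proof.
move=> ig hr h; apply: IE_ae0 => // S.
have mfst : meas2 (fun x : R * R => x.1) by exact: measurable_fst.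
have msnd : meas2 (fun x : R * R => x.2) by exact: measurable_snd.
have XE (A B : set R) : A `*` B = snd @^-1` B `&` (fst @^-1` A).
  by apply/seteqP; split => x [].
have XE' (A B : set R) : A `*` B = fst @^-1` A `&` (snd @^-1` B).
  by apply/seteqP; split => x [].
have nfst (x : R * R) : `|x.1| <= `|x| by rewrite prod_normE le_max lexx.
have nsnd (x : R * R) : `|x.2| <= `|x| by rewrite prod_normE le_max lexx orbT.
have h1 (A B : set (measurableTypeR R)) : measurable A -> measurable B -> IE g (A `*` B) = 0.
  move=> mA mB; rewrite XE; apply: (IE_stage ig hr msnd) => //.
    by rewrite -[X in measurable X]setTI; exact: mfst.
  move=> c d; rewrite -XE XE'; apply: (IE_stage ig hr mfst) => //.
    by rewrite -[X in measurable X]setTI; exact: msnd.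
  by move=> a b; rewrite -XE'.
rewrite measurable_prod_measurableType => mS.
pose G := [set A `*` B | A in (measurable : set (set (measurableTypeR R))) & B in (measurable : set (set (measurableTypeR R)))].
apply: (@dynkin_induction _ (Plane R) G (fun S => IE g S = 0)) => //.
- by rewrite measurable_prod_measurableType.
- move=> _ _ [A1 mA1 [B1 mB1 <-]] [A2 mA2 [B2 mB2 <-]]; rewrite -setXI.
  by exists (A1 `&` A2); [exact: measurableI|exists (B1 `&` B2) => //; exact: measurableI].
- by rewrite -setXTT; exact: h1.
- by move=> _ [A mA [B mB <-]]; exact: h1.
- move=> T mT T0; have := @IE_setC g T setT ig mT measurableT.
  by rewrite !setIT; apply => //; rewrite -setXTT; exact: h1.
- by move=> F mF tF F0; exact: IE_bigcup.
Qed.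


Lemma cvg_cst_eq (c l : R) : (fun _ : nat => c) @ \oo --> l -> l = c.
Proof. by move=> /cvg_lim <- //; exact: lim_cst. Qed.

Lemma smooth_meas2 f : smooth f -> meas2 f.
Proof. by move=> sf; apply: continuous_meas2; exact: smooth_continuous. Qed.

Lemma step_cvg f x :
  step (fun y => n%:R * f y) x @[n --> \oo] --> (if 0 < f x then 1 else 0 : R).
Proof.
case: ifPn => [fx|]; last first.
  rewrite -leNgt => fx; apply: cvg_near_cst; apply: nearW => n.
  by rewrite step_eq0// mulr_ge0_le0.
apply: cvg_near_cst; near=> n; rewrite step_eq1//.
rewrite -ler_pdivrMr//; near: n; exact: nbhs_infty_ger.
Unshelve. all: by end_near. Qed.

(** Products of a function of the first coordinate and a function of the
    second. They suffice to approximate indicators of rectangles, and unlike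
    for general smooth functions the symmetry of their second derivatives can
    be checked directly. *)
Definition prod_test (phi : R * R -> R) := exists A B : R * R -> R,
  [/\ smooth A, smooth B, (forall x y, A (x, y) = A (x, 0)),
      (forall x y, B (x, y) = B (0, y)) & phi = fun x => A x * B x].

(** Smooth functions supported where al < p < b and converging, as n grows, to
    the indicator of al < p <= be inside p < b. The factor with b keeps the
    support inside the region where the hypothesis of the fundamental lemma
    can be applied. *)
Definition itv_step (al b be : R) (n : nat) (p : R * R -> R) (x : R * R) : R :=
  step (fun y => n%:R * (p y - al)) x * step (fun y => n%:R * (b - p y)) x *
  (1 - step (fun y => n%:R * (p y - be)) x).

Lemma smooth_itv_step al b be n p : smooth p -> smooth (itv_step al b be n p).
Proof.
move=> sp; have sc c := @smooth_cst R c.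
apply: smoothM; last by apply: smoothB => //; apply: smooth_step; apply: smoothM => //; exact: smoothB.
by apply: smoothM; apply: smooth_step; apply: smoothM => //; exact: smoothB.
Qed.

Lemma itv_step_supp al b be n p x : itv_step al b be n p x != 0 -> al < p x < b.
Proof.
rewrite /itv_step mulf_eq0 negb_or => /andP[+ _].
rewrite mulf_eq0 negb_or => /andP[h1 h2].
rewrite !ltNge; apply/andP; split; [move: h1|move: h2]; apply: contraNN => h;
  by rewrite step_eq0// mulr_ge0_le0// subr_le0.
Qed.

Lemma itv_step_norm al b be n p x : `|itv_step al b be n p x| <= 1.
Proof.
suff aux (u v w : R) : 0 <= u <= 1 -> 0 <= v <= 1 -> 0 <= w <= 1 -> `|u * v * (1 - w)| <= 1.
  by apply: aux; rewrite step_ge0 step_le1.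
move=> /andP[u0 u1] /andP[v0 v1] /andP[w0 w1].
have w2 : 0 <= 1 - w by rewrite subr_ge0.
by rewrite ger0_norm ?mulr_ge0// !mulr_ile1 ?mulr_ge0// gerBl.
Qed.

Lemma itv_step_cvg al b be p x : itv_step al b be n p x @[n --> \oo] -->
  (\1_[set y | al < p y < b /\ p y <= be] x : R).
Proof.
rewrite (_ : \1__ x = (if 0 < p x - al then 1 else 0) * (if 0 < b - p x then 1 else 0) *
   (1 - (if 0 < p x - be then 1 else 0))).
  apply: cvgM; first by apply: cvgM; exact: step_cvg.
  by apply: cvgB; [exact: cvg_cst|exact: step_cvg].
rewrite !subr_gt0 indicE; case: (boolP (al < p x)) => h1; last first.
  by rewrite !mul0r memNset// => -[]; rewrite (negbTE h1).
case: (boolP (p x < b)) => h2; last first.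
  by rewrite mulr0 mul0r memNset// => -[]; rewrite (negbTE h2) andbF.
rewrite !mul1r ltNge; case: (boolP (p x <= be)) => h3 /=.
  by rewrite subr0 mem_set//= h1 h2.
by rewrite subrr memNset// => -[_]; rewrite (negbTE h3).
Qed.

(** Products of two such transition functions are admissible test functions
    and converge boundedly to the indicator of a half-open rectangle;
    dominated convergence then shows that g has integral 0 on all half-open
    rectangles. *)
Lemma fundamental_box (a b c d : R) g : integ g ->
  (forall phi, test_fun phi -> prod_test phi ->
     (forall x, phi x != 0 -> a < x.1 < b /\ c < x.2 < d) ->
     I2 (fun x => g x * phi x) = 0) ->
  aep (fun x => a < x.1 < b -> c < x.2 < d -> g x = 0).
Proof.
move=> ig h.
pose B := [set x : R * R | a < x.1 < b] `&` [set x : R * R | c < x.2 < d].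
have mfst : meas2 (fun x : R * R => x.1) by exact: measurable_fst.
have msnd : meas2 (fun x : R * R => x.2) by exact: measurable_snd.
have mpre (p : R * R -> R) (i : interval R) : meas2 p ->
    measurable ([set x | p x \in i] : set (Plane R)).
  by move=> mp; have := mp measurableT _ (measurable_itv i); rewrite setTI.
have mB : measurable (B : set (Plane R)).
  by apply: measurableI; [have := mpre _ `]a, b[ mfst|have := mpre _ `]c, d[ msnd];
    congr measurable; apply/seteqP; split => x /=; rewrite in_itv.
pose r : R := `|a| + `|b| + `|c| + `|d|.
have boxr (x : R * R) : a < x.1 < b /\ c < x.2 < d -> `|x| <= r.
  move=> [/andP[ax xb] /andP[cx xd]].
  have hb := ler_norm b; have hd := ler_norm d.
  have ha := ler_norm (- a); have hc := ler_norm (- c); rewrite !normrN in ha hc.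
  have := (normr_ge0 a, normr_ge0 b, normr_ge0 c, normr_ge0 d) => -[[[? ?] ?] ?].
  by rewrite prod_normE ge_max !ler_norml; apply/andP; split; apply/andP; split; rewrite /r; lra.
have : aep (fun x => g x * \1_B x = 0).
  apply: (@IE_rect_ae0 _ r); first exact: integ_indic.
    move=> x; rewrite mulf_eq0 negb_or => /andP[_].
    rewrite indicE; case: (boolP (x \in B)) => [|_]; last by rewrite eqxx.
    by rewrite inE => -[/= h1 h2] _; exact: boxr.
  move=> a1 b1 c1 d1; rewrite /IE.
  pose U n (x : R * R) := itv_step (Num.max a a1) b b1 n (fun x => x.1) x *
     itv_step (Num.max c c1) d d1 n (fun x => x.2) x.
  have sU n : smooth (U n).
    by apply: smoothM; apply: smooth_itv_step; [exact: smooth_fst|exact: smooth_snd].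
  have U0 n : I2 (fun x => g x * U n x) = 0.
    have sA := smooth_itv_step (Num.max a a1) b b1 n smooth_fst.
    have sB := smooth_itv_step (Num.max c c1) d d1 n smooth_snd.
    have Usupp x : U n x != 0 -> a < x.1 < b /\ c < x.2 < d.
      rewrite mulf_eq0 negb_or => /andP[/itv_step_supp + /itv_step_supp].
      by rewrite !gt_max => /andP[/andP[-> _] ->] /andP[/andP[-> _] ->].
    apply: h => //; last by exists (itv_step (Num.max a a1) b b1 n (fun x => x.1)),
      (itv_step (Num.max c c1) d d1 n (fun x => x.2)).
    apply/test_funP; split; first exact: smoothM.
    by exists r => x /Usupp /boxr.
  suff : I2 (fun x => g x * U n x) @[n --> \oo] -->
      I2 (fun x => g x * \1_B x * \1_(`]a1, b1] `*` `]c1, d1]) x).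
    by under eq_cvg do rewrite U0; exact: cvg_cst_eq.
  apply: (@I2_cvg _ _ _ (fun x => `|g x|)).
  - by move=> n; apply: meas2M; [exact: integ_meas|apply: smooth_meas2; exact: sU].
  - apply: meas2M; first by apply: integ_meas; exact: integ_indic.
    apply: measurable_indic; apply: measurableX; exact: measurable_itv.
  - apply: aep_all => x; rewrite -mulrA; apply: cvgM; first exact: cvg_cst.
    rewrite (_ : _ * _ = \1_[set y | Num.max a a1 < y.1 < b /\ y.1 <= b1] x *
         \1_[set y | Num.max c c1 < y.2 < d /\ y.2 <= d1] x).
      by apply: cvgM; exact: itv_step_cvg.
    have I1 (A C : set (R * R)) : \1_A x * \1_C x = \1_(A `&` C) x :> R by rewrite indicI.
    rewrite !I1; congr (\1__ x); apply/seteqP; split => y; rewrite /B /= !in_itv/= !gt_max.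
      by move=> [[/andP[-> ->] /andP[-> ->]] [/andP[-> ->] /andP[-> ->]]].
    by rewrite /B /= => -[[/andP[/andP[-> ->] ->] ->] [/andP[/andP[-> ->] ->] ->]].
  - exact: integ_norm.
  - move=> n x; rewrite normrM ler_piMr// normrM -[leRHS]mulr1.
    by apply: ler_pM => //; exact: itv_step_norm.
by apply: aep_sub => x + h1 h2; rewrite indicE mem_set ?mulr1.
Qed.



(** The derivative of f in direction j is h in the sense of distributions. *)
Definition wd j f h := forall phi, test_fun phi ->
  I2 (fun x => h x * phi x) = - I2 (fun x => f x * partial j phi x).

Lemma loci_integ_test f phi : loci f -> test_fun phi -> integ (fun x => f x * phi x).
Proof.
move=> lf /test_funP[sphi [r hr]].
exact: (loci_integM lf (smooth_continuous sphi) hr).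
Qed.

(** The plane is the union of countably many boxes, and the local statement
    applies to the truncations of f. *)
Lemma fundamental f : loci f ->
  (forall phi, test_fun phi -> prod_test phi -> I2 (fun x => f x * phi x) = 0) ->
  aep (fun x => f x = 0).
Proof.
move=> [mf fr] h.
have : aep (fun x => forall n : nat, - n%:R < x.1 < n%:R -> - n%:R < x.2 < n%:R -> f x = 0).
  apply: aep_bigcap => n.
  have H : aep (fun x => - n%:R < x.1 < n%:R -> - n%:R < x.2 < n%:R -> trunc n%:R f x = 0).
    apply: fundamental_box => // phi tphi pphi hphi.
    rewrite -[RHS](h phi tphi pphi); congr I2; apply/funext => x.
    have [->|/hphi[/andP[? ?] /andP[? ?]]] := eqVneq (phi x) 0; first by rewrite !mulr0.
    rewrite /trunc ifT// prod_normE ge_max !ler_norml.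
    by apply/andP; split; apply/andP; split; exact: ltW.
  apply: aep_sub H => x hx h1 h2; have := hx h1 h2; rewrite /trunc ifT//.
  move: h1 h2 => /andP[? ?] /andP[? ?]; rewrite prod_normE ge_max !ler_norml.
  by apply/andP; split; apply/andP; split; exact: ltW.
apply: aep_sub => x hx.
have := archi_boundP (normr_ge0 x); set n := Num.bound _.
by rewrite prod_normE gt_max !ltr_norml => /andP[h1 h2]; exact: (hx n).
Qed.


Lemma wd_unique j f h h' : loci h -> loci h' -> wd j f h -> wd j f h' ->
  aep (fun x => h x = h' x).
Proof.
move=> lh lh' wh wh'.
suff : aep (fun x => h x - h' x = 0) by apply: aep_sub => x /subr0_eq.
apply: fundamental; first exact: lociB.
move=> phi tphi _; rewrite (_ : (fun x => _) = fun x => h x * phi x - h' x * phi x).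
  by rewrite I2B ?wh ?wh' ?subrr//; exact: loci_integ_test.
by apply/funext => x; rewrite mulrBl.
Qed.

Lemma smooth_loci f : smooth f -> loci f.
Proof. by move=> sf; apply: continuous_loci; exact: smooth_continuous. Qed.

(** Leibniz rule: the product of psi and a test function is a test function,
    so the definition for f can be applied to it. *)
Lemma wdM j f h psi : loci f -> loci h -> smooth psi -> wd j f h ->
  wd j (fun x => f x * psi x) (fun x => h x * psi x + f x * partial j psi x).
Proof.
move=> lf lh spsi w phi tphi; have sphi := test_smooth tphi.
have t1 := test_mulr tphi spsi.
have := w _ t1; rewrite (partialM j sphi spsi) => w1.
have t2 := test_mulr tphi (smooth_partial j spsi).
have t3 := test_mulr (test_partial j tphi) spsi.
rewrite (_ : (fun x => _ * phi x) = fun x => h x * (phi x * psi x) + f x * (phi x * partial j psi x)); last first.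
  by apply/funext => x; ring.
rewrite I2D ?w1; [|exact: loci_integ_test|exact: loci_integ_test].
rewrite (_ : (fun x => f x * (_ + _)) = fun x => f x * (phi x * partial j psi x) + f x * (partial j phi x * psi x)); last first.
  by apply/funext => x; ring.
rewrite I2D; [|exact: loci_integ_test|exact: loci_integ_test].
rewrite (_ : (fun x => f x * psi x * _) = fun x => f x * (partial j phi x * psi x)); last first.
  by apply/funext => x; ring.
by ring.
Qed.

Lemma wd_cst j (c : R) : wd j (fun=> c) (fun=> 0).
Proof.
move=> phi tphi; have tp := test_partial j tphi.
by rewrite !I2Z ?I2_partial ?mul0r ?mulr0 ?oppr0//; exact: test_integ.
Qed.

Lemma wd_smooth j f : smooth f -> wd j f (partial j f).
Proof.
move=> sf; have := wdM (loci_cst 1) (loci_cst 0) sf (@wd_cst j 1).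
rewrite (_ : (fun x => 1 * f x) = f); last by apply/funext => x; rewrite mul1r.
congr wd; apply/funext => x; ring.
Qed.

Lemma wdD j f h f' h' : loci f -> loci h -> loci f' -> loci h' ->
  wd j f h -> wd j f' h' -> wd j (fun x => f x + f' x) (fun x => h x + h' x).
Proof.
move=> lf lh lf' lh' w w' phi tphi.
rewrite (_ : (fun x => _ * phi x) = fun x => h x * phi x + h' x * phi x); last first.
  by apply/funext => x; rewrite mulrDl.
rewrite I2D; [|exact: loci_integ_test|exact: loci_integ_test].
rewrite w// w'// -opprD; congr (- _).
rewrite [in RHS](_ : (fun x => _) = fun x => f x * partial j phi x + f' x * partial j phi x); last first.
  by apply/funext => x; rewrite mulrDl.
by rewrite I2D//; apply: loci_integ_test => //; exact: test_partial.
Qed.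

Lemma wdN j f h : loci f -> loci h -> wd j f h -> wd j (fun x => - f x) (fun x => - h x).
Proof.
move=> lf lh w phi tphi.
rewrite (_ : (fun x => _ * phi x) = fun x => - (h x * phi x)); last first.
  by apply/funext => x; rewrite mulNr.
rewrite I2N; last exact: loci_integ_test.
rewrite w//; congr (- _).
rewrite [in RHS](_ : (fun x => _) = fun x => - (f x * partial j phi x)); last first.
  by apply/funext => x; rewrite mulNr.
by rewrite I2N//; apply: loci_integ_test => //; exact: test_partial.
Qed.

Lemma partial_indep2 f : (forall x y, f (x, y) = f (x, 0)) ->
  partial 1 f = fun=> 0.
Proof.
move=> h; apply: partialE => x; apply/is_derive_line.
rewrite (_ : (fun _ => _) = cst (f x)); first exact: is_derive_cst.
apply/funext => t; case: x => x1 x2; rewrite h (h x1 x2); congr (f (_, _)).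
by rewrite /= scaler0 add0r.
Qed.

Lemma partial_indep1 f : (forall x y, f (x, y) = f (0, y)) ->
  partial 0 f = fun=> 0.
Proof.
move=> h; apply: partialE => x; apply/is_derive_line.
rewrite (_ : (fun _ => _) = cst (f x)); first exact: is_derive_cst.
apply/funext => t; case: x => x1 x2; rewrite h (h x1 x2); congr (f (_, _)).
by rewrite /= scaler0 add0r.
Qed.

Lemma partial_indep2W f j : (forall x y, f (x, y) = f (x, 0)) ->
  forall x y, partial j f (x, y) = partial j f (x, 0).
Proof.
move=> h x y; have h' z : f z = f (z.1, 0) by case: z => z1 z2; rewrite h.
rewrite /partial /derive (_ : (fun t : R => _) =
  (fun t : R => t^-1 *: ((f \o shift (x, 0)) (t *: basis_vec j) - f (x, 0))))//.
by apply/funext => t /=; rewrite (h x y) [in LHS]h' [in X in _ = _ *: (X - _)]h'.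
Qed.

Lemma partial_indep1W f j : (forall x y, f (x, y) = f (0, y)) ->
  forall x y, partial j f (x, y) = partial j f (0, y).
Proof.
move=> h x y; have h' z : f z = f (0, z.2) by case: z => z1 z2; rewrite h.
rewrite /partial /derive (_ : (fun t : R => _) =
  (fun t : R => t^-1 *: ((f \o shift (0, y)) (t *: basis_vec j) - f (0, y))))//.
by apply/funext => t /=; rewrite (h x y) [in LHS]h' [in X in _ = _ *: (X - _)]h'.
Qed.

Lemma partialC_prod phi : prod_test phi ->
  partial 0 (partial 1 phi) = partial 1 (partial 0 phi).
Proof.
move=> [A [B [sA sB hA hB ->]]].
have sA0 := smooth_partial 0 sA; have sB1 := smooth_partial 1 sB.
rewrite !(partialM _ sA sB) (partial_indep2 hA) (partial_indep1 hB).
rewrite (_ : (fun x => _ + B x * 0) = fun x => A x * partial 1 B x); last first.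
  by apply/funext => x; ring.
rewrite (_ : (fun x => A x * 0 + _) = fun x => B x * partial 0 A x); last first.
  by apply/funext => x; ring.
rewrite !partialM// (partial_indep2 (partial_indep2W 0 hA)) (partial_indep1 (partial_indep1W 1 hB)).
by apply/funext => x; ring.
Qed.

(** The smoothness in use asks for iterated partial derivatives of all orders,
    in each order of differentiation, and their symmetry is not part of it.
    Integrating by parts against a product test function moves both
    derivatives to that function, for which they commute; the fundamental
    lemma concludes. *)
Lemma partialC_ae f : smooth f ->
  aep (fun x => partial 0 (partial 1 f) x = partial 1 (partial 0 f) x).
Proof.
move=> sf; have s01 := smooth_partial 0 (smooth_partial 1 sf).
have s10 := smooth_partial 1 (smooth_partial 0 sf).
suff : aep (fun x => partial 0 (partial 1 f) x - partial 1 (partial 0 f) x = 0).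
  by apply: aep_sub => x /subr0_eq.
apply: fundamental; first by apply: lociB; exact: smooth_loci.
move=> phi tphi pphi.
rewrite (_ : (fun x => _) = fun x => partial 0 (partial 1 f) x * phi x - partial 1 (partial 0 f) x * phi x); last first.
  by apply/funext => x; rewrite mulrBl.
rewrite I2B; [|by apply: loci_integ_test => //; exact: smooth_loci|by apply: loci_integ_test => //; exact: smooth_loci].
have e1 := wd_smooth 0 (smooth_partial 1 sf) tphi.
have e2 := wd_smooth 1 (smooth_partial 0 sf) tphi.
have e3 := wd_smooth 1 sf (test_partial 0 tphi).
have e4 := wd_smooth 0 sf (test_partial 1 tphi).
apply/eqP; rewrite subr_eq0; apply/eqP.
apply: (etrans e1); rewrite e3; apply/esym; apply: (etrans e2); rewrite e4.
by rewrite (partialC_prod pphi).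
Qed.

End Parts.

(** * A regularised Cauchy kernel *)

Section Kernel.
Context {R : realType}.
Implicit Types (f g : R * R -> R) (w z : R * R).

Definition sq w z : R := (z.1 - w.1) ^+ 2 + (z.2 - w.2) ^+ 2.

Lemma sq_ge0 w z : 0 <= sq w z.
Proof. by rewrite addr_ge0 ?sqr_ge0. Qed.

Lemma sqC w z : sq w z = sq z w.
Proof. by rewrite /sq; ring. Qed.

Lemma sq_triangle w0 w z : sq w0 z <= 2 * sq w0 w + 2 * sq w z.
Proof.
rewrite /sq; set a := w.1; set b := w.2.
have -> : z.1 - w0.1 = (a - w0.1) + (z.1 - a) by ring.
have -> : z.2 - w0.2 = (b - w0.2) + (z.2 - b) by ring.
move: (a - w0.1) (z.1 - a) (b - w0.2) (z.2 - b) => p q s t.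
have := sqr_ge0 (p - q); have := sqr_ge0 (s - t).
lra.
Qed.

Lemma norm_le_sq w z (e : R) : 0 <= e -> sq w z <= e ^+ 2 -> `|z - w| <= e.
Proof.
move=> e0 h; rewrite prod_normE ge_max /=.
by apply/andP; split; rewrite -ler_sqr ?nnegrE// real_normK ?num_real//;
  apply: le_trans h; rewrite /sq ?lerDl ?lerDr sqr_ge0.
Qed.

Lemma smooth_coord1 (c : R) : smooth (fun z => z.1 - c).
Proof. by apply: smoothB; [exact: smooth_fst|exact: smooth_cst]. Qed.

Lemma smooth_coord2 (c : R) : smooth (fun z => z.2 - c).
Proof. by apply: smoothB; [exact: smooth_snd|exact: smooth_cst]. Qed.

Lemma smooth_sq w : smooth (sq w).
Proof.
by apply: smoothD; apply: smoothM;
  (exact: smooth_coord1 || exact: smooth_coord2).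
Qed.

Lemma partial_coord1 (c : R) j : partial j (fun z : R * R => z.1 - c) = fun=> (basis_vec j).1.
Proof.
rewrite partialB ?partial_fst ?partial_cst; [|exact: smooth_fst|exact: smooth_cst].
by apply/funext => x; rewrite subr0.
Qed.

Lemma partial_coord2 (c : R) j : partial j (fun z : R * R => z.2 - c) = fun=> (basis_vec j).2.
Proof.
rewrite partialB ?partial_snd ?partial_cst; [|exact: smooth_snd|exact: smooth_cst].
by apply/funext => x; rewrite subr0.
Qed.

Lemma partial_sq w j : partial j (sq w) = fun z =>
  2 * (z.1 - w.1) * (basis_vec j).1 + 2 * (z.2 - w.2) * (basis_vec j).2.
Proof.
have s1 := smooth_coord1 w.1; have s2 := smooth_coord2 w.2.
rewrite /sq partialD; [|exact: smoothM|exact: smoothM].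
rewrite (partialM j s1 s1) (partialM j s2 s2) partial_coord1 partial_coord2.
by apply/funext => z; ring.
Qed.

(** The square |z - w|^2, modified in the disc |z - w|^2 < d so that it
    vanishes nowhere. The modification is smooth because bump is. *)
Definition den (d : R) w z : R := sq w z + bump (d - sq w z).

Lemma den_gt0 d w z : 0 < d -> 0 < den d w z.
Proof.
move=> d0; have [h|h] := ltP (sq w z) d.
  by rewrite /den ltr_wpDl ?sq_ge0// bump_gt0 ?subr_gt0.
by rewrite /den bump_eq0 ?subr_le0// addr0 (lt_le_trans d0).
Qed.

Lemma smooth_den d w : smooth (den d w).
Proof.
have ss := smooth_sq w; apply: smoothD => //.
apply: (smooth_comp1 smooth1_bump); apply: smoothB => //; exact: smooth_cst.
Qed.

Lemma partial_den d w j : partial j (den d w) = fun z =>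
  (1 - derive1 bump (d - sq w z)) * partial j (sq w) z.
Proof.
have ss := smooth_sq w.
have sds : smooth (fun z => d - sq w z) by apply: smoothB => //; exact: smooth_cst.
rewrite /den partialD//; last exact: (smooth_comp1 smooth1_bump).
rewrite (partial_comp1 j smooth1_bump sds) partialB//; last exact: smooth_cst.
by rewrite partial_cst; apply/funext => z; ring.
Qed.

(** With Ker2, the real and imaginary parts of conj(z - w) / den: a smooth
    function of z which is the Cauchy kernel 1/(z - w) outside of the disc |z
    - w|^2 < d. *)
Definition Ker1 (d : R) w z : R := (z.1 - w.1) / den d w z.
Definition Ker2 (d : R) w z : R := - (z.2 - w.2) / den d w z.
Definition prof (d s : R) : R :=
  2 * (bump (d - s) + s * derive1 bump (d - s)) / (s + bump (d - s)) ^+ 2.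
(** The profile of the measure obtained by applying d_1 + i d_2 to the
    regularised kernel: a nonnegative bump supported in the disc |z - w|^2 <=
    d, which approximates a multiple of the Dirac mass at w. *)
Definition Pk (d : R) w z : R := prof d (sq w z).

Lemma smooth_Ker1 d w : 0 < d -> smooth (Ker1 d w).
Proof.
move=> d0; apply: smoothM; first exact: smooth_coord1.
by apply: smoothV; [move=> x; rewrite gt_eqF// den_gt0|exact: smooth_den].
Qed.

Lemma smooth_Ker2 d w : 0 < d -> smooth (Ker2 d w).
Proof.
move=> d0; apply: smoothM; first by apply: smoothN; exact: smooth_coord2.
by apply: smoothV; [move=> x; rewrite gt_eqF// den_gt0|exact: smooth_den].
Qed.

Lemma partial_Ker1 d w j : 0 < d -> partial j (Ker1 d w) = fun z =>
  (basis_vec j).1 / den d w z - (z.1 - w.1) * partial j (den d w) z / den d w z ^+ 2.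
Proof.
move=> d0; have dn0 z : den d w z != 0 by rewrite gt_eqF// den_gt0.
rewrite partialM; [|exact: smooth_coord1|exact: smoothV dn0 (smooth_den d w)].
rewrite (partialV j dn0 (smooth_den d w)) partial_coord1.
by apply/funext => z; field; exact: dn0.
Qed.

Lemma partial_Ker2 d w j : 0 < d -> partial j (Ker2 d w) = fun z =>
  - (basis_vec j).2 / den d w z + (z.2 - w.2) * partial j (den d w) z / den d w z ^+ 2.
Proof.
move=> d0; have dn0 z : den d w z != 0 by rewrite gt_eqF// den_gt0.
rewrite partialM; [|exact: smoothN (smooth_coord2 _)|exact: smoothV dn0 (smooth_den d w)].
rewrite (partialV j dn0 (smooth_den d w)) (partialN j (smooth_coord2 _)) partial_coord2.
by apply/funext => z; field; exact: dn0.
Qed.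

Lemma basis0 : basis_vec 0 = (1, 0) :> R * R. Proof. by []. Qed.
Lemma basis1 : basis_vec 1 = (0, 1) :> R * R. Proof. by []. Qed.

(** Together with the next identity: the Cauchy-Riemann operator d_1 + i d_2
    maps Ker1 + i Ker2 to the real function Pk. *)
Lemma Ker_div d w z : 0 < d ->
  partial 0 (Ker1 d w) z - partial 1 (Ker2 d w) z = Pk d w z.
Proof.
move=> d0; rewrite partial_Ker1// partial_Ker2// !partial_den !partial_sq basis0 basis1 /=.
have := den_gt0 w z d0; rewrite /Pk /prof -/(den d w z) => /lt0r_neq0 n0.
rewrite /sq; set b' := derive1 _ _.
have -> : bump (d - ((z.1 - w.1) ^+ 2 + (z.2 - w.2) ^+ 2)) = den d w z - sq w z.
  by rewrite /den /sq; ring.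
by rewrite /sq; field.
Qed.

Lemma Ker_curl d w z : 0 < d ->
  partial 1 (Ker1 d w) z + partial 0 (Ker2 d w) z = 0.
Proof.
move=> d0; rewrite partial_Ker1// partial_Ker2// !partial_den !partial_sq basis0 basis1 /=.
have /lt0r_neq0 n0 := den_gt0 w z d0.
by field.
Qed.

Lemma Ker1_far d w z : d <= sq w z -> Ker1 d w z = (z.1 - w.1) / sq w z.
Proof. by move=> h; rewrite /Ker1 /den bump_eq0 ?subr_le0// addr0. Qed.

Lemma Ker2_far d w z : d <= sq w z -> Ker2 d w z = - (z.2 - w.2) / sq w z.
Proof. by move=> h; rewrite /Ker2 /den bump_eq0 ?subr_le0// addr0. Qed.

Lemma Pk_ge0 d w z : 0 <= Pk d w z.
Proof.
rewrite /Pk /prof divr_ge0 ?sqr_ge0// mulr_ge0// addr_ge0 ?bump_ge0//.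
by rewrite mulr_ge0 ?sq_ge0 ?derive1_bump_ge0.
Qed.

Lemma Pk_far d w z : d <= sq w z -> Pk d w z = 0.
Proof.
move=> h; rewrite /Pk /prof bump_eq0 ?subr_le0// derive1_bump /flat.
by rewrite ifF ?mulr0 ?addr0 ?mulr0 ?mul0r// subr_gt0 ltNge h.
Qed.

Lemma Pk_gt0 d w z : sq w z < d -> 0 < Pk d w z.
Proof.
move=> h; have b0 : 0 < bump (d - sq w z) by rewrite bump_gt0 ?subr_gt0.
rewrite /Pk /prof divr_gt0//.
  by rewrite mulr_gt0// ltr_pwDl// mulr_ge0 ?sq_ge0 ?derive1_bump_ge0.
by rewrite exprn_gt0// ltr_wpDl ?sq_ge0.
Qed.

Lemma PkC d w z : Pk d w z = Pk d z w.
Proof. by rewrite /Pk sqC. Qed.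

Lemma Pk_shift d w z : Pk d 0 (z - w) = Pk d w z.
Proof. by rewrite /Pk /sq /= !subr0. Qed.

Lemma smooth_Pk d w : 0 < d -> smooth (Pk d w).
Proof.
move=> d0; rewrite (_ : Pk d w = fun z => partial 0 (Ker1 d w) z - partial 1 (Ker2 d w) z).
  by apply: smoothB; apply: smooth_partial; [exact: smooth_Ker1|exact: smooth_Ker2].
by apply/funext => z; rewrite Ker_div.
Qed.

Lemma Pk_supp e w z : 0 < e -> Pk (e ^+ 2) w z != 0 -> `|z - w| <= e.
Proof.
move=> e0 h; apply: norm_le_sq; first exact: ltW.
by rewrite leNgt; apply: contraNN h => /ltW /Pk_far ->.
Qed.

Lemma test_Pk d w : 0 < d -> test_fun (Pk d w).
Proof.
move=> d0; apply/test_funP; split; first exact: smooth_Pk.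
exists (`|w| + Num.sqrt d) => z.
rewrite -{1}[d]sqr_sqrtr ?(ltW d0)// => /Pk_supp; rewrite sqrtr_gt0 => /(_ d0) h.
by rewrite -[z](subrK w) addrC (le_trans (ler_normD _ _))// lerD2l.
Qed.

(** Joint measurability is required by Fubini on the product of two planes; it
    comes from measurability of |z - w|^2 and of the one-variable profile. *)
Lemma measurable_Pk2 d : 0 < d ->
  measurable_fun (setT : set (Plane R * Plane R)) (fun p => Pk d p.1 p.2).
Proof.
move=> d0.
have mp : measurable_fun (setT : set (measurableTypeR R)) (fun s : R => prof d `|s|).
  apply: continuous_measurable_fun => s.
  have cn : {for s, continuous (fun s : R => d - `|s|)}.
    by apply: cvgB; [exact: cvg_cst|exact: norm_continuous].
  have cb : {for s, continuous (fun s : R => bump (d - `|s|))}.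
    apply: (continuous_comp (f := fun s : R => d - `|s|) (g := bump)) => //.
    exact: smooth1_continuous smooth1_bump _.
  have cb' : {for s, continuous (fun s : R => derive1 bump (d - `|s|))}.
    apply: (continuous_comp (f := fun s : R => d - `|s|) (g := derive1 bump)) => //.
    exact: smooth1_continuous (smooth1_derive1 smooth1_bump) _.
  have cs : {for s, continuous (fun s : R => `|s|)} by exact: norm_continuous.
  rewrite /prof; apply: cvgM.
    by apply: cvgM; [exact: cvg_cst|apply: cvgD => //; exact: cvgM].
  apply: cvgV.
    rewrite sqrf_eq0 gt_eqF//; have [h|h] := ltP `|s| d.
      by rewrite ltr_wpDl// bump_gt0 ?subr_gt0.
    by rewrite bump_eq0 ?subr_le0// addr0 (lt_le_trans d0).
  by apply: cvgM; apply: cvgD.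
rewrite (_ : (fun p => _) = (fun s : R => prof d `|s|) \o (fun p => sq p.1 p.2)).
  apply: measurableT_comp => //.
  have m11 : measurable_fun (setT : set (Plane R * Plane R)) (fun p => p.1.1) by exact: measurableT_comp.
  have m12 : measurable_fun (setT : set (Plane R * Plane R)) (fun p => p.1.2) by exact: measurableT_comp.
  have m21 : measurable_fun (setT : set (Plane R * Plane R)) (fun p => p.2.1) by exact: measurableT_comp.
  have m22 : measurable_fun (setT : set (Plane R * Plane R)) (fun p => p.2.2) by exact: measurableT_comp.
  by apply: measurable_funD; apply: measurable_funX; apply: measurable_funB.
by apply/funext => p /=; rewrite ger0_norm ?sq_ge0.
Qed.

End Kernel.

(** * Mean values and the Liouville theorem for weakly holomorphic functions *)

Section Averages.
Context {R : realType}.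
Implicit Types (f g : R * R -> R) (w z : R * R).

Lemma lebesgue_shift (a : R) (F : R -> \bar R) :
  measurable_fun (setT : set (measurableTypeR R)) F -> (forall x, 0 <= F x)%E ->
  (\int[@lebesgue_measure R]_x F (x - a)%R = \int[@lebesgue_measure R]_x F x)%E.
Proof.
move=> mF F0; pose T : measurableTypeR R -> measurableTypeR R := fun x => x - a.
have mT : measurable_fun setT T by exact: measurable_funB.
have <- : (\int[pushforward (@lebesgue_measure R) T]_x F x = \int[@lebesgue_measure R]_x F (x - a)%R)%E.
  by rewrite ge0_integral_pushforward// preimage_setT.
apply: eq_measure_integral => A mA _; apply/esym.
apply: lebesgue_measure_unique => // _ [[b c] _ <-].
rewrite -[RHS]/(lebesgue_measure (T @^-1` `]b, c]%classic)).
rewrite (_ : T @^-1` _ = `]b + a, c + a]%classic).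
  rewrite !lebesgue_measure_itv/= !lte_fin ltrD2r.
  by case: ifPn => // _; rewrite -!EFinB; congr EFin; ring.
by apply/seteqP; split => x /=; rewrite !in_itv/= /T ltrBrDr lerBlDr.
Qed.

Lemma leb2_tonelli f : meas2 f -> (forall z, 0 <= f z) ->
  (\int[@leb2 R]_z (f z)%:E =
   \int[@lebesgue_measure R]_x \int[@lebesgue_measure R]_y (f (x, y))%:E)%E.
Proof.
move=> mf f0; have f0' z : (0 <= (f z)%:E)%E by rewrite lee_fin.
exact: (@fubini_tonelli1 _ _ _ _ R lebesgue_measure lebesgue_measure _ (meas2_EFin mf) f0').
Qed.

Lemma measurable_slice_int f : meas2 f -> (forall z, 0 <= f z) ->
  measurable_fun (setT : set (measurableTypeR R))
    (fun x => \int[@lebesgue_measure R]_y (f (x, y))%:E)%E.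
Proof.
move=> mf f0; have f0' z : (0 <= (f z)%:E)%E by rewrite lee_fin.
exact: (@measurable_fun_fubini_tonelli_F _ _ _ _ R lebesgue_measure _ (meas2_EFin mf) f0').
Qed.

Lemma I2_shift f w : integ f -> integ (fun z => f (z - w)) -> (forall z, 0 <= f z) ->
  I2 (fun z => f (z - w)) = I2 f.
Proof.
move=> ig igw f0; apply: EFin_inj; rewrite (I2_EFin ig) (I2_EFin igw).
have mf := integ_meas ig; have mfw := integ_meas igw.
rewrite !leb2_tonelli//.
pose G x := (\int[@lebesgue_measure R]_y (f (x, y))%:E)%E.
transitivity (\int[@lebesgue_measure R]_x G (x - w.1)%R)%E.
  apply: eq_integral => x _; rewrite /G.
  rewrite -(lebesgue_shift w.2 (F := fun y => (f (x - w.1, y))%:E))//; last first.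
    by move=> y; rewrite lee_fin.
  by apply/measurable_EFinP; exact: (measurableT_comp mf (pair1_measurable _)).
apply: lebesgue_shift.
  exact: measurable_slice_int.
by move=> x; apply: integral_ge0 => y _; rewrite lee_fin.
Qed.

Lemma lipschitz_derive (k k' : R -> R) (M a b : R) :
  (forall x : R, is_derive x 1 k (k' x)) -> (forall x, `|k' x| <= M) ->
  `|k a - k b| <= M * `|a - b|.
Proof.
move=> dk kM; wlog ab : a b / a <= b => [H|].
  by have [/H//|/ltW/H] := leP a b; rewrite distrC (distrC b).
have ck : continuous k.
  move=> x; apply/differentiable_continuous/derivable1_diffP.
  exact: (@ex_derive _ _ _ _ _ _ _ (dk x)).
rewrite distrC (distrC a).
have [c _ ->] := MVT_segment ab (fun x _ => dk x) (continuous_subspaceT ck).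
by rewrite normrM ler_wpM2r.
Qed.

Lemma test_bounded f : test_fun f -> exists2 M : R, 0 <= M & forall x, `|f x| <= M.
Proof.
move=> /test_funP[sf [r hr]].
have [M M0 hM] := continuous_bounded_box r (smooth_continuous sf).
exists M => // x; have [->|/hr/hM//] := eqVneq (f x) 0; by rewrite normr0.
Qed.

Lemma test_lipschitz f : test_fun f ->
  exists2 L : R, 0 <= L & forall x y : R * R, `|f x - f y| <= L * `|x - y|.
Proof.
move=> tf; have sf := test_smooth tf.
have [M0 M00 h0] := test_bounded (test_partial 0 tf).
have [M1 M10 h1] := test_bounded (test_partial 1 tf).
exists (M0 + M1) => [|x y]; first exact: addr_ge0.
case: x y => x1 x2 [y1 y2].
rewrite (_ : _ - _ = (f (x1, x2) - f (y1, x2)) + (f (y1, x2) - f (y1, y2))); last by ring.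
apply: (le_trans (ler_normD _ _)); rewrite mulrDl; apply: lerD.
  apply: (@le_trans _ _ (M0 * `|x1 - y1|)); last by rewrite ler_wpM2l// prod_normE le_max lexx.
  apply: (@lipschitz_derive (fun s => f (s, x2)) (fun s => partial 0 f (s, x2))) => // s.
  by apply: is_derive_slice1; exact: smooth_is_derive.
apply: (@le_trans _ _ (M1 * `|x2 - y2|)); last by rewrite ler_wpM2l// prod_normE le_max lexx orbT.
apply: (@lipschitz_derive (fun s => f (y1, s)) (fun s => partial 1 f (y1, s))) => // s.
by apply: is_derive_slice2; exact: smooth_is_derive.
Qed.

(** The function f1 + i f2 is weakly holomorphic: its integral against (d_1 +
    i d_2) phi vanishes for all test functions phi. The two equations are the
    real and imaginary parts. *)
Definition wCR f1 f2 := forall phi, test_fun phi ->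
  I2 (fun x => f1 x * partial 0 phi x) = I2 (fun x => f2 x * partial 1 phi x) /\
  I2 (fun x => f2 x * partial 0 phi x) = - I2 (fun x => f1 x * partial 1 phi x).

Lemma wCR_const : wCR (fun=> 1) (fun=> 0).
Proof.
move=> phi tphi.
have h (c : R) j : I2 (fun x => c * partial j phi x) = 0.
  have tp := test_partial j tphi.
  by rewrite I2Z ?I2_partial ?mulr0//; exact: test_integ.
split; first exact: (etrans (h 1 0) (esym (h 0 1))).
by apply: (etrans (h 0 0)); rewrite [X in - X]h oppr0.
Qed.

(** A cutoff equal to 1 in the disc of radius r about w, and to 0 where |z -
    w|^2 >= 2 r^2. *)
Definition chi (r : R) w : R * R -> R := step (fun z => 2 - sq w z / r ^+ 2).

Lemma smooth_chi r w : smooth (chi r w).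
Proof.
apply: smooth_step; apply: smoothB; first exact: smooth_cst.
by apply: smoothM; [exact: smooth_sq|exact: smooth_cst].
Qed.

Lemma chi_eq1 r w z : 0 < r -> sq w z <= r ^+ 2 -> chi r w z = 1.
Proof.
move=> r0 h; apply: step_eq1; have : sq w z / r ^+ 2 <= 1.
  by rewrite ler_pdivrMr ?exprn_gt0// mul1r.
lra.
Qed.

Lemma chi_eq0 r w z : 0 < r -> 2 * r ^+ 2 <= sq w z -> chi r w z = 0.
Proof.
move=> r0 h; apply: step_eq0; have : 2 <= sq w z / r ^+ 2.
  by rewrite ler_pdivlMr ?exprn_gt0.
lra.
Qed.

Lemma chi_ge0 r w z : 0 <= chi r w z. Proof. exact: step_ge0. Qed.
Lemma chi_le1 r w z : chi r w z <= 1. Proof. exact: step_le1. Qed.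

Lemma supp_chi r w : 0 < r -> supp_box (`|w| + 2 * r) (chi r w).
Proof.
move=> r0 z h; have : sq w z <= (2 * r) ^+ 2.
  rewrite leNgt; apply: contraNN h => h; rewrite chi_eq0//.
  by apply: le_trans (ltW h); rewrite exprMn ler_wpM2r ?sqr_ge0//; lra.
move=> /norm_le_sq; rewrite mulr_ge0 ?(ltW r0)// => /(_ isT) h'.
by rewrite -[z](subrK w) addrC (le_trans (ler_normD _ _))// lerD2l.
Qed.

Lemma test_chi r w : 0 < r -> test_fun (chi r w).
Proof.
move=> r0; apply/test_funP; split; first exact: smooth_chi.
by exists (`|w| + 2 * r); exact: supp_chi.
Qed.

Lemma partial_chi_near r w z j : 0 < r -> sq w z < r ^+ 2 -> partial j (chi r w) z = 0.
Proof.
move=> r0 h; rewrite /partial (@near_eq_derive _ _ _ _ (cst (1 : R))) ?derive_cst//.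
have cs := smooth_continuous (smooth_sq w) (x := z).
have : \forall y \near z, sq w y < r ^+ 2 by exact: (cs [set t | t < r ^+ 2] (lt_nbhsl h)).
by apply: filterS => y hy; rewrite chi_eq1// ltW.
Qed.

(** The square of r/2: kernels with poles in the disc of radius r/2 stay away
    from the region, outside of the disc of radius r, where chi is not
    constant. *)
Definition rad (r : R) : R := r ^+ 2 / 4.

Lemma rad_gt0 r : 0 < r -> 0 < rad r.
Proof. by move=> r0; rewrite divr_gt0 ?exprn_gt0. Qed.

(** With mu2, the real and imaginary parts of f (d_1 + i d_2) chi, which plays
    the part of the boundary values of f in the Cauchy formula. *)
Definition mu1 f1 f2 r w z := f1 z * partial 0 (chi r w) z - f2 z * partial 1 (chi r w) z.
Definition mu2 f1 f2 r w z := f1 z * partial 1 (chi r w) z + f2 z * partial 0 (chi r w) z.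

(** With HH2, the Cauchy integral of f: minus the integral of f (d_1 + i d_2)
    chi times the kernel with pole w. *)
Definition HH1 f1 f2 r w0 w := - I2 (fun z =>
  mu1 f1 f2 r w0 z * Ker1 (rad r) w z - mu2 f1 f2 r w0 z * Ker2 (rad r) w z).
Definition HH2 f1 f2 r w0 w := - I2 (fun z =>
  mu1 f1 f2 r w0 z * Ker2 (rad r) w z + mu2 f1 f2 r w0 z * Ker1 (rad r) w z).

Lemma sqr_le_itv (t s : R) : - s < t < s -> t ^+ 2 <= s ^+ 2.
Proof.
move=> /andP[h1 h2]; have h3 : 0 <= s - t by lra.
have h4 : 0 <= s + t by lra.
by have := mulr_ge0 h3 h4; lra.
Qed.

Lemma box_ball r w0 w : 0 < r -> w0.1 - r / 4 < w.1 < w0.1 + r / 4 ->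
  w0.2 - r / 4 < w.2 < w0.2 + r / 4 -> sq w0 w <= rad r /\ `|w| <= `|w0| + r.
Proof.
move=> r0 /andP[h1 h2] /andP[h3 h4].
have a1 : - (r / 4) < w.1 - w0.1 < r / 4 by apply/andP; split; lra.
have a2 : - (r / 4) < w.2 - w0.2 < r / 4 by apply/andP; split; lra.
split.
  have := sqr_le_itv a1; have := sqr_le_itv a2; have := sqr_ge0 r.
  by rewrite /sq /rad !exprMn; lra.
have h5 : `|w - w0| <= r.
  rewrite prod_normE ge_max /= !ler_norml; move: a1 a2 => /andP[? ?] /andP[? ?].
  by apply/andP; split; apply/andP; split; lra.
by rewrite -{1}[w](subrK w0) addrC (le_trans (ler_normD _ _))// lerD2l.
Qed.

Lemma rad_large d : 0 < d -> d <= rad (2 * (d + 1)) /\ 1 <= rad (2 * (d + 1)).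
Proof. by move=> d0; rewrite /rad; split; nra. Qed.

Lemma radE r : rad r = (r / 2) ^+ 2.
Proof. by rewrite /rad expr_div_n -natrX. Qed.

Lemma chi_scale r z : chi r 0 z = chi 1 0 (r^-1 *: z).
Proof.
rewrite /chi /step (_ : sq 0 z / r ^+ 2 = sq 0 (r^-1 *: z) / 1 ^+ 2)//.
by rewrite /sq /= !subr0 expr1n divr1 /GRing.scale /= !exprMn -mulrDr mulrC exprVn.
Qed.

Lemma far_from_center r w0 w z : sq w0 w <= rad r -> r ^+ 2 <= sq w0 z ->
  rad r <= sq w z.
Proof. by rewrite /rad => h1 h2; have h3 := sq_triangle w0 w z; lra. Qed.

(** Where the gradient of chi does not vanish, |z - w|^2 is at least rad r, so
    that the kernel does not depend on its regularisation parameter. *)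
Lemma Ker1_grad_chi r d w0 w z j : 0 < r -> d <= rad r -> sq w0 w <= rad r ->
  partial j (chi r w0) z * Ker1 d w z = partial j (chi r w0) z * Ker1 (rad r) w z.
Proof.
move=> r0 dr hw.
have [h|h] := ltP (sq w0 z) (r ^+ 2); first by rewrite (partial_chi_near j r0 h) !mul0r.
have h3 := far_from_center hw h.
by rewrite (Ker1_far h3) (Ker1_far (le_trans dr h3)).
Qed.

Lemma Ker2_grad_chi r d w0 w z j : 0 < r -> d <= rad r -> sq w0 w <= rad r ->
  partial j (chi r w0) z * Ker2 d w z = partial j (chi r w0) z * Ker2 (rad r) w z.
Proof.
move=> r0 dr hw.
have [h|h] := ltP (sq w0 z) (r ^+ 2); first by rewrite (partial_chi_near j r0 h) !mul0r.
have h3 := far_from_center hw h.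
by rewrite (Ker2_far h3) (Ker2_far (le_trans dr h3)).
Qed.

Lemma chi_Pk r d w0 w z : 0 < r -> d <= rad r -> sq w0 w <= rad r ->
  chi r w0 z * Pk d w z = Pk d w z.
Proof.
move=> r0 dr hw; have [h|h] := ltP (sq w z) d; last by rewrite (Pk_far h) mulr0.
have h2 := sq_triangle w0 w z.
by rewrite (chi_eq1 r0) ?mul1r//; move: dr hw; rewrite /rad; lra.
Qed.

Local Opaque rad chi Ker1 Ker2 Pk partial test_fun I2.

Lemma dbar_mul1 (c A B : R * R -> R) z : smooth c -> smooth A -> smooth B ->
  partial 0 (fun z => c z * A z) z - partial 1 (fun z => c z * B z) z =
  c z * (partial 0 A z - partial 1 B z) + (partial 0 c z * A z - partial 1 c z * B z).
Proof.
move=> sc sA sB; rewrite (partialM 0 sc sA) (partialM 1 sc sB).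
move: (partial 0 c z) (partial 1 c z) (partial 0 A z) (partial 1 B z) => *; ring.
Qed.

Lemma dbar_mul2 (c A B : R * R -> R) z : smooth c -> smooth A -> smooth B ->
  partial 1 (fun z => c z * A z) z + partial 0 (fun z => c z * B z) z =
  c z * (partial 1 A z + partial 0 B z) + (partial 1 c z * A z + partial 0 c z * B z).
Proof.
move=> sc sA sB; rewrite (partialM 1 sc sA) (partialM 0 sc sB).
move: (partial 0 c z) (partial 1 c z) (partial 1 A z) (partial 0 B z) => *; ring.
Qed.

(** Test functions in the definition of weakly holomorphic are real; applying
    it to both parts of a complex test function F gives the vanishing of the
    integral of f (d_1 + i d_2) F. *)
Lemma wCR_complex f1 f2 F1 F2 : loci f1 -> loci f2 -> wCR f1 f2 ->
  test_fun F1 -> test_fun F2 ->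
  I2 (fun z => f1 z * (partial 0 F1 z - partial 1 F2 z) -
               f2 z * (partial 1 F1 z + partial 0 F2 z)) = 0 /\
  I2 (fun z => f1 z * (partial 1 F1 z + partial 0 F2 z) +
               f2 z * (partial 0 F1 z - partial 1 F2 z)) = 0.
Proof.
move=> l1 l2 cr t1 t2; have [a1 a2] := cr _ t1; have [b1 b2] := cr _ t2.
have ip f j phi (lf : loci f) (tphi : test_fun phi) : integ (fun x => f x * partial j phi x).
  exact: loci_integ_test lf (test_partial j tphi).
have i1 := ip f1 0 F1 l1 t1; have i2 := ip f1 1 F1 l1 t1.
have i3 := ip f2 0 F1 l2 t1; have i4 := ip f2 1 F1 l2 t1.
have j1 := ip f1 0 F2 l1 t2; have j2 := ip f1 1 F2 l1 t2.
have j3 := ip f2 0 F2 l2 t2; have j4 := ip f2 1 F2 l2 t2.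
split.
- rewrite (_ : (fun z => _) = fun z => (f1 z * partial 0 F1 z - f1 z * partial 1 F2 z) -
     (f2 z * partial 1 F1 z + f2 z * partial 0 F2 z)); last first.
    by apply/funext => z; rewrite mulrBr mulrDr.
  rewrite (I2B (integB i1 j2) (integD i4 j3)) (I2B i1 j2) (I2D i4 j3) b2.
  rewrite [X in X - _ - _]a1; move: (I2 _) (I2 _) => *; ring.
- rewrite (_ : (fun z => _) = fun z => (f1 z * partial 1 F1 z + f1 z * partial 0 F2 z) +
     (f2 z * partial 0 F1 z - f2 z * partial 1 F2 z)); last first.
    by apply/funext => z; rewrite mulrBr mulrDr.
  rewrite (I2D (integD i2 j1) (integB i3 j4)) (I2D i2 j1) (I2B i3 j4) a2.
  rewrite [X in _ + X + _]b1; move: (I2 _) (I2 _) => *; ring.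
Qed.

(** Test weak holomorphy against the cutoff times the regularised kernel: the
    derivative falls either on the kernel, giving the average with weight Pk,
    or on the cutoff, giving the Cauchy integral. The latter is independent of
    d. *)
Lemma mean_value f1 f2 (r d : R) w0 w : loci f1 -> loci f2 -> wCR f1 f2 -> 0 < r ->
  0 < d -> d <= rad r -> sq w0 w <= rad r ->
  I2 (fun z => f1 z * Pk d w z) = HH1 f1 f2 r w0 w /\
  I2 (fun z => f2 z * Pk d w z) = HH2 f1 f2 r w0 w.
Proof.
move=> l1 l2 cr r0 d0 dr hw.
have tc := test_chi w0 r0; have sc := test_smooth tc.
have sK1 := smooth_Ker1 w d0; have sK2 := smooth_Ker2 w d0.
have [e1 e2] := wCR_complex l1 l2 cr (test_mulr tc sK1) (test_mulr tc sK2).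
have tP := test_Pk w d0.
have iP1 := loci_integ_test l1 tP; have iP2 := loci_integ_test l2 tP.
have imK f j : loci f -> integ (fun z => f z * (partial j (chi r w0) z * Ker1 d w z)) /\
   integ (fun z => f z * (partial j (chi r w0) z * Ker2 d w z)).
  move=> lf; have tp := test_partial j tc.
  split; [exact: loci_integ_test lf (test_mulr tp sK1)|exact: loci_integ_test lf (test_mulr tp sK2)].
have q1 z j := Ker1_grad_chi z j r0 dr hw; have q2 z j := Ker2_grad_chi z j r0 dr hw.
have alg1 (u v p q a a' b b' : R) : p * a = p * a' -> q * a = q * a' ->
    p * b = p * b' -> q * b = q * b' ->
    (u * p - v * q) * a' - (u * q + v * p) * b' =
    u * (p * a) - u * (q * b) - (v * (q * a) + v * (p * b)).
  by move=> -> -> -> ->; ring.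
have alg2 (u v p q a a' b b' : R) : p * a = p * a' -> q * a = q * a' ->
    p * b = p * b' -> q * b = q * b' ->
    (u * p - v * q) * b' + (u * q + v * p) * a' =
    v * (p * a) - v * (q * b) + (u * (q * a) + u * (p * b)).
  by move=> -> -> -> ->; ring.
have alg3 (u v p q a b c s t : R) : s = c + (p * a - q * b) -> t = q * a + p * b ->
    u * c + (u * (p * a) - u * (q * b) - (v * (q * a) + v * (p * b))) = u * s - v * t.
  by move=> -> ->; ring.
have alg4 (u v p q a b c s t : R) : s = c + (p * a - q * b) -> t = q * a + p * b ->
    v * c + (v * (p * a) - v * (q * b) + (u * (q * a) + u * (p * b))) = u * t + v * s.
  by move=> -> ->; ring.
have [c1 c2] := imK f1 0 l1; have [c3 c4] := imK f1 1 l1.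
have [g1 g2] := imK f2 0 l2; have [g3 g4] := imK f2 1 l2.
have D1 z : partial 0 (fun z => chi r w0 z * Ker1 d w z) z - partial 1 (fun z => chi r w0 z * Ker2 d w z) z =
  Pk d w z + (partial 0 (chi r w0) z * Ker1 d w z - partial 1 (chi r w0) z * Ker2 d w z).
  by rewrite (dbar_mul1 z sc sK1 sK2) (Ker_div w z d0) (chi_Pk z r0 dr hw).
have D2 z : partial 1 (fun z => chi r w0 z * Ker1 d w z) z + partial 0 (fun z => chi r w0 z * Ker2 d w z) z =
  partial 1 (chi r w0) z * Ker1 d w z + partial 0 (chi r w0) z * Ker2 d w z.
  by rewrite (dbar_mul2 z sc sK1 sK2) (Ker_curl w z d0) mulr0 add0r.
split.
- rewrite (_ : HH1 _ _ _ _ _ = - I2 (fun z =>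
    (f1 z * (partial 0 (chi r w0) z * Ker1 d w z) - f1 z * (partial 1 (chi r w0) z * Ker2 d w z)) -
    (f2 z * (partial 1 (chi r w0) z * Ker1 d w z) + f2 z * (partial 0 (chi r w0) z * Ker2 d w z)))); last first.
    congr (- I2 _); apply/funext => z.
    exact: (alg1 (f1 z) (f2 z) _ _ _ _ _ _ (q1 z 0) (q1 z 1) (q2 z 0) (q2 z 1)).
  apply/eqP; rewrite -subr_eq0 opprK -(I2D iP1 (integB (integB c1 c4) (integD g3 g2))).
  apply/eqP; rewrite -[RHS]e1; congr I2; apply/funext => z.
  exact: (alg3 _ _ _ _ _ _ _ _ _ (D1 z) (D2 z)).
- rewrite (_ : HH2 _ _ _ _ _ = - I2 (fun z =>
    (f2 z * (partial 0 (chi r w0) z * Ker1 d w z) - f2 z * (partial 1 (chi r w0) z * Ker2 d w z)) +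
    (f1 z * (partial 1 (chi r w0) z * Ker1 d w z) + f1 z * (partial 0 (chi r w0) z * Ker2 d w z)))); last first.
    congr (- I2 _); apply/funext => z.
    exact: (alg2 (f1 z) (f2 z) _ _ _ _ _ _ (q1 z 0) (q1 z 1) (q2 z 0) (q2 z 1)).
  apply/eqP; rewrite -subr_eq0 opprK -(I2D iP2 (integD (integB g1 g4) (integD c3 c2))).
  apply/eqP; rewrite -[RHS]e2; congr I2; apply/funext => z.
  exact: (alg4 _ _ _ _ _ _ _ _ _ (D1 z) (D2 z)).
Qed.

(** The common total mass of the averaging weights, for all d and w. *)
Definition mass : R := I2 (Pk 1 0).

(** The mean value formula for the constant function 1 shows that the mass is
    independent of d, and invariance under translations that it is independent
    of w. *)
Lemma I2_Pk d w : 0 < d -> I2 (Pk d w) = mass.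
Proof.
move=> d0.
have J d1 w1 : 0 < d1 -> I2 (Pk d1 w1) = I2 (Pk 1 w1).
  move=> d10; pose r : R := 2 * (d1 + 1).
  have r0 : 0 < r by rewrite /r; lra.
  have h1 : sq w1 w1 <= rad r.
    by rewrite /sq !subrr expr0n addr0 ltW// rad_gt0.
  have e d2 : (fun z => 1 * Pk d2 w1 z) = Pk d2 w1 by apply/funext => z; rewrite mul1r.
  have [r1 r2] := rad_large d10.
  have [m1 _] := mean_value (loci_cst 1) (loci_cst 0) wCR_const r0 d10 r1 h1.
  have [m2 _] := mean_value (loci_cst 1) (loci_cst 0) wCR_const r0 ltr01 r2 h1.
  by move: m1; rewrite -m2 !e.
apply: (etrans (J d w d0)).
have E : (fun z => Pk 1 0 (z - w)) = Pk 1 w.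
  by apply/funext => z; rewrite Pk_shift.
rewrite -E; apply: I2_shift; last exact: Pk_ge0.
  by apply: test_integ; exact: (test_Pk 0 ltr01).
by rewrite E; apply: test_integ; exact: (test_Pk w ltr01).
Qed.


Lemma sigma_finite_leb2 : sigma_finite setT (@leb2 R).
Proof.
have /sigma_finiteP[F [TF ndF Foo]] := sigma_finiteT (@lebesgue_measure R).
exists (fun n => F n `*` F n).
  rewrite -setXTT TF predeqE => -[x y]; split; last first.
    by move=> [n _ []/= ? ?]; split; exists n.
  move=> [/= [n _ Fnx] [k _ Gky]]; exists (maxn n k) => //; split.
  - by move: x Fnx; exact/subsetPset/ndF/leq_maxl.
  - by move: y Gky; exact/subsetPset/ndF/leq_maxr.
move=> k; have [? ?] := Foo k.
by split; [exact: measurableX|rewrite leb2X// lte_mul_pinfty// ge0_fin_numE].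
Qed.

Definition leb2s : {sigma_finite_measure set (Plane R) -> \bar R} :=
  HB.pack (@lebesgue_measure R \x @lebesgue_measure R)%E
    (Measure_isSigmaFinite.Build _ _ _ (@leb2 R) sigma_finite_leb2).

(** The integrand is dominated by the product of psi and of f truncated to a
    larger box. *)
Lemma fubini4 f psi d r : loci f -> integ psi -> supp_box r psi -> 0 < d ->
  [/\ integ (fun w => psi w * I2 (fun z => f z * Pk d w z)),
      integ (fun z => f z * I2 (fun w => psi w * Pk d w z)) &
  I2 (fun w => psi w * I2 (fun z => f z * Pk d w z)) =
  I2 (fun z => f z * I2 (fun w => psi w * Pk d w z))].
Proof.
move=> lf ipsi hr d0.
have tP w := test_Pk w d0.
have fP w : integ (fun z => f z * Pk d w z) by exact: loci_integ_test lf (tP w).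
have [B B0 hB] := test_bounded (tP 0).
have BP w z : `|Pk d w z| <= B by rewrite -Pk_shift.
pose r' : R := r + Num.sqrt d.
have Psupp w z : psi w != 0 -> Pk d w z != 0 -> `|z| <= r'.
  move=> /hr wr; rewrite -[d]sqr_sqrtr ?(ltW d0)// => /Pk_supp.
  rewrite sqrtr_gt0 => /(_ d0) h.
  by rewrite -[z](subrK w) addrC (le_trans (ler_normD _ _))// lerD.
have psiP z : integ (fun w => psi w * Pk d w z).
  apply: (@integ_le _ _ (fun w => B * `|psi w|)).
  - apply: meas2M; first exact: integ_meas.
    by rewrite (_ : (fun w => Pk d w z) = Pk d z); [exact: integ_meas (test_integ (tP z))|apply/funext => w; rewrite PkC].
  - by move=> w; rewrite normrM mulrC ler_wpM2r.
  - by apply: integZ; exact: integ_norm.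
pose Fe (p : Plane R * Plane R) := (psi p.1 * (f p.2 * Pk d p.1 p.2))%:E.
have mFe : measurable_fun setT Fe.
  apply/measurable_EFinP; apply: measurable_funM.
    by apply: measurableT_comp => //; exact: integ_meas.
  apply: measurable_funM; last exact: measurable_Pk2.
  by apply: measurableT_comp => //; case: lf.
pose C : R := I2 (fun z => B * `|trunc r' f z|).
have iC : integ (fun z => B * `|trunc r' f z|).
  by apply: integZ; apply: integ_norm; case: lf.
have iFe : (leb2s \x leb2s)%E.-integrable setT Fe.
  apply/integrable12ltyP => //.
  apply: (@le_lt_trans _ _ (\int[leb2s]_w (`|psi w| * C)%:E)%E).
    apply: ge0_le_integral => //.
    - by move=> w _; apply: integral_ge0.
    - apply: (measurable_fun_fubini_tonelli_F (abse \o Fe)) => //.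
        exact: measurableT_comp.
      by move=> p; exact: abse_ge0.
    - apply/measurable_EFinP; apply: measurable_funM => //.
      by apply: measurableT_comp => //; exact: integ_meas.
    - move=> w _; rewrite -I2Z// I2_EFin; last exact: integZ.
      apply: ge0_le_integral => //.
      + apply: measurableT_comp => //; exact: (measurableT_comp mFe (pair1_measurable w)).
      + by apply: meas2_EFin; apply: integ_meas; exact: integZ.
      + move=> z _; rewrite /Fe /= lee_fin normrM.
        have [->|p0] := eqVneq (psi w) 0; first by rewrite normr0 !mul0r.
        rewrite ler_wpM2l// normrM mulrC.
        have [->|/(Psupp _ _ p0) zr] := eqVneq (Pk d w z) 0.
          by rewrite normr0 mul0r mulr_ge0.
        by rewrite /trunc zr ler_wpM2r.
  have iC2 : integ (fun w => C * `|psi w|) by apply: integZ; exact: integ_norm.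
  apply: (le_lt_trans _ (ltry (I2 (fun w => C * `|psi w|)))); rewrite (I2_EFin iC2).
  by under eq_integral do rewrite mulrC; exact: lexx.
have in1 w : (\int[leb2s]_z Fe (w, z) = (psi w * I2 (fun z => f z * Pk d w z))%:E)%E.
  by rewrite -I2Z// (I2_EFin (integZ _ (fP w))).
have in2 z : (\int[leb2s]_w Fe (w, z) = (f z * I2 (fun w => psi w * Pk d w z))%:E)%E.
  rewrite -I2Z// (I2_EFin (integZ _ (psiP z))); apply: eq_integral => w _.
  by rewrite /Fe /= mulrCA.
have i1 : integ (fun w => psi w * I2 (fun z => f z * Pk d w z)).
  by apply: eq_integrable (integrable_fubini_F iFe) => // w _; exact: in1.
have i2 : integ (fun z => f z * I2 (fun w => psi w * Pk d w z)).
  have mG : meas2 (fun z => f z * I2 (fun w => psi w * Pk d w z)).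
    apply/measurable_EFinP.
    rewrite (_ : EFin \o _ = fubini_G leb2s Fe); first exact: (measurable_fubini_G iFe).
    by apply/funext => z; exact: (esym (in2 z)).
  pose D : R := I2 (fun w => B * `|psi w|).
  have iD : integ (fun w => B * `|psi w|) by apply: integZ; exact: integ_norm.
  apply: (@integ_le _ _ (fun z => D * `|trunc r' f z|)) => // [z|]; last first.
    by apply: integZ; apply: integ_norm; case: lf.
  rewrite normrM mulrC; have [zr|zr] := leP `|z| r'.
    rewrite /trunc zr ler_wpM2r//.
    apply: le_trans (I2_norm (psiP z)) _; apply: le_I2 => //; first exact: integ_norm.
    by move=> w; rewrite normrM mulrC ler_wpM2r.
  rewrite (_ : (fun w => _) = fun=> 0 * 0).
    rewrite I2Z ?mul0r ?normr0 ?mul0r ?mulr_ge0 ?I2_ge0// => [w|]; first by rewrite mulr_ge0.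
    exact: test_integ test0.
  apply/funext => w; have [->|p0] := eqVneq (psi w) 0; first by rewrite !mul0r.
  have [->|/(Psupp _ _ p0)] := eqVneq (Pk d w z) 0; first by rewrite !mulr0.
  by rewrite leNgt zr.
split; [exact: i1|exact: i2|].
apply: EFin_inj; apply: (etrans (I2_EFin i1)); apply: (etrans _ (esym (I2_EFin i2))).
transitivity (\int[leb2s]_w \int[leb2s]_z Fe (w, z))%E.
  by apply: eq_integral => w _; exact: (esym (in1 w)).
apply: (etrans (Fubini iFe)).
by apply: eq_integral => z _; exact: (in2 z).
Qed.


Lemma mass_ge0 : 0 <= mass.
Proof. by apply: I2_ge0 => z; exact: Pk_ge0. Qed.

Lemma I2_PkC d z : 0 < d -> I2 (fun w => Pk d w z) = mass.
Proof.
move=> d0; rewrite (_ : (fun w => Pk d w z) = Pk d z); first exact: I2_Pk.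
by apply/funext => w; exact: PkC.
Qed.

Lemma integ_PkC d z : 0 < d -> integ (fun w => Pk d w z).
Proof.
move=> d0; rewrite (_ : (fun w => Pk d w z) = Pk d z); first exact: test_integ (test_Pk z d0).
by apply/funext => w; exact: PkC.
Qed.

(** The weight is supported in the ball of radius e, where phi varies by at
    most L e. *)
Lemma average_test phi e L z : test_fun phi -> 0 < e ->
  (forall x y : R * R, `|phi x - phi y| <= L * `|x - y|) ->
  `|I2 (fun w => phi w * Pk (e ^+ 2) w z) - mass * phi z| <= L * e * mass.
Proof.
move=> tphi e0 hL; have d0 : 0 < e ^+ 2 by rewrite exprn_gt0.
have iP := integ_PkC z d0.
have L0 : 0 <= L.
  have := hL (1, 0) 0; rewrite subr0 prod_normE /= normr1 normr0 max_l//.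
  by rewrite mulr1; exact: le_trans.
have iphiP : integ (fun w => phi w * Pk (e ^+ 2) w z).
  rewrite (_ : (fun w => _) = fun w => phi w * Pk (e ^+ 2) z w).
    exact: loci_integ_test (smooth_loci (test_smooth tphi)) (test_Pk z d0).
  by apply/funext => w; rewrite PkC.
rewrite -(I2_PkC z d0) mulrC -(I2Z _ iP) -(I2B iphiP (integZ _ iP)).
have iD := integB iphiP (integZ (phi z) iP).
apply: (le_trans (I2_norm iD)).
rewrite -(I2Z _ iP); apply: le_I2; [exact: integ_norm|exact: integZ|move=> w].
rewrite -mulrBl normrM (ger0_norm (Pk_ge0 _ _ _)).
have [->|h] := eqVneq (Pk (e ^+ 2) w z) 0; first by rewrite !mulr0.
rewrite ler_wpM2r ?Pk_ge0//; apply: (le_trans (hL w z)); rewrite ler_wpM2l//.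
by rewrite distrC; exact: Pk_supp h.
Qed.

(** If the averages of f at scale d do not depend on d, then they equal mass *
    f almost everywhere. Against a test function phi, Fubini moves the
    averaging to phi, whose averages tend uniformly to mass * phi as d tends
    to 0; the fundamental lemma concludes. *)
Lemma averages_limit f H (r : R) w0 : loci f -> 0 < r ->
  (forall w d, sq w0 w <= rad r -> 0 < d -> d <= rad r ->
     I2 (fun z => f z * Pk d w z) = H w) ->
  aep (fun w => w0.1 - r / 4 < w.1 < w0.1 + r / 4 ->
                w0.2 - r / 4 < w.2 < w0.2 + r / 4 -> mass * f w = H w).
Proof.
move=> lf r0 hH; pose q : R := `|w0| + r; have d0 := rad_gt0 r0.
have boxP w := @box_ball r w0 w r0.
have i1 := integ_trunc1 q.
have s1 : supp_box q (trunc q (fun=> 1 : R)).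
  by move=> x; rewrite /trunc; case: ifPn => //; rewrite eqxx.
have [j1 _ _] := fubini4 lf i1 s1 d0.
have itf : integ (trunc q f) by case: lf.
pose g w := mass * trunc q f w - trunc q (fun=> 1) w * I2 (fun z => f z * Pk (rad r) w z).
have ig : integ g by apply: integB => //; exact: integZ.
suff : aep (fun w => w0.1 - r / 4 < w.1 < w0.1 + r / 4 -> w0.2 - r / 4 < w.2 < w0.2 + r / 4 -> g w = 0).
  apply: aep_sub => w h h1 h2; have [h3 h4] := boxP w h1 h2.
  by have /eqP := h h1 h2; rewrite /g /trunc h4 mul1r (hH w _ h3 d0 (lexx _)) subr_eq0 => /eqP.
apply: fundamental_box => // phi tphi _ hphi.
have [L L0 hL] := test_lipschitz tphi.
have phiq : supp_box q phi by move=> x /hphi [h1 h2]; have [] := boxP _ h1 h2.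
have ifphi := loci_integ_test lf tphi.
pose C : R := L * mass * I2 (fun z => `|trunc (q + 1) f z|).
have key e : 0 < e -> e <= 1 -> e ^+ 2 <= rad r -> `|I2 (fun x => g x * phi x)| <= e * C.
  move=> e0 e1 er; have de0 : 0 < e ^+ 2 by rewrite exprn_gt0.
  have [k1 k2 k3] := fubini4 lf (test_integ tphi) phiq de0.
  have im := integZ mass ifphi.
  have -> : I2 (fun x => g x * phi x) =
     I2 (fun z => mass * (f z * phi z) - f z * I2 (fun w => phi w * Pk (e ^+ 2) w z)).
    apply: etrans (esym (I2B im k2)); rewrite -k3; apply: etrans (I2B im k1).
    congr I2; apply/funext => w; rewrite /g.
    have [->|p0] := eqVneq (phi w) 0; first by rewrite !(mul0r, mulr0) subrr.
    have [h1 h2] := hphi w p0; have [h3 h4] := boxP w h1 h2.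
    rewrite /trunc h4 (hH w _ h3 d0 (lexx _)) (hH w _ h3 de0 er).
    by move: (H w) (f w) (phi w) => *; ring.
  apply: (le_trans (I2_norm (integB im k2))).
  have iB : integ (fun z => e * (L * mass * `|trunc (q + 1) f z|)).
    by apply: integZ; apply: integZ; apply: integ_norm; case: lf.
  rewrite /C -I2Z; last by apply: integ_norm; case: lf.
  rewrite -I2Z; last by apply: integZ; apply: integ_norm; case: lf.
  apply: le_I2; [exact: integ_norm (integB im k2)|exact: iB|move=> z].
  have := average_test z tphi e0 hL; set A := I2 _ => hA.
  have -> : mass * (f z * phi z) - f z * A = f z * (mass * phi z - A) by ring.
  rewrite normrM distrC; have [zq|zq] := leP `|z| (q + 1).
    rewrite /trunc zq [leLHS]mulrC (_ : e * _ = L * e * mass * `|f z|); last by ring.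
    by rewrite ler_wpM2r.
  have qz : q < `|z| by apply: lt_trans zq; rewrite ltrDl.
  have z0 : phi z = 0 := supp_box_eq0 phiq qz.
  rewrite (_ : A = 0).
    rewrite z0 mulr0 subrr normr0 mulr0.
    exact: (mulr_ge0 (ltW e0) (mulr_ge0 (mulr_ge0 L0 mass_ge0) (normr_ge0 _))).
  rewrite /A (_ : (fun w => _) = fun=> 0 * 0).
    by rewrite (I2Z 0 (test_integ test0)) mul0r.
  apply/funext => w; have [->|p0] := eqVneq (phi w) 0; first by rewrite !mul0r.
  have [->|/(Pk_supp e0) h] := eqVneq (Pk (e ^+ 2) w z) 0; first by rewrite !mulr0.
  have h5 : `|z| <= `|z - w| + `|w| by rewrite -{1}[z](subrK w) ler_normD.
  have := lt_le_trans zq (le_trans h5 (lerD h (phiq w p0))).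
  by rewrite addrC ltrD2r ltNge e1.
have C0 : 0 <= C.
  exact: (mulr_ge0 (mulr_ge0 L0 mass_ge0) (I2_ge0 (fun z => normr_ge0 _))).
apply/eqP; rewrite -normr_eq0 eq_le normr_ge0 andbT.
apply/ler_addgt0Pr => eta eta0; rewrite add0r.
pose e := Num.min 1 (Num.min (Num.sqrt (rad r)) (eta / (C + 1))).
have e0 : 0 < e by rewrite !lt_min ltr01 sqrtr_gt0 d0 divr_gt0// ltr_wpDl.
apply: (le_trans (key e e0 _ _)).
- by rewrite ge_min lexx.
- rewrite -[leRHS]sqr_sqrtr ?(ltW d0)// ler_sqr ?nnegrE ?sqrtr_ge0 ?(ltW e0)//.
  by rewrite /e !ge_min lexx orbT.
- have : e <= eta / (C + 1) by rewrite /e !ge_min lexx !orbT.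
  rewrite ler_pdivlMr ?ltr_wpDl//; apply: le_trans.
  by rewrite ler_wpM2l ?(ltW e0)// lerDl.
Qed.


Lemma rep_local f1 f2 (r : R) w0 : loci f1 -> loci f2 -> wCR f1 f2 -> 0 < r ->
  aep (fun w => w0.1 - r / 4 < w.1 < w0.1 + r / 4 ->
                w0.2 - r / 4 < w.2 < w0.2 + r / 4 ->
                mass * f1 w = HH1 f1 f2 r w0 w /\ mass * f2 w = HH2 f1 f2 r w0 w).
Proof.
move=> l1 l2 cr r0.
have h1 := @averages_limit f1 (HH1 f1 f2 r w0) r w0 l1 r0.
have h2 := @averages_limit f2 (HH2 f1 f2 r w0) r w0 l2 r0.
have k1 := h1 (fun w d a b c => (mean_value l1 l2 cr r0 b c a).1).
have k2 := h2 (fun w d a b c => (mean_value l1 l2 cr r0 b c a).2).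
by apply: aep_sub (aep_and k1 k2) => w [a b] c d; split; [exact: a|exact: b].
Qed.

Lemma I2_trunc1 (r : R) : 0 <= r -> I2 (trunc r (fun=> 1)) = (2 * r) ^+ 2.
Proof.
move=> r0; apply: EFin_inj; rewrite (I2_EFin (integ_trunc1 r)).
pose B : set (measurableTypeR R) := [set` `[- r, r]]%R.
have mB : measurable B by exact: measurable_itv.
transitivity (\int[@leb2 R]_x (\1_(B `*` B : set (Plane R)) x)%:E)%E.
  apply: eq_integral => x _; rewrite /trunc indicE; congr EFin.
  have E : (`|x| <= r) = (x \in B `*` B).
    by apply/idP/idP => [/box_normE h|]; [rewrite inE|rewrite inE => h; apply/box_normE].
  by rewrite -E; case: ifP.
rewrite integral_indic//; last exact: measurableX.
rewrite (_ : _ `&` _ = B `*` B); last by rewrite setIT.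
rewrite leb2X// !lebesgue_measure_itv /= lte_fin.
case: ifPn => h; first by rewrite -EFinB -EFinM; congr EFin; ring.
have -> : r = 0 by apply/eqP; move: h r0; rewrite -leNgt => h r0; rewrite eq_le r0 andbT; lra.
by rewrite mule0 mulr0 expr0n.
Qed.

Lemma is_derive_scale f (c : R) x v (d : R) :
  is_derive (c *: x) v f d -> is_derive x v (fun x => f (c *: x)) (c * d).
Proof.
move=> /is_derive_line h; apply/is_derive_line.
rewrite (_ : (fun h : R => _) = (fun t : R => f (t *: v + c *: x)) \o (fun h : R => h * c + 0)).
  have h1 := is_derive_affine c 0 (0 : R).
  have h2 : is_derive ((fun h : R => h * c + 0) 0) 1 (fun t : R => f (t *: v + c *: x)) d.
    by rewrite mul0r addr0.
  by rewrite mulrC; apply: is_derive1_comp.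
by apply/funext => t /=; rewrite addr0 scalerDr scalerA (mulrC t).
Qed.

(** The cutoff at scale r is a rescaling of the cutoff at scale 1. *)
Lemma test_partial_chi_bound : exists2 M : R, 0 <= M & forall (r : R) j z, 0 < r ->
  `|partial j (chi r 0) z| <= M / r.
Proof.
have t1 := test_chi (0 : R * R) (@ltr01 R); have s1 := test_smooth t1.
have [M0 M00 h0] := test_bounded (test_partial 0 t1).
have [M1 M10 h1] := test_bounded (test_partial 1 t1).
exists (M0 + M1) => [|r j z r0]; first exact: addr_ge0.
have hj x : `|partial j (chi 1 0) x| <= M0 + M1.
  case: j => -[|[|//]] i.
    have -> : Ordinal i = 0 by apply/val_inj.
    by apply: (le_trans (h0 x)); rewrite lerDl.
  have -> : Ordinal i = 1 by apply/val_inj.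
  by apply: (le_trans (h1 x)); rewrite lerDr.
have E : chi r 0 = fun z => chi 1 0 (r^-1 *: z).
  by apply/funext => y; exact: chi_scale.
have dE x : is_derive x (basis_vec j) (chi r 0) (r^-1 * partial j (chi 1 0) (r^-1 *: x)).
  by rewrite E; apply: is_derive_scale; exact: smooth_is_derive.
rewrite (partialE dE).
by rewrite normrM normfV (gtr0_norm r0) mulrC ler_wpM2r ?invr_ge0 ?(ltW r0).
Qed.

Lemma Ker_bound r w0 w z : 0 < r -> sq w0 w <= rad r -> r ^+ 2 <= sq w0 z ->
  `|Ker1 (rad r) w z| <= 2 / r /\ `|Ker2 (rad r) w z| <= 2 / r.
Proof.
move=> r0 h1 h2; have h3 := far_from_center h1 h2.
rewrite (Ker1_far h3) (Ker2_far h3).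
have h4 : (r / 2) ^+ 2 <= sq w z by apply: le_trans h3; rewrite -radE.
have s0 : 0 < sq w z by apply: lt_le_trans h4; rewrite exprn_gt0 ?divr_gt0.
have aux (a : R) : a ^+ 2 <= sq w z -> `|a / sq w z| <= 2 / r.
  move=> ha; rewrite -ler_sqr ?nnegrE ?divr_ge0 ?(ltW r0)// real_normK ?num_real//.
  rewrite expr_div_n ler_pdivrMr ?exprn_gt0//.
  have : 1 <= (2 / r) ^+ 2 * sq w z.
    rewrite -[leLHS](_ : (2 / r) ^+ 2 * (r / 2) ^+ 2 = 1).
      by rewrite ler_wpM2l ?sqr_ge0.
    by rewrite -exprMn (_ : 2 / r * (r / 2) = 1) ?expr1n//; field; exact: lt0r_neq0.
  move=> h5; apply: le_trans ha _; rewrite expr2 mulrA -[leLHS]mul1r.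
  by rewrite ler_wpM2r// ltW.
split; apply: aux; rewrite ?sqrrN /sq ?lerDl ?lerDr ?sqr_ge0//.
Qed.


Lemma mass_gt0 : 0 < mass.
Proof.
have c1 := smooth_continuous (smooth_Pk (0 : R * R) (@ltr01 R)) (x := 0).
have p0 : 0 < Pk 1 0 (0 : R * R).
  by apply: Pk_gt0; rewrite /sq !subrr expr0n addr0.
have : \forall z \near (0 : R * R), Pk 1 0 0 / 2 < Pk 1 0 z.
  apply: (c1 [set t | Pk 1 0 0 / 2 < t]); apply: lt_nbhsr; lra.
move=> /nbhs_ballP[e /= e0 he].
have i1 := integZ (Pk 1 0 0 / 2) (integ_trunc1 (e / 2)).
apply: (@lt_le_trans _ _ (Pk 1 0 0 / 2 * (2 * (e / 2)) ^+ 2)).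
  apply: mulr_gt0; first exact: divr_gt0.
  by apply: exprn_gt0; apply: mulr_gt0 => //; exact: divr_gt0.
rewrite -I2_trunc1; last by rewrite divr_ge0// ltW.
rewrite -(I2Z _ (integ_trunc1 _)); apply: le_I2.
- exact: i1.
- exact: test_integ (test_Pk 0 ltr01).
- move=> z; rewrite /trunc; case: ifPn => hz; last by rewrite mulr0; exact: Pk_ge0.
  rewrite mulr1 ltW//; apply: he; rewrite -ball_normE /ball_ /= sub0r normrN.
  by apply: le_lt_trans hz _; rewrite ltr_pdivrMr// ltr_pMr// ltr1n.
Qed.

Lemma integ_mu f1 f2 r w0 : loci f1 -> loci f2 -> 0 < r ->
  integ (mu1 f1 f2 r w0) /\ integ (mu2 f1 f2 r w0).
Proof.
move=> l1 l2 r0; have h f j : loci f -> integ (fun z => f z * partial j (chi r w0) z).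
  by move=> lf; apply: loci_integ_test => //; apply: test_partial; exact: test_chi.
split; [exact: (integB (h f1 0 l1) (h f2 1 l2))|exact: (integD (h f1 1 l1) (h f2 0 l2))].
Qed.

Lemma mu_near f1 f2 r w0 z : 0 < r -> sq w0 z < r ^+ 2 ->
  mu1 f1 f2 r w0 z = 0 /\ mu2 f1 f2 r w0 z = 0.
Proof.
move=> r0 h; rewrite /mu1 /mu2 (partial_chi_near 0 r0 h) (partial_chi_near 1 r0 h).
by rewrite !mulr0 subrr addr0.
Qed.

Definition mu_mass f1 f2 r w0 : R :=
  I2 (fun z => `|mu1 f1 f2 r w0 z| + `|mu2 f1 f2 r w0 z|).

(** The density mu vanishes in the disc of radius r, so the other factor needs
    to be bounded only outside of it. *)
Lemma mu_bound f1 f2 r w0 (A B : R * R -> R) (K : R) : loci f1 -> loci f2 -> 0 < r ->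
  meas2 A -> meas2 B ->
  (forall z, r ^+ 2 <= sq w0 z -> `|A z| <= K /\ `|B z| <= K) ->
  integ (fun z => mu1 f1 f2 r w0 z * A z + mu2 f1 f2 r w0 z * B z) /\
  `|I2 (fun z => mu1 f1 f2 r w0 z * A z + mu2 f1 f2 r w0 z * B z)| <=
    K * mu_mass f1 f2 r w0.
Proof.
move=> l1 l2 r0 mA mB h; have [i1 i2] := integ_mu w0 l1 l2 r0.
have im := integD (integ_norm i1) (integ_norm i2).
have le z : `|mu1 f1 f2 r w0 z * A z + mu2 f1 f2 r w0 z * B z| <=
    K * (`|mu1 f1 f2 r w0 z| + `|mu2 f1 f2 r w0 z|).
  have [/(@mu_near f1 f2 _ _ _ r0)[-> ->]|/h[hA hB]] := ltP (sq w0 z) (r ^+ 2).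
    by rewrite !mul0r addr0 normr0 addr0 mulr0.
  apply: (le_trans (ler_normD _ _)); rewrite !normrM mulrDr.
  by apply: lerD; rewrite mulrC ler_wpM2r.
have ig : integ (fun z => mu1 f1 f2 r w0 z * A z + mu2 f1 f2 r w0 z * B z).
  apply: (integ_le _ le); last exact: integZ.
  by apply: meas2D; apply: meas2M => //; exact: integ_meas.
split=> //; apply: (le_trans (I2_norm ig)); rewrite -(I2Z _ im).
by apply: le_I2 => //; [exact: integ_norm|exact: integZ].
Qed.

Lemma HH_bound f1 f2 r w0 w : loci f1 -> loci f2 -> 0 < r -> sq w0 w <= rad r ->
  `|HH1 f1 f2 r w0 w| <= 2 / r * mu_mass f1 f2 r w0 /\
  `|HH2 f1 f2 r w0 w| <= 2 / r * mu_mass f1 f2 r w0.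
Proof.
move=> l1 l2 r0 hw; have d0 := rad_gt0 r0.
have m1 := smooth_meas2 (smooth_Ker1 w d0); have m2 := smooth_meas2 (smooth_Ker2 w d0).
have kb z (h : r ^+ 2 <= sq w0 z) := Ker_bound r0 hw h.
split; rewrite normrN; last first.
  by apply: (mu_bound l1 l2 r0 m2 m1 _).2 => z /kb[? ?]; split.
rewrite (_ : (fun z => _) = fun z => mu1 f1 f2 r w0 z * Ker1 (rad r) w z +
    mu2 f1 f2 r w0 z * - Ker2 (rad r) w z); last by apply/funext => z; rewrite mulrN.
by apply: (mu_bound l1 l2 r0 m1 (meas2N m2) _).2 => z /kb[? ?]; rewrite normrN; split.
Qed.

(** The arithmetic-geometric inequality, weighted by r so that the constant
    term becomes 1/r. *)
Lemma amgm_inv (r a b : R) : 0 < r ->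
  `|a| + `|b| <= r / 2 * (a ^+ 2 + b ^+ 2) + r^-1.
Proof.
move=> r0; have r_neq0 := lt0r_neq0 r0.
rewrite -(real_normK (num_real a)) -(real_normK (num_real b)) -subr_ge0.
rewrite (_ : _ - _ = r / 2 * ((`|a| - r^-1) ^+ 2 + (`|b| - r^-1) ^+ 2)); last by field.
by rewrite mulr_ge0 ?addr_ge0 ?sqr_ge0// divr_ge0// ltW.
Qed.

Lemma rotation_bound (m a b p q : R) : `|p| <= m -> `|q| <= m ->
  `|a * p - b * q| + `|a * q + b * p| <= 2 * m * (`|a| + `|b|).
Proof.
move=> hp hq; have h (s t : R) : `|t| <= m -> `|s * t| <= m * `|s|.
  by move=> ht; rewrite normrM mulrC ler_wpM2r.
have := ler_normB (a * p) (b * q); have := ler_normD (a * q) (b * p).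
have := h a _ hp; have := h b _ hp; have := h a _ hq; have := h b _ hq.
move: (`|a|) (`|b|) => A B *; lra.
Qed.

(** The gradient of the cutoff is O(1/r) and is supported in a box of area
    O(r^2). Bounding |f| by r/2 |f|^2 + 1/r makes both contributions to the
    integral of |f|/r bounded independently of r. *)
Lemma mu_mass_L2 f1 f2 : meas2 f1 -> meas2 f2 -> integ (fun x => f1 x ^+ 2) ->
  integ (fun x => f2 x ^+ 2) ->
  exists C : R, forall r : R, 0 < r -> mu_mass f1 f2 r 0 <= C.
Proof.
move=> m1 m2 q1 q2; have l1 := integ_sq_loci m1 q1; have l2 := integ_sq_loci m2 q2.
have [M M0 hM] := test_partial_chi_bound.
(* The box of half-side 2 r has area 16 r^2, which gives the constant 16. *)
exists (2 * M * (2^-1 * I2 (fun x => f1 x ^+ 2 + f2 x ^+ 2) + 16)) => r r0.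
have iq := integD q1 q2; have it := integ_trunc1 (2 * r).
pose G z := 2 * M / r * (r / 2 * (f1 z ^+ 2 + f2 z ^+ 2) + r^-1 * trunc (2 * r) (fun=> 1) z).
have iG : integ G by apply: integZ; apply: integD; exact: integZ.
have r_neq0 := lt0r_neq0 r0.
have r2 : 0 <= 2 * r by rewrite mulr_ge0 ?(ltW r0).
have -> : 2 * M * (2^-1 * I2 (fun x => f1 x ^+ 2 + f2 x ^+ 2) + 16) = I2 G.
  rewrite (I2Z _ (integD (integZ _ iq) (integZ _ it))) (I2D (integZ _ iq) (integZ _ it)).
  rewrite (I2Z _ iq) (I2Z _ it) (I2_trunc1 r2).
  by move: (I2 _) => q; field.
have [i1 i2] := integ_mu 0 l1 l2 r0.
apply: le_I2 => //; first exact: (integD (integ_norm i1) (integ_norm i2)).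
move=> z; have [hz|hz] := leP `|z| (2 * r); last first.
  have d0 j : partial j (chi r 0) z = 0.
    have hs : supp_box (2 * r) (partial j (chi r 0)).
      by apply: supp_box_partial; have := @supp_chi r 0 r0; rewrite normr0 add0r.
    exact: (supp_box_eq0 hs hz).
  rewrite /mu1 /mu2 !d0 !mulr0 subrr addr0 normr0 addr0 /G.
  rewrite mulr_ge0 ?divr_ge0 ?mulr_ge0 ?(ltW r0)//.
  rewrite addr_ge0 ?mulr_ge0 ?divr_ge0 ?addr_ge0 ?sqr_ge0 ?invr_ge0 ?(ltW r0)//.
  by rewrite /trunc; case: ifP.
rewrite /G /trunc hz mulr1.
have h0 := hM r 0 z r0; have h1 := hM r 1 z r0.
apply: le_trans (rotation_bound (f1 z) (f2 z) h0 h1) _.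
rewrite (mulrA 2 M); apply: ler_wpM2l; last exact: amgm_inv.
by rewrite divr_ge0 ?(mulr_ge0 _ M0)// ltW.
Qed.

(** By the Cauchy formula at scale r, mass * f is bounded by the mass of mu
    times the size 2/r of the kernel; letting r tend to infinity gives f = 0. *)
Lemma liouville_L2 f1 f2 : meas2 f1 -> meas2 f2 -> integ (fun x => f1 x ^+ 2) ->
  integ (fun x => f2 x ^+ 2) -> wCR f1 f2 ->
  aep (fun x => f1 x = 0 /\ f2 x = 0).
Proof.
move=> m1 m2 q1 q2 cr; have l1 := integ_sq_loci m1 q1; have l2 := integ_sq_loci m2 q2.
have [C hC] := mu_mass_L2 m1 m2 q1 q2.
have n0 (n : nat) : 0 < n.+1%:R :> R by [].
have key (n : nat) := rep_local 0 l1 l2 cr (n0 n).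
apply: aep_sub (aep_bigcap key) => x {}key.
have mass0 := mass_gt0.
suff main (a : R) : (forall n : nat, `|x| < n.+1%:R / 4 ->
    `|mass * a| <= 2 / n.+1%:R * C) -> a = 0.
  have K n : `|x| < n.+1%:R / 4 ->
     `|mass * f1 x| <= 2 / n.+1%:R * C /\ `|mass * f2 x| <= 2 / n.+1%:R * C.
    rewrite {1}prod_normE gt_max => /andP[x1 x2].
    have b1 : (0 : R * R).1 - n.+1%:R / 4 < x.1 < (0 : R * R).1 + n.+1%:R / 4.
      by rewrite sub0r add0r -ltr_norml.
    have b2 : (0 : R * R).2 - n.+1%:R / 4 < x.2 < (0 : R * R).2 + n.+1%:R / 4.
      by rewrite sub0r add0r -ltr_norml.
    have [e1 e2] := key n b1 b2; have [sx _] := box_ball (n0 n) b1 b2.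
    have [c1 c2] := HH_bound l1 l2 (n0 n) sx; rewrite e1 e2.
    have le : 2 / n.+1%:R * mu_mass f1 f2 n.+1%:R 0 <= 2 / n.+1%:R * C.
      by apply: ler_wpM2l; [rewrite divr_ge0|exact: hC].
    by split; [exact: le_trans c1 le|exact: le_trans c2 le].
  by split; apply: main => n /K[].
move=> h; apply/eqP; rewrite -(mulrI_eq0 a (lregP (lt0r_neq0 mass0))) -normr_eq0 eq_le normr_ge0 andbT.
have C0 : 0 <= C by apply: le_trans (hC 1 ltr01); apply: I2_ge0 => z; exact: addr_ge0.
apply/ler_addgt0Pr => e e0; rewrite add0r.
(* The scale r = N + 1 must satisfy |x| < r/4, to apply the Cauchy formula at
   x, and 2 C / r <= e. *)
pose y : R := 4 * `|x| + 2 * C / e.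
have c0 : 0 <= 2 * C / e by apply: divr_ge0; [exact: mulr_ge0|exact: ltW].
have x0 : 0 <= 4 * `|x| by exact: mulr_ge0.
have y0 : 0 <= y by exact: addr_ge0.
have hy := archi_boundP y0; pose N := Num.bound y.
have hN : y < N.+1%:R by apply: lt_trans hy _; rewrite ltr_nat.
have y1 : 4 * `|x| <= y by rewrite lerDl.
have y2 : 2 * C / e <= y by rewrite lerDr.
apply: le_trans (h N _) _.
  by rewrite ltr_pdivlMr// mulrC; exact: le_lt_trans y1 hN.
rewrite mulrAC ler_pdivrMr// -ler_pdivrMl// mulrC.
by apply: ltW; exact: le_lt_trans y2 hN.
Qed.

End Averages.

Local Open Scope complex_scope.


(** * Regularity and unique continuation of weakly holomorphic functions *)

Section Continuation.
Context {R : realType}.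
Implicit Types (f psi : R * R -> R) (w z : R * R) (g k : R * R -> R[i]).

(** The l^1 norm on the complex numbers: only submultiplicativity and
    comparability with the usual modulus matter, and estimates for this norm
    reduce to real ones. *)
Definition cabs (z : R[i]) : R := `|Re z| + `|Im z|.

Lemma cabs_ge0 (z : R[i]) : 0 <= cabs z. Proof. exact: addr_ge0. Qed.

Lemma cabsM (z w : R[i]) : cabs (z * w) <= cabs z * cabs w.
Proof.
case: z => a b; case: w => c d; rewrite /cabs /=.
have := ler_normB (a * c) (b * d); have := ler_normD (a * d) (b * c).
rewrite !normrM mulrDl !mulrDr; move: (`|a| * _) (`|a| * _) (`|b| * _) (`|b| * _) => *; lra.
Qed.

Lemma cabsN (z : R[i]) : cabs (- z) = cabs z.
Proof. by case: z => a b; rewrite /cabs /= !normrN. Qed.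

Lemma cabsX (z : R[i]) n : cabs (z ^+ n) <= cabs z ^+ n.
Proof.
elim: n => [|n IH]; first by rewrite !expr0 /cabs /= normr1 normr0 addr0.
rewrite !exprS; apply: le_trans (cabsM _ _) _.
by rewrite ler_wpM2l ?cabs_ge0.
Qed.

Lemma cabs_eq0 (z : R[i]) : (forall e : R, 0 < e -> cabs z <= e) -> z = 0.
Proof.
case: z => a b h; have : cabs (a +i* b) <= 0.
  by apply/ler_addgt0Pr => e /h; rewrite add0r.
rewrite /cabs /= => h0; have a0 := normr_ge0 a; have b0 := normr_ge0 b.
have /normr0_eq0 -> : `|a| = 0 by lra.
by have /normr0_eq0 -> : `|b| = 0 by lra.
Qed.

Definition cmeas g := meas2 (fun x => Re (g x)) /\ meas2 (fun x => Im (g x)).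
Definition cinteg g := integ (fun x => Re (g x)) /\ integ (fun x => Im (g x)).
Definition CI2 g : R[i] := I2 (fun x => Re (g x)) +i* I2 (fun x => Im (g x)).

Lemma Re_mulc (a b : R[i]) : Re (a * b) = Re a * Re b - Im a * Im b.
Proof. by case: a => ? ?; case: b. Qed.
Lemma Im_mulc (a b : R[i]) : Im (a * b) = Re a * Im b + Im a * Re b.
Proof. by case: a => ? ?; case: b. Qed.

Lemma cmeasM g k : cmeas g -> cmeas k -> cmeas (fun x => g x * k x).
Proof.
move=> [g1 g2] [k1 k2]; split.
  under eq_fun do rewrite Re_mulc.
  by apply: meas2D; [|apply: meas2N]; exact: meas2M.
under eq_fun do rewrite Im_mulc.
by apply: meas2D; exact: meas2M.
Qed.

Lemma cmeasX g n : cmeas g -> cmeas (fun x => g x ^+ n).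
Proof.
move=> mg; elim: n => [|n IH]; first by split; exact: meas2_cst.
by under eq_fun do rewrite exprS; exact: cmeasM.
Qed.

Lemma CI2_lin g k (c : R[i]) : cinteg g -> cinteg k ->
  CI2 (fun x => g x + c * k x) = CI2 g + c * CI2 k.
Proof.
move=> [g1 g2] [k1 k2]; case: c => a b; rewrite /CI2.
have E1 x : Re (g x + (a +i* b) * k x) = Re (g x) + (a * Re (k x) - b * Im (k x)).
  by rewrite raddfD /= Re_mulc.
have E2 x : Im (g x + (a +i* b) * k x) = Im (g x) + (a * Im (k x) + b * Re (k x)).
  by rewrite raddfD /= Im_mulc.
under eq_fun do rewrite E1; under [X in _ +i* I2 X = _]eq_fun do rewrite E2.
have ak1 := integZ a k1; have ak2 := integZ a k2.
have bk1 := integZ b k1; have bk2 := integZ b k2.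
rewrite (I2D g1 (integB ak1 bk2)) (I2D g2 (integD ak2 bk1)) (I2B ak1 bk2) (I2D ak2 bk1).
by rewrite !I2Z.
Qed.

Definition cpt (z : R * R) : R[i] := z.1 +i* z.2.
Definition cker (d : R) w z : R[i] := Ker1 d w z +i* Ker2 d w z.
Definition cmu f1 f2 (r : R) w0 z : R[i] := mu1 f1 f2 r w0 z +i* mu2 f1 f2 r w0 z.

Lemma cker_inv d w z : 0 < d -> d <= sq w z -> cker d w z * (cpt z - cpt w) = 1.
Proof.
move=> d0 h; rewrite /cker (Ker1_far h) (Ker2_far h).
have s0 : sq w z != 0 by rewrite gt_eqF// (lt_le_trans d0).
apply/eqP; rewrite eq_complex /=; move: s0; rewrite /sq.
move: (z.1 - w.1) (z.2 - w.2) => a b s0.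
by apply/andP; split; apply/eqP; field.
Qed.

(** The resolvent identity 1/(z - w) = 1/(z - w0) + (w - w0) / ((z - w0) (z -
    w)). *)
Lemma cker_diff r w0 w z : 0 < r -> sq w0 w <= rad r -> r ^+ 2 <= sq w0 z ->
  cker (rad r) w z =
  cker (rad r) w0 z + (cpt w - cpt w0) * (cker (rad r) w0 z * cker (rad r) w z).
Proof.
move=> r0 h1 h2; have d0 := rad_gt0 r0.
have e1 := cker_inv d0 (far_from_center h1 h2).
have h0 : sq w0 w0 <= rad r by rewrite /sq !subrr expr0n addr0 ltW.
have e2 := cker_inv d0 (far_from_center h0 h2).
move: e1 e2; move: (cker _ w z) (cker _ w0 z) => K K0 e1 e2.
transitivity (K * (K0 * (cpt z - cpt w0))); first by rewrite e2 mulr1.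
transitivity (K0 * (K * (cpt z - cpt w)) + (cpt w - cpt w0) * (K0 * K)); first by ring.
by rewrite e1 mulr1.
Qed.

Lemma cmeas_cker d w : 0 < d -> cmeas (cker d w).
Proof.
by move=> d0; split; apply: smooth_meas2; [exact: smooth_Ker1|exact: smooth_Ker2].
Qed.

Lemma cker_bound r w0 w z : 0 < r -> sq w0 w <= rad r -> r ^+ 2 <= sq w0 z ->
  cabs (cker (rad r) w z) <= 4 / r.
Proof.
move=> r0 h1 h2; have [a b] := Ker_bound r0 h1 h2; rewrite /cabs /=.
have -> : 4 / r = 2 / r + 2 / r by rewrite -mulrDl -natrD.
exact: lerD.
Qed.

Lemma cmu_bound f1 f2 r w0 g (K : R) : loci f1 -> loci f2 -> 0 < r -> cmeas g ->
  (forall z, r ^+ 2 <= sq w0 z -> cabs (g z) <= K) ->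
  cinteg (fun z => cmu f1 f2 r w0 z * g z) /\
  cabs (CI2 (fun z => cmu f1 f2 r w0 z * g z)) <= 2 * K * mu_mass f1 f2 r w0.
Proof.
move=> l1 l2 r0 [m1 m2] h.
have h1 z : r ^+ 2 <= sq w0 z -> `|Re (g z)| <= K /\ `|- Im (g z)| <= K.
  by rewrite normrN => /h; rewrite /cabs => h'; split; apply: le_trans h'; rewrite ?lerDl ?lerDr.
have h2 z : r ^+ 2 <= sq w0 z -> `|Im (g z)| <= K /\ `|Re (g z)| <= K.
  by move=> /h1; rewrite normrN => -[].
have [i1 b1] := mu_bound l1 l2 r0 m1 (meas2N m2) h1.
have [i2 b2] := mu_bound l1 l2 r0 m2 m1 h2.
have E1 : (fun z => Re (cmu f1 f2 r w0 z * g z)) =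
    fun z => mu1 f1 f2 r w0 z * Re (g z) + mu2 f1 f2 r w0 z * - Im (g z).
  by apply/funext => z; rewrite Re_mulc mulrN.
have E2 : (fun z => Im (cmu f1 f2 r w0 z * g z)) =
    fun z => mu1 f1 f2 r w0 z * Im (g z) + mu2 f1 f2 r w0 z * Re (g z).
  by apply/funext => z; rewrite Im_mulc.
split; first by rewrite /cinteg E1 E2.
rewrite /cabs /CI2 /= E1 E2 -mulrA mulr_natl mulr2n; exact: lerD.
Qed.

Section Expansion.
Variables (f1 f2 : R * R -> R) (r : R) (w0 : R * R).
Hypotheses (l1 : loci f1) (l2 : loci f2) (r0 : 0 < r).

(** Up to sign, the n-th Taylor coefficient at w0 of the Cauchy integral of f. *)
Definition coef n : R[i] := CI2 (fun z => cmu f1 f2 r w0 z * cker (rad r) w0 z ^+ n.+1).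
(** Up to sign, the remainder of order n of the Taylor expansion at w0,
    divided by (w - w0)^n; for n = 0 it is the Cauchy integral itself. *)
Definition rem n w : R[i] :=
  CI2 (fun z => cmu f1 f2 r w0 z * (cker (rad r) w0 z ^+ n * cker (rad r) w z)).

Lemma w0_near : sq w0 w0 <= rad r.
Proof. by rewrite /sq !subrr expr0n addr0 ltW// rad_gt0. Qed.

Lemma coef_spec n : cinteg (fun z => cmu f1 f2 r w0 z * cker (rad r) w0 z ^+ n.+1).
Proof.
have d0 := rad_gt0 r0.
apply: (cmu_bound (K := (4 / r) ^+ n.+1) l1 l2 r0 _ _).1.
  by apply: cmeasX; exact: cmeas_cker.
move=> z hz; apply: le_trans (cabsX _ _) _; apply: lerXn2r; rewrite ?nnegrE ?cabs_ge0//.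
  by rewrite divr_ge0// ltW.
exact: (cker_bound r0 w0_near hz).
Qed.

Lemma rem_spec n w : sq w0 w <= rad r ->
  cinteg (fun z => cmu f1 f2 r w0 z * (cker (rad r) w0 z ^+ n * cker (rad r) w z)) /\
  cabs (rem n w) <= 2 * (4 / r) ^+ n.+1 * mu_mass f1 f2 r w0.
Proof.
move=> hw; have d0 := rad_gt0 r0; apply: cmu_bound => //.
  by apply: cmeasM; [apply: cmeasX|]; exact: cmeas_cker.
have r4 : 0 <= 4 / r by rewrite divr_ge0// ltW.
move=> z hz; apply: le_trans (cabsM _ _) _; rewrite exprSr.
apply: ler_pM; rewrite ?cabs_ge0//; last exact: (cker_bound r0 hw hz).
apply: le_trans (cabsX _ _) _; apply: lerXn2r; rewrite ?nnegrE ?cabs_ge0//.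
exact: (cker_bound r0 w0_near hz).
Qed.

(** One step of the geometric expansion of the kernel, by the resolvent
    identity. *)
Lemma remS n w : sq w0 w <= rad r ->
  rem n w = coef n + (cpt w - cpt w0) * rem n.+1 w.
Proof.
move=> hw; rewrite -(CI2_lin _ (coef_spec n) (rem_spec n.+1 hw).1); congr CI2.
apply/funext => z; have [h|h] := ltP (sq w0 z) (r ^+ 2).
  have [e1 e2] := mu_near f1 f2 r0 h.
  by rewrite /cmu e1 e2 !mul0r mulr0 addr0.
rewrite {1}(cker_diff r0 hw h) !exprSr; ring.
Qed.

Lemma HH_rem w : (HH1 f1 f2 r w0 w +i* HH2 f1 f2 r w0 w) = - rem 0 w.
Proof.
apply/eqP; rewrite eq_complex /HH1 /HH2 /rem /CI2 /=.
by apply/andP; split; apply/eqP; congr (- I2 _); apply/funext => z;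
  rewrite !mul1r !mul0r subr0 addr0.
Qed.

Hypothesis zeros : forall e : R, 0 < e -> exists w,
  [/\ cpt w != cpt w0, sq w0 w <= rad r, cabs (cpt w - cpt w0) <= e & rem 0 w = 0].

(** If the Cauchy integral vanishes at points tending to w0, all Taylor
    coefficients are 0: when the first n vanish, rem n vanishes at these
    points as well, and its value at w0 is coef n. *)
Lemma rem_pow n w : sq w0 w <= rad r -> rem 0 w = (cpt w - cpt w0) ^+ n * rem n w.
Proof.
elim: n w => [|n IH] w hw; first by rewrite expr0 mul1r.
suff c0 : coef n = 0 by rewrite IH// remS// c0 add0r mulrA -exprSr.
apply: cabs_eq0 => e e0.
have C0 : 0 <= 2 * (4 / r) ^+ n.+2 * mu_mass f1 f2 r w0.
  apply: mulr_ge0; last by apply: I2_ge0 => z; exact: addr_ge0.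
  by apply: mulr_ge0 => //; apply: exprn_ge0; rewrite divr_ge0// ltW.
set C := 2 * _ * _ in C0.
have C1 : 0 < C + 1 by rewrite ltr_wpDl.
have [v [vw hv ve v0]] := zeros (divr_gt0 e0 C1).
have d0 : cpt v - cpt w0 != 0 by rewrite subr_eq0.
have rv : rem n v = 0.
  by have /eqP := IH v hv; rewrite v0 eq_sym mulf_eq0 expf_eq0 (negbTE d0) andbF => /eqP.
have -> : coef n = - ((cpt v - cpt w0) * rem n.+1 v).
  by have := remS n hv; rewrite rv => /esym/eqP; rewrite addr_eq0 => /eqP.
rewrite cabsN; apply: le_trans (cabsM _ _) _.
apply: (@le_trans _ _ (e / (C + 1) * C)).
  by apply: ler_pM; rewrite ?cabs_ge0//; exact: (rem_spec n.+1 hv).2.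
rewrite mulrAC ler_pdivrMr// ler_wpM2l ?(ltW e0)//; lra.
Qed.

(** The remainder of order n is at most 2 (4/r)^(n+1) times a constant. For |w
    - w0| <= r/8 the factor (w - w0)^n turns this into a constant times
    2^(-n), for every n. *)
Lemma rem_eq0 w : sq w0 w <= rad r -> cabs (cpt w - cpt w0) <= r / 8 -> rem 0 w = 0.
Proof.
move=> hw h8; apply: cabs_eq0 => e e0.
set C := 2 * (4 / r) * mu_mass f1 f2 r w0.
have C0 : 0 <= C.
  apply: mulr_ge0; last by apply: I2_ge0 => z; exact: addr_ge0.
  by apply: mulr_ge0 => //; rewrite divr_ge0// ltW.
have bound n : cabs (rem 0 w) <= C / 2 ^+ n.
  rewrite (rem_pow n hw); apply: le_trans (cabsM _ _) _.
  have := (rem_spec n hw).2; have := cabsX (cpt w - cpt w0) n.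
  move=> h1 h2; apply: le_trans (ler_pM (cabs_ge0 _) (cabs_ge0 _) h1 h2) _.
  have h3 : cabs (cpt w - cpt w0) ^+ n <= (r / 8) ^+ n.
    by apply: lerXn2r; rewrite ?nnegrE ?cabs_ge0// divr_ge0// ltW.
  have -> : C / 2 ^+ n = (r / 8) ^+ n * (2 * (4 / r) ^+ n.+1 * mu_mass f1 f2 r w0).
    rewrite /C exprS -exprVn (_ : 2^-1 = r / 8 * (4 / r)); last by field; exact: lt0r_neq0.
    by rewrite exprMn; ring.
  apply: ler_wpM2r => //; apply: le_trans h2; exact: cabs_ge0.
(* Any N > C / e will do, since N < 2^N. *)
pose N := Num.bound (C / e).
have hN : C / e < 2 ^+ N.
  have := archi_boundP (divr_ge0 C0 (ltW e0)); move=> /lt_trans; apply.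
  by rewrite -natrX ltr_nat ltn_expl.
apply: le_trans (bound N) _; rewrite ler_pdivrMr ?exprn_gt0//.
by rewrite mulrC -ler_pdivrMr// ltW.
Qed.

End Expansion.

(** A correlation rather than a convolution, which accounts for the sign of
    its derivatives. *)
Definition conv f (psi : R * R -> R) w : R := I2 (fun z => f z * psi (z - w)).

Lemma taylor1 (k k' : R -> R) (L h : R) : (forall x : R, is_derive x 1 k (k' x)) ->
  (forall x, `|k' x - k' 0| <= L * `|x|) -> 0 <= L ->
  `|k h - k 0 - h * k' 0| <= L * h ^+ 2.
Proof.
move=> dk kL L0.
have dk2 (x : R) : is_derive x 1 (fun x => k x - x * k' 0) (k' x - k' 0).
  have h1 := is_derive_affine (k' 0) 0 x; have h2 := is_deriveB (dk x) h1.
  by rewrite (_ : (fun x => _) = (k - (fun x => x * k' 0 + 0)))//; apply/funext => y; rewrite -[RHS]/(k y - (y * k' 0 + 0)) addr0.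
have cd (x : R) : {for x, continuous (fun x => k x - x * k' 0)}.
  by apply/differentiable_continuous/derivable1_diffP; exact: (@ex_derive _ _ _ _ _ _ _ (dk2 x)).
have main (a b : R) : a <= b -> (a = 0 /\ b = h \/ a = h /\ b = 0) ->
    `|(k b - b * k' 0) - (k a - a * k' 0)| <= L * h ^+ 2.
  move=> ab abh; have [] := MVT_segment ab (fun x _ => dk2 x).
    exact: continuous_subspaceT.
  move=> c; rewrite in_itv /= => /andP[c1 c2] ->; rewrite normrM.
  have hc : `|c| <= `|h|.
    by case: abh => -[e1 e2]; subst a b; [rewrite !ger0_norm//; exact: le_trans c1 c2|rewrite !ler0_norm ?lerN2//; exact: le_trans c1 c2].
  have hb : `|b - a| = `|h| by case: abh => -[-> ->]; rewrite ?subr0 ?sub0r ?normrN.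
  rewrite hb -(real_normK (num_real h)) expr2 mulrA ler_wpM2r//.
  by apply: le_trans (kL c) _; rewrite ler_wpM2l.
rewrite (_ : k h - k 0 - h * k' 0 = (k h - h * k' 0) - (k 0 - 0 * k' 0)); last by ring.
have [h0|h0] := leP 0 h; first by apply: main => //; left.
by rewrite -normrN opprB; apply: main; [exact: ltW|right].
Qed.

Lemma is_derive_shift psi (w z v : R * R) (d : R) : is_derive (z - w) v psi d ->
  is_derive z v (fun z => psi (z - w)) d.
Proof.
move=> /is_derive_line h; apply/is_derive_line.
by under eq_fun do rewrite -addrA.
Qed.

Lemma continuous_shift psi (w : R * R) : continuous psi -> continuous (fun z : R * R => psi (z - w)).
Proof.
move=> cp z; apply: (@continuous_comp _ _ _ (fun z : R * R => z - w) psi); last exact: cp.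
by apply: cvgB; [exact: cvg_id|exact: cvg_cst].
Qed.

Lemma smooth_shift psi w : smooth psi -> smooth (fun z => psi (z - w)).
Proof.
move=> + k; elim: k psi => [|k IH] psi sp.
  exact: continuous_shift (smooth_continuous sp).
apply: (@Ck_S _ _ _ (fun (j : 'I_2) z => partial j psi (z - w))).
- exact: continuous_shift (smooth_continuous sp).
- by move=> j z; apply: is_derive_shift; exact: smooth_is_derive.
- by move=> j; apply: IH; exact: smooth_partial.
Qed.

Lemma test_shift psi w : test_fun psi -> test_fun (fun z => psi (z - w)).
Proof.
move=> /test_funP[sp [s hs]]; apply/test_funP; split; first exact: smooth_shift.
exists (s + `|w|) => z /hs h; rewrite -[z](subrK w).
by apply: le_trans (ler_normD _ _) _; rewrite lerD2r.
Qed.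

Lemma loci_conv_bound f (g : R * R -> R) (rho M : R) : loci f -> meas2 g ->
  supp_box rho g -> (forall z, `|g z| <= M) ->
  integ (fun z => f z * g z) /\
  `|I2 (fun z => f z * g z)| <= M * I2 (fun z => `|trunc rho f z|).
Proof.
move=> lf mg hg gM; have M0 : 0 <= M := le_trans (normr_ge0 _) (gM 0).
have it := integ_norm (lf.2 rho).
have le z : `|f z * g z| <= M * `|trunc rho f z|.
  rewrite normrM /trunc; case: ifPn => [_|]; first by rewrite mulrC ler_wpM2r.
  by rewrite -ltNge => /(supp_box_eq0 hg) ->; rewrite !normr0 !mulr0.
have ig : integ (fun z => f z * g z).
  by apply: (integ_le (meas2M lf.1 mg) le); exact: integZ.
split=> //; apply: (le_trans (I2_norm ig)); rewrite -(I2Z _ it).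
by apply: le_I2 => //; [exact: integ_norm|exact: integZ].
Qed.

Lemma conv_lipschitz f psi w : loci f -> test_fun psi ->
  exists2 C : R, 0 <= C & forall v, `|v - w| <= 1 -> `|conv f psi v - conv f psi w| <= C * `|v - w|.
Proof.
move=> lf tp; have [L L0 hL] := test_lipschitz tp.
have /test_funP[sp [s hs]] := tp.
pose rho := s + `|w| + 1.
exists (L * I2 (fun z => `|trunc rho f z|)) => [|v hv].
  by apply: mulr_ge0 => //; exact: I2_ge0.
have i1 := loci_integ_test lf (test_shift v tp).
have i2 := loci_integ_test lf (test_shift w tp).
have m1 := meas2D (smooth_meas2 (test_smooth (test_shift v tp)))
  (meas2N (smooth_meas2 (test_smooth (test_shift w tp)))).
rewrite /conv -(I2B i1 i2) mulrAC.
under eq_fun do rewrite -mulrBr.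
have sup z u : `|u - w| <= 1 -> psi (z - u) != 0 -> `|z| <= rho.
  move=> hu /hs h; rewrite -(subrK u z) -{2}(subrK w u).
  have := ler_normD (z - u) (u - w + w); have := ler_normD (u - w) w.
  rewrite /rho; lra.
apply: (loci_conv_bound lf m1 (rho := rho) _ _).2 => z.
  have [->|h _] := eqVneq (psi (z - v)) 0; last exact: sup h.
  by rewrite sub0r oppr_eq0; apply: sup; rewrite subrr normr0.
apply: le_trans (hL _ _) _.
by rewrite opprB addrC addrA subrK distrC.
Qed.


Lemma near_dist (w : R * R) (e : R) : 0 < e -> \forall v \near w, `|v - w| <= e.
Proof.
move=> e0; apply/nbhs_ballP; exists e => // v.
by rewrite -ball_normE /ball_ /= distrC => /ltW.
Qed.

Lemma conv_continuous f psi : loci f -> test_fun psi -> continuous (conv f psi).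
Proof.
move=> lf tp w; have [C C0 hC] := conv_lipschitz w lf tp.
apply/cvgrPdist_le => e e0.
have C1 : 0 < C + 1 by rewrite ltr_wpDl.
have e1 : 0 < Num.min 1 (e / (C + 1)) by rewrite lt_min ltr01 divr_gt0.
apply: filterS (near_dist w e1) => v; rewrite le_min => /andP[v1 v2].
rewrite distrC; apply: le_trans (hC v v1) _.
move: v2; rewrite ler_pdivlMr// mulrC; apply: le_trans.
by rewrite ler_wpM2r// lerDl.
Qed.

(** Differentiation under the integral: the Taylor remainder of psi is
    quadratic, uniformly in the point, since the derivatives of a test
    function are Lipschitz; and f is integrable on bounded boxes. *)
Lemma conv_is_derive f psi j w : loci f -> test_fun psi ->
  is_derive w (basis_vec j) (conv f psi) (- conv f (partial j psi) w).
Proof.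
move=> lf tp; have tq := test_partial j tp.
have [L L0 hL] := test_lipschitz tq; have /test_funP[sp [s hs]] := tp.
have hs' : supp_box s (partial j psi) by exact: supp_box_partial.
pose rho := s + `|w| + 1.
have e1 : `|basis_vec j : R * R| <= 1.
  by rewrite /basis_vec; case: ifP => _; rewrite prod_normE /= normr1 normr0 ge_max lexx ler01.
apply/is_derive_line; apply: (@is_derive_quad _ _ _ _ (L * I2 (fun z => `|trunc rho f z|))).
move=> h h1; rewrite add0r scale0r add0r; set v := h *: basis_vec j + w.
have i1 := loci_integ_test lf (test_shift v tp).
have i2 := loci_integ_test lf (test_shift w tp).
have i3 := loci_integ_test lf (test_shift w tq).
have m1 := meas2D (meas2D (smooth_meas2 (test_smooth (test_shift v tp)))
  (meas2N (smooth_meas2 (test_smooth (test_shift w tp)))))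
  (meas2M (meas2_cst h) (smooth_meas2 (test_smooth (test_shift w tq)))).
rewrite /conv mulrN opprK -(I2B i1 i2) -(I2Z h i3) -(I2D (integB i1 i2) (integZ h i3)) mulrAC.
rewrite (_ : (fun z => _) = fun z => f z *
   (psi (z - v) - psi (z - w) + h * partial j psi (z - w))); last first.
  by apply/funext => z; ring.
have hvw : `|v - w| <= 1.
  by rewrite /v addrK normrZ mulr_ile1.
have sup (p : R * R -> R) z u : `|u - w| <= 1 -> supp_box s p -> rho < `|z| -> p (z - u) = 0.
  move=> hu hp hz; apply: (supp_box_eq0 hp).
  have := ler_normD (z - u) (u - w + w); have := ler_normD (u - w) w.
  by rewrite (subrK w u) (subrK u z); move: hz; rewrite /rho; lra.
have hw : `|w - w| <= 1 by rewrite subrr normr0.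
apply: (loci_conv_bound lf m1 (rho := rho) _ _).2 => z.
  apply: contraNT; rewrite -ltNge => hz.
  by rewrite (sup _ _ _ hvw hs hz) (sup _ _ _ hw hs hz) (sup _ _ _ hw hs' hz) mulr0 addr0 subrr.
pose k (t : R) := psi (t *: basis_vec j + (z - w)).
pose k' (t : R) := partial j psi (t *: basis_vec j + (z - w)).
have dk (t : R) : is_derive t 1 k (k' t).
  have := smooth_is_derive (t *: basis_vec j + (z - w)) j sp.
  move=> /is_derive_line hd.
  rewrite (_ : k = (fun x : R => psi (x *: basis_vec j + (t *: basis_vec j + (z - w)))) \o (fun x : R => x * 1 + - t)).
    rewrite -[k' t]mulr1; apply: is_derive1_comp; last exact: is_derive_affine.
    by rewrite mulr1 subrr.
  by apply/funext => x /=; rewrite mulr1 addrA -scalerDl subrK.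
have kL (x : R) : `|k' x - k' 0| <= L * `|x|.
  apply: le_trans (hL _ _) _; rewrite opprD addrACA subrr addr0 -scalerBl subr0 normrZ.
  by rewrite ler_wpM2l// ler_piMr.
have := taylor1 (- h) dk kL L0; rewrite /k /k' scale0r add0r sqrrN mulNr opprK.
by rewrite (_ : - h *: basis_vec j + (z - w) = z - v)// /v opprD scaleNr addrCA.
Qed.

Lemma convN f psi w : loci f -> test_fun psi -> conv f (fun z => - psi z) w = - conv f psi w.
Proof.
move=> lf tp; rewrite /conv -(I2N (loci_integ_test lf (test_shift w tp))).
by congr I2; apply/funext => z; rewrite mulrN.
Qed.

Lemma smooth_conv f psi : loci f -> test_fun psi -> smooth (conv f psi).
Proof.
move=> lf + k; elim: k psi => [|k IH] psi tp; first exact: conv_continuous.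
apply: (@Ck_S _ _ _ (fun (j : 'I_2) => conv f (fun z => - partial j psi z))).
- exact: conv_continuous.
- by move=> j w; rewrite convN//; [exact: conv_is_derive|exact: test_partial].
- by move=> j; apply: IH; apply: testN; exact: test_partial.
Qed.

(** The smooth representative of a weakly holomorphic function: its average at
    scale 1, normalised. By the mean value property any scale would give the
    same function. *)
Definition regular f : R * R -> R := fun w => I2 (fun z => f z * Pk 1 w z) / mass.

Lemma regularE f w : regular f w = conv f (Pk 1 0) w / mass.
Proof. apply: (congr1 (fun F => I2 F / mass)); apply/funext => z.
exact: (congr1 (fun t => f z * t) (esym (Pk_shift 1 w z))). Qed.

Lemma smooth_regular f : loci f -> smooth (regular f).
Proof.
move=> lf; rewrite (_ : regular f = fun w => conv f (Pk 1 0) w * mass^-1).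
  by apply: smoothM; [apply: smooth_conv => //; exact: test_Pk|exact: smooth_cst].
by apply/funext => w; exact: regularE.
Qed.

Lemma regular_HH f1 f2 r w0 w : loci f1 -> loci f2 -> wCR f1 f2 -> 2 <= r ->
  sq w0 w <= rad r ->
  regular f1 w = HH1 f1 f2 r w0 w / mass /\ regular f2 w = HH2 f1 f2 r w0 w / mass.
Proof.
move=> l1 l2 cr r2 hw; have r0 : 0 < r by exact: lt_le_trans r2.
have d1 : 1 <= rad r by rewrite /rad; nra.
by have [<- <-] := mean_value l1 l2 cr r0 ltr01 d1 hw.
Qed.

(** Both sides are the Cauchy integral divided by the mass, locally, and
    countably many localisations cover the plane. *)
Lemma regular_ae f1 f2 : loci f1 -> loci f2 -> wCR f1 f2 ->
  aep (fun w => f1 w = regular f1 w /\ f2 w = regular f2 w).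
Proof.
move=> l1 l2 cr.
have n0 (n : nat) : 2 <= n.+2%:R :> R by rewrite ler_nat.
have n1 (n : nat) : 0 < n.+2%:R :> R by [].
have key (n : nat) := rep_local 0 l1 l2 cr (n1 n).
apply: aep_sub (aep_bigcap key) => x {}key.
pose n := Num.bound (4 * `|x|).
have hn : `|x| < n.+2%:R / 4.
  rewrite ltr_pdivlMr// mulrC; apply: lt_le_trans (archi_boundP _) _; first exact: mulr_ge0.
  by rewrite ler_nat; exact: leq_trans (leqnSn n) (leqnSn _).
move: hn; rewrite prod_normE gt_max => /andP[x1 x2].
have b1 : (0 : R * R).1 - n.+2%:R / 4 < x.1 < (0 : R * R).1 + n.+2%:R / 4.
  by rewrite sub0r add0r -ltr_norml.
have b2 : (0 : R * R).2 - n.+2%:R / 4 < x.2 < (0 : R * R).2 + n.+2%:R / 4.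
  by rewrite sub0r add0r -ltr_norml.
have [e1 e2] := key n b1 b2; have [sx _] := box_ball (n1 n) b1 b2.
have [-> ->] := regular_HH l1 l2 cr (n0 n) sx.
have m0 := lt0r_neq0 (@mass_gt0 R).
by rewrite -e1 -e2; split; rewrite mulrAC divff// mul1r.
Qed.

Lemma cabs_norm w0 v : cabs (cpt v - cpt w0) <= 2 * `|v - w0|.
Proof.
rewrite /cabs /= prod_normE /=; set a := `|v.1 - w0.1|; set b := `|v.2 - w0.2|.
have h1 : a <= Num.max a b by rewrite le_max lexx.
have h2 : b <= Num.max a b by rewrite le_max lexx orbT.
by rewrite mulr_natl mulr2n; exact: lerD.
Qed.

Lemma sq_cabs w0 v (e : R) : 0 <= e -> cabs (cpt v - cpt w0) <= e -> sq w0 v <= e ^+ 2.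
Proof.
move=> e0; rewrite /cabs /= => h.
have := @lerXn2r R 2 _ _ (addr_ge0 (normr_ge0 (v.1 - w0.1)) (normr_ge0 (v.2 - w0.2))) e0 h.
rewrite /sq -(real_normK (num_real (v.1 - w0.1))) -(real_normK (num_real (v.2 - w0.2))).
have := mulr_ge0 (normr_ge0 (v.1 - w0.1)) (normr_ge0 (v.2 - w0.2)).
move: (`|v.1 - w0.1|) (`|v.2 - w0.2|) => a b; rewrite sqrrD; lra.
Qed.

(** The Cauchy formula is available at every scale r, so no chain of discs is
    necessary: for a given w one takes r so large that w lies in the disc of
    radius r/8 about w0. *)
Lemma unique_continuation f1 f2 w0 : loci f1 -> loci f2 -> wCR f1 f2 ->
  (forall e : R, 0 < e -> exists w,
     [/\ w != w0, `|w - w0| <= e, regular f1 w = 0 & regular f2 w = 0]) ->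
  forall w, regular f1 w = 0 /\ regular f2 w = 0.
Proof.
move=> l1 l2 cr zeros w; have m0 := lt0r_neq0 (@mass_gt0 R).
(* With this r, w is in the disc of radius r/8, and r >= 2 makes the scale 1
   of the averages admissible at w. *)
pose r : R := 2 + 8 * cabs (cpt w - cpt w0).
have c0 := cabs_ge0 (cpt w - cpt w0).
have r2 : 2 <= r by rewrite lerDl mulr_ge0.
have r0 : 0 < r by exact: lt_le_trans r2.
have near v : cabs (cpt v - cpt w0) <= r / 8 -> sq w0 v <= rad r.
  have r8 : 0 <= r / 8 by rewrite divr_ge0// ltW.
  move=> /(sq_cabs r8) h; apply: le_trans h _; rewrite radE.
  by apply: lerXn2r; rewrite ?nnegrE ?divr_ge0 ?(ltW r0)//; lra.
have hw : cabs (cpt w - cpt w0) <= r / 8 by rewrite /r; lra.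
have [-> ->] := regular_HH l1 l2 cr r2 (near w hw).
suff rem0 : rem f1 f2 r w0 0 w = 0.
  have /eqP := HH_rem f1 f2 r w0 w; rewrite rem0 oppr0 eq_complex /=.
  by move=> /andP[/eqP -> /eqP ->]; rewrite !mul0r.
apply: rem_eq0 => // [e e0|]; last exact: near.
have e1 : 0 < Num.min (e / 2) (r / 16) by rewrite lt_min !divr_gt0.
have [v [vw ve v1 v2]] := zeros _ e1.
have hv : cabs (cpt v - cpt w0) <= e /\ cabs (cpt v - cpt w0) <= r / 8.
  move: ve; rewrite le_min => /andP[h1 h2]; have := cabs_norm w0 v.
  by move=> h3; split; apply: le_trans h3 _; lra.
exists v; split; [|exact: near hv.2|exact: hv.1|].
  apply: contraNneq vw; rewrite /cpt => -[a b]; apply/eqP.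
  by case: (v) (w0) a b => [? ?] [? ?] /= -> ->.
apply: oppr_inj; rewrite oppr0 -HH_rem.
have [e3 e4] := regular_HH l1 l2 cr r2 (near v hv.2).
have unit (x : R) : x / mass = 0 -> x = 0.
  by move=> /eqP; rewrite mulf_eq0 invr_eq0 (negbTE m0) orbF => /eqP.
by rewrite e3 in v1; rewrite e4 in v2; rewrite (unit _ v1) (unit _ v2).
Qed.

End Continuation.

Local Open Scope complex_scope.


(** * Square integrable functions *)

Section Sobolev.
Context {R : realType}.
Implicit Types (u v g : R * R -> R[i]) (phi psi : R * R -> R).

Lemma L2P u : L2 u <-> cmeas u /\ integ (fun x => sqmod (u x)).
Proof.
have ms : cmeas u -> meas2 (fun x => sqmod (u x)).
  by move=> [m1 m2]; apply: meas2D; apply: meas2M.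
have s0 x : 0 <= sqmod (u x) by rewrite addr_ge0 ?sqr_ge0.
split=> -[mu iu]; split=> //.
  apply/integrableP; split; first exact: meas2_EFin (ms mu).
  by under eq_integral do rewrite /= ger0_norm//.
move: iu => /integrableP[_].
by under eq_integral do rewrite /= ger0_norm//.
Qed.

Lemma sqmod_ge0 (z : R[i]) : 0 <= sqmod z.
Proof. by rewrite addr_ge0 ?sqr_ge0. Qed.

Lemma sqnormL2E u : L2 u -> sqnormL2 u = (I2 (fun x => sqmod (u x)))%:E.
Proof. by move=> /L2P[_ iu]; rewrite (I2_EFin iu). Qed.

Lemma L2_sq u : L2 u -> [/\ meas2 (fun x => Re (u x)), meas2 (fun x => Im (u x)),
  integ (fun x => Re (u x) ^+ 2) & integ (fun x => Im (u x) ^+ 2)].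
Proof.
move=> /L2P[[m1 m2] iu]; split=> //.
  apply: (integ_le _ _ iu); first exact: meas2M.
  by move=> x; rewrite ger0_norm ?sqr_ge0// lerDl sqr_ge0.
apply: (integ_le _ _ iu); first exact: meas2M.
by move=> x; rewrite ger0_norm ?sqr_ge0// lerDr sqr_ge0.
Qed.

Lemma L2_loci u : L2 u -> loci (fun x => Re (u x)) /\ loci (fun x => Im (u x)).
Proof. by move=> /L2_sq[m1 m2 i1 i2]; split; exact: integ_sq_loci. Qed.

Lemma sqmodD (z w : R[i]) : sqmod (z + w) <= 2 * sqmod z + 2 * sqmod w.
Proof.
case: z => a b; case: w => c d; rewrite /sqmod /=.
rewrite -subr_ge0 (_ : _ - _ = (a - c) ^+ 2 + (b - d) ^+ 2); last by ring.
by rewrite addr_ge0 ?sqr_ge0.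
Qed.

Lemma sqmodM (z w : R[i]) : sqmod (z * w) = sqmod z * sqmod w.
Proof. by case: z => a b; case: w => c d; rewrite /sqmod /=; ring. Qed.

Lemma sqmodN (z : R[i]) : sqmod (- z) = sqmod z.
Proof. by case: z => a b; rewrite /sqmod /= !sqrrN. Qed.

Lemma cmeasD u v : cmeas u -> cmeas v -> cmeas (fun x => u x + v x).
Proof.
move=> [a b] [c d]; split; [under eq_fun do rewrite raddfD|under eq_fun do rewrite raddfD];
  exact: meas2D.
Qed.

Lemma L2D u v : L2 u -> L2 v -> L2 (fun x => u x + v x).
Proof.
move=> /L2P[mu iu] /L2P[mv iv]; apply/L2P; split; first exact: cmeasD.
apply: (integ_le _ _ (integD (integZ 2 iu) (integZ 2 iv))).
  by have [m1 m2] := cmeasD mu mv; apply: meas2D; exact: meas2M.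
by move=> x; rewrite ger0_norm ?sqmod_ge0//; exact: sqmodD.
Qed.

Lemma L2M u v (M : R) : L2 u -> cmeas v -> (forall x, sqmod (v x) <= M) ->
  L2 (fun x => v x * u x).
Proof.
move=> /L2P[mu iu] mv vM; apply/L2P; split; first exact: cmeasM.
apply: (integ_le _ _ (integZ M iu)).
  by have [m1 m2] := cmeasM mv mu; apply: meas2D; exact: meas2M.
by move=> x; rewrite ger0_norm ?sqmod_ge0// sqmodM ler_wpM2r ?sqmod_ge0.
Qed.

Lemma L2N u : L2 u -> L2 (fun x => - u x).
Proof.
move=> hu; have := @L2M u (fun=> -1) 1 hu.
under [in X in _ -> _ -> X]eq_fun do rewrite mulN1r; apply.
  by split; exact: meas2_cst.
by move=> x; rewrite sqmodN /sqmod /= expr1n expr0n addr0.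
Qed.

Lemma L2B u v : L2 u -> L2 v -> L2 (fun x => u x - v x).
Proof. by move=> hu hv; apply: L2D => //; exact: L2N. Qed.

End Sobolev.

(** * The magnetic momentum operators *)

Section Momentum.
Context {R : realType}.
Variable b : R.
Implicit Types (u v g : R * R -> R[i]) (phi psi : R * R -> R) (j : 'I_2).

Lemma smooth_vpot j : smooth (fun x => vpot b x j).
Proof.
apply: smoothM; first exact: smooth_cst.
by case: (j == 0); [apply: smoothN; exact: smooth_snd|exact: smooth_fst].
Qed.

Definition lociC u := loci (fun x => Re (u x)) /\ loci (fun x => Im (u x)).

(** Separating real and imaginary parts in g = (-i d_j - A_j) u expresses the
    magnetic derivative through two real weak derivatives. *)
Definition wdPi j u g :=
  wd j (fun x => Im (u x)) (fun x => Re (g x) + Re (u x) * vpot b x j) /\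
  wd j (fun x => Re (u x)) (fun x => - (Im (g x) + Im (u x) * vpot b x j)).

Lemma weak_PiP j u g : lociC u -> lociC g -> weak_Pi b j u g <-> wdPi j u g.
Proof.
move=> [u1 u2] [g1 g2].
have sv := smooth_vpot j.
have l1 := lociM u1 (smooth_continuous sv); have l2 := lociM u2 (smooth_continuous sv).
have key phi : test_fun phi ->
  (Cintegral leb2 setT (fun x => g x * (phi x)%:C) =
   Cintegral leb2 setT (fun x => u x * ('i * (partial j phi x)%:C - (vpot b x j * phi x)%:C)))
  <->
  (I2 (fun x => (Re (g x) + Re (u x) * vpot b x j) * phi x) =
     - I2 (fun x => Im (u x) * partial j phi x)) /\
  (I2 (fun x => - (Im (g x) + Im (u x) * vpot b x j) * phi x) =
     - I2 (fun x => Re (u x) * partial j phi x)).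
  move=> tp; have tq := test_partial j tp.
  have i1 := loci_integ_test g1 tp; have i2 := loci_integ_test g2 tp.
  have i3 := loci_integ_test l1 tp; have i4 := loci_integ_test l2 tp.
  have i5 := loci_integ_test u1 tq; have i6 := loci_integ_test u2 tq.
  have E1 : I2 (fun x => Re (g x * (phi x)%:C)) = I2 (fun x => Re (g x) * phi x).
    by congr I2; apply/funext => x; rewrite Re_mulc /= mulr0 subr0.
  have E2 : I2 (fun x => Im (g x * (phi x)%:C)) = I2 (fun x => Im (g x) * phi x).
    by congr I2; apply/funext => x; rewrite Im_mulc /= mulr0 add0r.
  have E3 : I2 (fun x => Re (u x * ('i * (partial j phi x)%:C - (vpot b x j * phi x)%:C))) =
    - I2 (fun x => Re (u x) * vpot b x j * phi x) - I2 (fun x => Im (u x) * partial j phi x).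
    rewrite -(I2N i3) -(I2B (integN i3) i6); congr I2; apply/funext => x.
    by rewrite Re_mulc /=; ring.
  have E4 : I2 (fun x => Im (u x * ('i * (partial j phi x)%:C - (vpot b x j * phi x)%:C))) =
    I2 (fun x => Re (u x) * partial j phi x) - I2 (fun x => Im (u x) * vpot b x j * phi x).
    rewrite -(I2B i5 i4); congr I2; apply/funext => x.
    by rewrite Im_mulc /=; ring.
  have E5 : I2 (fun x => (Re (g x) + Re (u x) * vpot b x j) * phi x) =
    I2 (fun x => Re (g x) * phi x) + I2 (fun x => Re (u x) * vpot b x j * phi x).
    by rewrite -(I2D i1 i3); congr I2; apply/funext => x; ring.
  have E6 : I2 (fun x => - (Im (g x) + Im (u x) * vpot b x j) * phi x) =
    - (I2 (fun x => Im (g x) * phi x) + I2 (fun x => Im (u x) * vpot b x j * phi x)).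
    by rewrite -(I2D i2 i4) -(I2N (integD i2 i4)); congr I2; apply/funext => x; ring.
  rewrite E5 E6; change (Cintegral leb2 setT ?f) with (I2 (fun x => Re (f x)) +i* I2 (fun x => Im (f x))).
  rewrite E1 E2 E3 E4.
  move: (I2 _) (I2 _) (I2 _) (I2 _) (I2 _) (I2 _) => a1 a2 a3 a4 a5 a6.
  split=> [[h1 h2]|[h1 h2]]; first by split; lra.
  by congr (_ +i* _); lra.
split=> [h|[h1 h2]]; first by split=> phi tp; have [] := (key phi tp).1 (h phi tp).
by move=> phi tp; apply/(key phi tp); split; [exact: h1|exact: h2].
Qed.

Lemma L2_lociC u : L2 u -> lociC u.
Proof. exact: L2_loci. Qed.

Lemma lociC_vpot j u : lociC u -> loci (fun x => Re (u x) * vpot b x j) /\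
  loci (fun x => Im (u x) * vpot b x j).
Proof.
by move=> [u1 u2]; split; apply: lociM => //; exact: smooth_continuous (smooth_vpot j).
Qed.

Lemma wd_ext j (f f' h h' : R * R -> R) : (forall x, f x = f' x) ->
  (forall x, h x = h' x) -> wd j f h -> wd j f' h'.
Proof. by move=> /funext -> /funext ->. Qed.

Lemma wd_ae j (f f' h h' : R * R -> R) : loci f -> loci f' -> loci h -> loci h' ->
  aep (fun x => f x = f' x) -> aep (fun x => h x = h' x) -> wd j f h -> wd j f' h'.
Proof.
move=> lf lf' lh lh' ef eh w phi tp; have tq := test_partial j tp.
have i1 := integ_meas (loci_integ_test lf tq); have i2 := integ_meas (loci_integ_test lf' tq).
have i3 := integ_meas (loci_integ_test lh tp); have i4 := integ_meas (loci_integ_test lh' tp).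
have e1 := I2_ae i1 i2 (aep_sub (fun x e => congr1 (fun t => t * partial j phi x) e) ef).
have e2 := I2_ae i3 i4 (aep_sub (fun x e => congr1 (fun t => t * phi x) e) eh).
by rewrite -e1 -e2; exact: w.
Qed.

Lemma wdPi_unique j u g g' : lociC u -> lociC g -> lociC g' ->
  wdPi j u g -> wdPi j u g' -> aep (fun x => g x = g' x).
Proof.
move=> lu [g1 g2] [g1' g2'] [a1 a2] [b1 b2]; have [v1 v2] := lociC_vpot j lu.
have e1 := wd_unique (lociD g1 v1) (lociD g1' v1) a1 b1.
have e2 := wd_unique (lociN (lociD g2 v2)) (lociN (lociD g2' v2)) a2 b2.
apply: aep_sub (aep_and e1 e2) => x [/addIr h1 /oppr_inj/addIr h2].
by apply/eqP; rewrite eq_complex h1 h2 !eqxx.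
Qed.

Lemma lociCB u v : lociC u -> lociC v -> lociC (fun x => u x - v x).
Proof.
move=> [a c] [a' c']; split; [under eq_fun do rewrite raddfB|under eq_fun do rewrite raddfB];
  exact: lociB.
Qed.

Lemma wdB j (f h f' h' : R * R -> R) : loci f -> loci h -> loci f' -> loci h' ->
  wd j f h -> wd j f' h' -> wd j (fun x => f x - f' x) (fun x => h x - h' x).
Proof.
move=> lf lh lf' lh' w w'; exact: (wdD lf lh (lociN lf') (lociN lh') w (wdN lf' lh' w')).
Qed.

Lemma wdPiB j u g v k : lociC u -> lociC g -> lociC v -> lociC k ->
  wdPi j u g -> wdPi j v k -> wdPi j (fun x => u x - v x) (fun x => g x - k x).
Proof.
move=> lu lg lv lk [a1 a2] [b1 b2].
have [u1 u2] := lociC_vpot j lu; have [v1 v2] := lociC_vpot j lv.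
have [[c1 c2] [d1 d2]] := (lu, lv); have [[g1 g2] [k1 k2]] := (lg, lk).
split.
  apply: wd_ext (wdB c2 (lociD g1 u1) d2 (lociD k1 v1) a1 b1) => x; rewrite !raddfB//=.
  by rewrite mulrBl opprD addrACA.
apply: wd_ext (wdB c1 (lociN (lociD g2 u2)) d1 (lociN (lociD k2 v2)) a2 b2) => x; rewrite !raddfB//=.
by rewrite mulrBl; ring.
Qed.

(** The operator -i d_j - A_j on differentiable functions. *)
Definition cPi j u : R * R -> R[i] := fun x =>
  (partial j (fun x => Im (u x)) x - vpot b x j * Re (u x)) +i*
  (- partial j (fun x => Re (u x)) x - vpot b x j * Im (u x)).

Lemma wdPi_smooth j u : smooth (fun x => Re (u x)) -> smooth (fun x => Im (u x)) ->
  wdPi j u (cPi j u).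
Proof.
move=> s1 s2; split.
  by apply: wd_ext (@wd_smooth _ j _ s2) => // x; rewrite /cPi /=; ring.
by apply: wd_ext (@wd_smooth _ j _ s1) => // x; rewrite /cPi /=; ring.
Qed.

(** The product rule: the momentum of chi u is chi times the momentum g of u,
    minus i (d_j chi) u. *)
Definition gradmul j (chi : R * R -> R) u g : R * R -> R[i] := fun x =>
  (Re (g x) * chi x + Im (u x) * partial j chi x) +i*
  (Im (g x) * chi x - Re (u x) * partial j chi x).

Lemma wdPiM j chi u g : lociC u -> lociC g -> smooth chi -> wdPi j u g ->
  wdPi j (fun x => (chi x)%:C * u x) (gradmul j chi u g).
Proof.
move=> lu lg sc [a1 a2]; have [v1 v2] := lociC_vpot j lu.
have [[u1 u2] [g1 g2]] := (lu, lg); split.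
  by apply: wd_ext (wdM u2 (lociD g1 v1) sc a1) => x; rewrite ?Re_mulc ?Im_mulc /=; ring.
by apply: wd_ext (wdM u1 (lociN (lociD g2 v2)) sc a2) => x; rewrite ?Re_mulc ?Im_mulc /=; ring.
Qed.

Lemma PiA_spec j u : H1A b u -> L2 (PiA b j u) /\ wdPi j u (PiA b j u).
Proof.
move=> [lu hu]; have [h1 h2] : [set g | L2 g /\ weak_Pi b j u g] (PiA b j u).
  by apply: xgetPex; have [g hg] := hu j; exists g.
by split=> //; apply/weak_PiP; [exact: L2_lociC|exact: L2_lociC|].
Qed.

(** The j-th component of the magnetic gradient is a chosen representative,
    and two representatives agree almost everywhere by uniqueness of weak
    derivatives. *)
Lemma PiA_ae j u g : L2 u -> L2 g -> wdPi j u g ->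
  L2 (PiA b j u) /\ aep (fun x => PiA b j u x = g x).
Proof.
move=> lu lg w; have := @xgetPex _ (fun=> 0) [set g | L2 g /\ weak_Pi b j u g].
case; first by exists g; split=> //; apply/weak_PiP; [exact: L2_lociC..|].
rewrite -/(PiA b j u) => l2 w2; split=> //.
apply: (@wdPi_unique j u) => //; do 1?[exact: L2_lociC].
by apply/weak_PiP => //; exact: L2_lociC.
Qed.

Lemma H1A_intro u (g : 'I_2 -> R * R -> R[i]) : L2 u -> (forall j, L2 (g j)) ->
  (forall j, wdPi j u (g j)) -> H1A b u.
Proof.
move=> lu lg w; split=> // j; exists (g j); split=> //.
by apply/weak_PiP; [exact: L2_lociC|exact: L2_lociC|].
Qed.

Lemma test_sq_integ phi : test_fun phi -> integ (fun x => phi x ^+ 2).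
Proof. by move=> tp; apply: test_integ; exact: (test_mulr tp (test_smooth tp)). Qed.

Lemma Ctest_L2 u : Ctest_fun u -> L2 u.
Proof.
move=> [t1 t2]; apply/L2P; split.
  by split; apply: smooth_meas2; exact: test_smooth.
exact: (integD (test_sq_integ t1) (test_sq_integ t2)).
Qed.

Lemma Ctest_cPi j u : Ctest_fun u -> Ctest_fun (cPi j u).
Proof.
move=> [t1 t2]; have sv := smooth_vpot j; split; rewrite /cPi /=.
  by apply: testB; [exact: test_partial|exact: test_mull].
apply: testB; last exact: test_mull.
by apply: testN; exact: test_partial.
Qed.

Lemma Ctest_H1A u : Ctest_fun u -> H1A b u.
Proof.
move=> tu; apply: (H1A_intro (Ctest_L2 tu) (fun j => Ctest_L2 (Ctest_cPi j tu))) => j.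
by case: tu => t1 t2; apply: wdPi_smooth; exact: test_smooth.
Qed.

Lemma Ctest_PiA j u : Ctest_fun u -> L2 (PiA b j u) /\ aep (fun x => PiA b j u x = cPi j u x).
Proof.
move=> tu; apply: PiA_ae; [exact: Ctest_L2|exact: Ctest_L2 (Ctest_cPi j tu)|].
by case: tu => t1 t2; apply: wdPi_smooth; exact: test_smooth.
Qed.

End Momentum.

(** * Pairing with test functions *)

Section Pairing.
Context {R : realType}.
Variable b : R.
Implicit Types (f : R * R -> R) (u v g : R * R -> R[i]) (phi psi : R * R -> R) (j : 'I_2).

(** The value of the distribution f at phi. Commutation relations of
    differential operators become identities between pairings, where linear
    arithmetic decides. *)
Definition pair f phi : R := I2 (fun x => f x * phi x).

Lemma pairDr f phi psi : loci f -> test_fun phi -> test_fun psi ->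
  pair f (fun x => phi x + psi x) = pair f phi + pair f psi.
Proof.
move=> lf t1 t2; rewrite /pair -(I2D (loci_integ_test lf t1) (loci_integ_test lf t2)).
by congr I2; apply/funext => x; rewrite mulrDr.
Qed.

Lemma pairNr f phi : loci f -> test_fun phi -> pair f (fun x => - phi x) = - pair f phi.
Proof.
move=> lf t1; rewrite /pair -(I2N (loci_integ_test lf t1)).
by congr I2; apply/funext => x; rewrite mulrN.
Qed.

Lemma pairZr f phi (c : R) : loci f -> test_fun phi ->
  pair f (fun x => c * phi x) = c * pair f phi.
Proof.
move=> lf t1; rewrite /pair -(I2Z c (loci_integ_test lf t1)).
by congr I2; apply/funext => x; rewrite mulrCA.
Qed.

Lemma pairDl f f' phi : loci f -> loci f' -> test_fun phi ->
  pair (fun x => f x + f' x) phi = pair f phi + pair f' phi.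
Proof.
move=> lf lf' t; rewrite /pair -(I2D (loci_integ_test lf t) (loci_integ_test lf' t)).
by congr I2; apply/funext => x; rewrite mulrDl.
Qed.

Lemma pairNl f phi : loci f -> test_fun phi -> pair (fun x => - f x) phi = - pair f phi.
Proof.
move=> lf t; rewrite /pair -(I2N (loci_integ_test lf t)).
by congr I2; apply/funext => x; rewrite mulNr.
Qed.

Lemma pair_ae f f' phi : loci f -> loci f' -> test_fun phi -> aep (fun x => f x = f' x) ->
  pair f phi = pair f' phi.
Proof.
move=> lf lf' t e; apply: I2_ae.
- exact: integ_meas (loci_integ_test lf t).
- exact: integ_meas (loci_integ_test lf' t).
- exact: (aep_sub (fun x e => congr1 (fun t => t * phi x) e) e).
Qed.

Definition vp j phi : R * R -> R := fun x => vpot b x j * phi x.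

Lemma test_vp j phi : test_fun phi -> test_fun (vp j phi).
Proof. by apply: test_mull; exact: smooth_vpot. Qed.

Lemma partial_vpot j k : partial j (fun x => vpot b x k) =
  fun=> b / 2 * (if k == 0 then - (basis_vec j).2 else (basis_vec j).1).
Proof.
have s1 := @smooth_fst R; have s2 := @smooth_snd R.
rewrite /vpot; case: (k == 0).
  by rewrite (partialZ _ _ (smoothN s2)) (partialN _ s2) partial_snd.
by rewrite (partialZ _ _ s1) partial_fst.
Qed.

Lemma partial_vp j k phi : test_fun phi -> partial j (vp k phi) = fun x =>
  vp k (partial j phi) x + b / 2 * (if k == 0 then - (basis_vec j).2 else (basis_vec j).1) * phi x.
Proof.
move=> tp; rewrite (partialM j (smooth_vpot b k) (test_smooth tp)) partial_vpot.
by apply/funext => x; rewrite /vp; ring.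
Qed.

Lemma wdPi_pair j u g phi : lociC u -> lociC g -> wdPi b j u g -> test_fun phi ->
  pair (fun x => Re (g x)) phi =
    - pair (fun x => Im (u x)) (partial j phi) - pair (fun x => Re (u x)) (vp j phi) /\
  pair (fun x => Im (g x)) phi =
    pair (fun x => Re (u x)) (partial j phi) - pair (fun x => Im (u x)) (vp j phi).
Proof.
move=> lu [g1 g2] [w1 w2] tp; have [v1 v2] := lociC_vpot b j lu; have [u1 u2] := lu.
have e1 := w1 _ tp; have e2 := w2 _ tp.
have d1 := pairDl g1 v1 tp; have d2 := pairDl g2 v2 tp.
have n2 := pairNl (lociD g2 v2) tp.
have a1 : pair (fun x => Re (u x) * vpot b x j) phi = pair (fun x => Re (u x)) (vp j phi).
  by congr I2; apply/funext => x; rewrite /vp mulrA.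
have a2 : pair (fun x => Im (u x) * vpot b x j) phi = pair (fun x => Im (u x)) (vp j phi).
  by congr I2; apply/funext => x; rewrite /vp mulrA.
have e1' : pair (fun x => Re (g x) + Re (u x) * vpot b x j) phi =
  - pair (fun x => Im (u x)) (partial j phi) := e1.
have e2' : pair (fun x => - (Im (g x) + Im (u x) * vpot b x j)) phi =
  - pair (fun x => Re (u x)) (partial j phi) := e2.
rewrite -a1 -a2; move: e1' e2'; rewrite n2 d1 d2.
move: (pair _ _) (pair _ _) (pair _ _) (pair _ _) (pair _ _) (pair _ _) => *; split; lra.
Qed.

Lemma Re_mulconj (z w : R[i]) : Re (z * w^*) = Re z * Re w + Im z * Im w.
Proof. by case: z => p q; case: w => s t /=; rewrite mulrN opprK. Qed.

Lemma Im_mulconj (z w : R[i]) : Im (z * w^*) = Im z * Re w - Re z * Im w.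
Proof. by case: z => p q; case: w => s t /=; ring. Qed.

(** A real test function phi has momentum -i d_j phi - A_j phi almost
    everywhere. *)
Lemma inner_PiA_test j g phi : L2 g -> test_fun phi ->
  inner g (PiA b j (fun x => (phi x)%:C)) =
  (- pair (fun x => Im (g x)) (partial j phi) - pair (fun x => Re (g x)) (vp j phi)) +i*
  (pair (fun x => Re (g x)) (partial j phi) - pair (fun x => Im (g x)) (vp j phi)).
Proof.
move=> lg tp; have tC : Ctest_fun (fun x => (phi x)%:C) by split=> //=; exact: test0.
have [lP eP] := Ctest_PiA b j tC.
have [m1 m2 s1 s2] := L2_sq lg; have [n1 n2 r1 r2] := L2_sq lP.
have [l1 l2] := L2_loci lg.
have tq := test_partial j tp; have tv := test_vp j tp.
have i1 := loci_integ_test l1 tq; have i2 := loci_integ_test l2 tq.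
have i3 := loci_integ_test l1 tv; have i4 := loci_integ_test l2 tv.
have E x : cPi b j (fun x => (phi x)%:C) x = (- vp j phi x) +i* (- partial j phi x).
  by rewrite /cPi /= partial_cst /vp sub0r mulr0 subr0.
rewrite /inner; change (Cintegral leb2 setT ?f) with (I2 (fun x => Re (f x)) +i* I2 (fun x => Im (f x))).
congr (_ +i* _).
  rewrite -(I2N i2) -(I2B (integN i2) i3); apply: I2_ae.
  - under eq_fun do rewrite Re_mulconj.
    by apply: meas2D; exact: meas2M.
  - exact: integ_meas (integB (integN i2) i3).
  - by apply: aep_sub eP => x ->; rewrite E Re_mulconj /=; ring.
rewrite -(I2B i1 i4); apply: I2_ae.
- under eq_fun do rewrite Im_mulconj.
  by apply: meas2D; [exact: meas2M|apply: meas2N; exact: meas2M].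
- exact: integ_meas (integB i1 i4).
- by apply: aep_sub eP => x ->; rewrite E Im_mulconj /=; ring.
Qed.

Lemma inner_test u (c : R) phi : L2 u -> test_fun phi ->
  inner (fun x => c%:C * u x) (fun x => (phi x)%:C) =
  (c * pair (fun x => Re (u x)) phi) +i* (c * pair (fun x => Im (u x)) phi).
Proof.
move=> lu tp; have [l1 l2] := L2_loci lu.
rewrite /pair -(I2Z c (loci_integ_test l1 tp)) -(I2Z c (loci_integ_test l2 tp)).
congr (I2 _ +i* I2 _); apply/funext => x; case: (u x) => p q /=; ring.
Qed.

End Pairing.

(** * The lowest Landau level and holomorphic functions *)

Section LowestLevel.
Context {R : realType}.
Variable b : R.
Hypothesis b0 : 0 < b.
Implicit Types (f : R * R -> R) (phi psi : R * R -> R) (j : 'I_2).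

Definition gauss (c : R) (x : R * R) : R := expR (c * sq 0 x).

Lemma smooth_gauss c : smooth (gauss c).
Proof.
apply: (smooth_comp1 (@smooth1_expR R)); apply: smoothM; first exact: smooth_cst.
exact: smooth_sq.
Qed.

Lemma partial_gauss c j : partial j (gauss c) = fun x =>
  2 * c * (x.1 * (basis_vec j).1 + x.2 * (basis_vec j).2) * gauss c x.
Proof.
have sc : smooth (fun x : R * R => c * sq 0 x).
  by apply: smoothM; [exact: smooth_cst|exact: smooth_sq].
rewrite (partial_comp1 j (@smooth1_expR R) sc) (partialZ _ _ (smooth_sq 0)) partial_sq.
apply/funext => x; rewrite derive1E derive_val -/(gauss c x) /= !subr0; ring.
Qed.

Lemma vpot0 (x : R * R) : vpot b x 0 = - (b / 2 * x.2).
Proof. by rewrite /vpot mulrN. Qed.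

Lemma vpot1 (x : R * R) : vpot b x 1 = b / 2 * x.1.
Proof. by []. Qed.

Lemma partial_gauss_mul c phi j : test_fun phi ->
  partial j (fun x => gauss c x * phi x) = fun x => gauss c x * partial j phi x +
    2 * c * (x.1 * (basis_vec j).1 + x.2 * (basis_vec j).2) * gauss c x * phi x.
Proof.
move=> tp; rewrite (partialM j (smooth_gauss c) (test_smooth tp)) partial_gauss.
by apply/funext => x; rewrite (mulrC (phi x)).
Qed.

(** Conjugation by the Gaussian factor exp(s b |x|^2 / 4) absorbs the vector
    potential into the derivative, because the gradient of b |x|^2 / 4 is the
    potential rotated by a right angle. *)
Lemma gauge (s : R) f phi : loci f -> test_fun phi ->
  let psi x := gauss (s * (b / 4)) x * phi x in
  pair f (partial 1 psi) + s * pair f (vp b 0 psi) =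
    I2 (fun x => f x * gauss (s * (b / 4)) x * partial 1 phi x) /\
  pair f (partial 0 psi) - s * pair f (vp b 1 psi) =
    I2 (fun x => f x * gauss (s * (b / 4)) x * partial 0 phi x).
Proof.
move=> lf tp psi; have tpsi : test_fun psi := test_mull (smooth_gauss _) tp.
have E j : partial j psi = fun x => gauss (s * (b / 4)) x * partial j phi x +
    2 * (s * (b / 4)) * (x.1 * (basis_vec j).1 + x.2 * (basis_vec j).2) *
    gauss (s * (b / 4)) x * phi x by exact: partial_gauss_mul.
have t0 := test_vp b 0 tpsi; have t1 := test_vp b 1 tpsi.
split.
  rewrite -(pairZr s lf t0) -(pairDr lf (test_partial 1 tpsi) (test_mull (smooth_cst s) t0)).
  congr I2; apply/funext => x; rewrite E /vp vpot0 /psi /=; by field.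
have tn : test_fun (fun x => - (s * vp b 1 psi x)).
  by apply: testN; exact: (test_mull (smooth_cst s) t1).
rewrite -(pairZr s lf t1) -(pairNr lf (test_mull (smooth_cst s) t1)).
rewrite -(pairDr lf (test_partial 0 tpsi) tn).
congr I2; apply/funext => x; rewrite E /vp vpot1 /psi /=; by field.
Qed.

Lemma vpC f phi : pair f (vp b 0 (vp b 1 phi)) = pair f (vp b 1 (vp b 0 phi)).
Proof. by congr pair; apply/funext => x; rewrite /vp mulrCA. Qed.

Local Opaque inner pair PiA test_fun I2 partial vp.

Lemma sum_I2 (V : nmodType) (F : 'I_2 -> V) : \sum_(j < 2) F j = F 0 + F 1.
Proof.
by rewrite !big_ord_recl big_ord0 addr0; congr (_ + F _); apply/val_inj.
Qed.

Lemma landau_formE u v : landau_form b u v =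
  inner (PiA b 0 u) (PiA b 0 v) + inner (PiA b 1 u) (PiA b 1 v).
Proof.
exact: (sum_I2 (fun j => inner (PiA b j u) (PiA b j v))).
Qed.

Lemma complex_add_components (X Y Z : R[i]) (p q s t v w : R) : X + Y = Z ->
  X = p +i* q -> Y = s +i* t -> Z = v +i* w -> p + s = v /\ q + t = w.
Proof. by move=> <- -> -> [-> ->]. Qed.

(** The eigenvalue equation for the level b in the sense of distributions: the
    variational identity tested against real test functions, split in real and
    imaginary parts. *)
Lemma landau_eq u phi : landau_space b 0 u -> test_fun phi ->
  (- pair (fun x => Im (PiA b 0 u x)) (partial 0 phi) - pair (fun x => Re (PiA b 0 u x)) (vp b 0 phi)) +
  (- pair (fun x => Im (PiA b 1 u x)) (partial 1 phi) - pair (fun x => Re (PiA b 1 u x)) (vp b 1 phi)) =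
    b * pair (fun x => Re (u x)) phi /\
  (pair (fun x => Re (PiA b 0 u x)) (partial 0 phi) - pair (fun x => Im (PiA b 0 u x)) (vp b 0 phi)) +
  (pair (fun x => Re (PiA b 1 u x)) (partial 1 phi) - pair (fun x => Im (PiA b 1 u x)) (vp b 1 phi)) =
    b * pair (fun x => Im (u x)) phi.
Proof.
move=> [hH _ h] tp.
have tC : Ctest_fun (fun x => (phi x)%:C) by split=> //=; exact: test0.
have level : landau_level b 0 = b by rewrite /landau_level muln0 add0n mulr1.
rewrite level in h.
have e := etrans (esym (landau_formE u (fun x => (phi x)%:C))) (h _ (Ctest_H1A b tC)).
exact: (complex_add_components e (inner_PiA_test b 0 (PiA_spec 0 hH).1 tp)
  (inner_PiA_test b 1 (PiA_spec 1 hH).1 tp) (inner_test b hH.1 tp)).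
Qed.

Lemma mixed_ae f phi : loci f -> test_fun phi ->
  pair f (partial 0 (partial 1 phi)) = pair f (partial 1 (partial 0 phi)).
Proof.
move=> lf tp; have t01 := test_partial 0 (test_partial 1 tp).
have t10 := test_partial 1 (test_partial 0 tp).
apply: (I2_ae (integ_meas (loci_integ_test lf t01)) (integ_meas (loci_integ_test lf t10))).
by apply: aep_sub (partialC_ae (test_smooth tp)) => x ->.
Qed.

Lemma pair_partial_vp0 f phi : loci f -> test_fun phi ->
  pair f (partial 1 (vp b 0 phi)) = pair f (vp b 0 (partial 1 phi)) - b / 2 * pair f phi.
Proof.
move=> lf tp; have t1 := test_partial 1 tp.
rewrite (partial_vp b 1 0 tp).
rewrite (_ : (fun x => _) = fun x => vp b 0 (partial 1 phi) x + - (b / 2) * phi x).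
  rewrite (pairDr lf (test_vp b 0 t1) (test_mull (smooth_cst (- (b / 2))) tp)).
  by rewrite (pairZr _ lf tp) mulNr.
by apply/funext => x; rewrite /= mulrN1.
Qed.

Lemma pair_partial_vp1 f phi : loci f -> test_fun phi ->
  pair f (partial 0 (vp b 1 phi)) = pair f (vp b 1 (partial 0 phi)) + b / 2 * pair f phi.
Proof.
move=> lf tp; have t0 := test_partial 0 tp.
rewrite (partial_vp b 0 1 tp).
rewrite (_ : (fun x => _) = fun x => vp b 1 (partial 0 phi) x + b / 2 * phi x).
  rewrite (pairDr lf (test_vp b 1 t0) (test_mull (smooth_cst (b / 2)) tp)).
  by rewrite (pairZr _ lf tp).
by apply/funext => x; rewrite /= mulr1.
Qed.

Section Adjoint.
Variables u g0 g1 : R * R -> R[i].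
Hypotheses (lu : lociC u) (l0 : lociC g0) (l1 : lociC g1).
Hypotheses (h0 : wdPi b 0 u g0) (h1 : wdPi b 1 u g1).
Hypothesis eigen : forall phi, test_fun phi ->
  (- pair (fun x => Im (g0 x)) (partial 0 phi) - pair (fun x => Re (g0 x)) (vp b 0 phi)) +
  (- pair (fun x => Im (g1 x)) (partial 1 phi) - pair (fun x => Re (g1 x)) (vp b 1 phi)) =
    b * pair (fun x => Re (u x)) phi /\
  (pair (fun x => Re (g0 x)) (partial 0 phi) - pair (fun x => Im (g0 x)) (vp b 0 phi)) +
  (pair (fun x => Re (g1 x)) (partial 1 phi) - pair (fun x => Im (g1 x)) (vp b 1 phi)) =
    b * pair (fun x => Im (u x)) phi.

(** With low2, the real and imaginary parts of D u, where D = Pi_1 + i Pi_2 is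
    the annihilation operator and g0, g1 are the components of the magnetic
    gradient of u. *)
Definition low1 (x : R * R) : R := Re (g0 x) - Im (g1 x).
Definition low2 (x : R * R) : R := Im (g0 x) + Re (g1 x).

Lemma pair_low1 phi : test_fun phi ->
  pair low1 phi = pair (fun x => Re (g0 x)) phi - pair (fun x => Im (g1 x)) phi.
Proof. by move=> tp; rewrite (pairDl l0.1 (lociN l1.2) tp) (pairNl l1.2 tp). Qed.

Lemma pair_low2 phi : test_fun phi ->
  pair low2 phi = pair (fun x => Im (g0 x)) phi + pair (fun x => Re (g1 x)) phi.
Proof. exact: (pairDl l0.2 l1.1). Qed.

(** With D = Pi_1 + i Pi_2 and D' = Pi_1 - i Pi_2 one has D' D = Pi_1^2 +
    Pi_2^2 + i [Pi_1, Pi_2] = H_0 - b, since [Pi_1, Pi_2] = i b. Hence D' (D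
    u) = 0 in the sense of distributions; the two equations are its real and
    imaginary parts. The commutator appears through the derivatives of the
    potential and the symmetry of second derivatives of phi. *)
Lemma adjoint_eq phi : test_fun phi ->
  pair low1 (partial 1 phi) - pair low1 (vp b 0 phi) -
    (pair low2 (partial 0 phi) + pair low2 (vp b 1 phi)) = 0 /\
  pair low2 (partial 1 phi) - pair low2 (vp b 0 phi) +
    (pair low1 (partial 0 phi) + pair low1 (vp b 1 phi)) = 0.
Proof.
move=> tp; have t0 := test_partial 0 tp; have t1 := test_partial 1 tp.
have a0 := test_vp b 0 tp; have a1 := test_vp b 1 tp.
have := eigen tp.
have := wdPi_pair lu l0 h0 a1; have := wdPi_pair lu l0 h0 t1.
have := wdPi_pair lu l1 h1 a0; have := wdPi_pair lu l1 h1 t0.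
rewrite (pair_low1 t0) (pair_low1 t1) (pair_low1 a0) (pair_low1 a1).
rewrite (pair_low2 t0) (pair_low2 t1) (pair_low2 a0) (pair_low2 a1).
rewrite (pair_partial_vp0 lu.1 tp) (pair_partial_vp0 lu.2 tp).
rewrite (pair_partial_vp1 lu.1 tp) (pair_partial_vp1 lu.2 tp).
have := mixed_ae lu.1 tp; have := mixed_ae lu.2 tp.
have := vpC (fun x => Re (u x)) phi; have := vpC (fun x => Im (u x)) phi.
move: (@pair R) (vp b) (@partial R) => P V d c1 c2 m1 m2.
move=> [e1 e2] [e3 e4] [e5 e6] [e7 e8] [e9 e10].
rewrite e1 e2 e3 e4 e5 e6 e7 e8 c1 c2 m1 m2.
split; lra.
Qed.

End Adjoint.

Lemma gauss_le1 (c : R) x : c <= 0 -> gauss c x <= 1.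
Proof. by move=> c0; rewrite /gauss -expR0 ler_expR mulr_le0_ge0 ?sq_ge0. Qed.

Lemma adjoint_alg (p1 p0 v1 v0 q1 q0 z1 z0 X1 X0 Y1 Y0 N1 N0 : R) :
  p1 + -1 * v0 = X1 -> p0 - -1 * v1 = X0 -> q1 + -1 * z0 = Y1 -> q0 - -1 * z1 = Y0 ->
  N0 = - Y0 -> N1 = - Y1 -> p1 - v0 - (q0 + z1) = 0 /\ q1 - z0 + (p0 + v1) = 0 ->
  X0 = N1 /\ N0 = - X1.
Proof. by move=> <- <- <- <- -> -> [? ?]; split; lra. Qed.

Lemma sqrD_le (s t : R) : (s + t) ^+ 2 <= 2 * s ^+ 2 + 2 * t ^+ 2.
Proof.
by rewrite -subr_ge0 (_ : _ - _ = (s - t) ^+ 2) ?sqr_ge0//; ring.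
Qed.

(** The equation D' (D u) = 0 says that conj(D u) exp(-b |x|^2 / 4) is weakly
    holomorphic. As D u is in L^2 and the Gaussian is bounded, the Liouville
    theorem gives D u = 0. *)
Lemma annihilated u : landau_space b 0 u ->
  aep (fun x => low1 (PiA b 0 u) (PiA b 1 u) x = 0 /\ low2 (PiA b 0 u) (PiA b 1 u) x = 0).
Proof.
move=> hu; have hH : H1A b u by case: hu.
have Lu := hH.1; have [Lg0 h0] := PiA_spec 0 hH; have [Lg1 h1] := PiA_spec 1 hH.
have lu := L2_lociC Lu; have l0 := L2_lociC Lg0; have l1 := L2_lociC Lg1.
have eigen phi (tp : test_fun phi) := landau_eq hu tp.
have adj := adjoint_eq lu l0 l1 h0 h1 eigen.
set w1 := low1 _ _ in adj *; set w2 := low2 _ _ in adj *.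
have lw1 : loci w1 := lociB l0.1 l1.2.
have lw2 : loci w2 := lociD l0.2 l1.1.
pose E := gauss (-1 * (b / 4)).
have sE : smooth E := smooth_gauss _.
have cE := smooth_continuous sE.
have mE := smooth_meas2 sE.
have E1 x : E x <= 1.
  by apply: gauss_le1; rewrite mulN1r oppr_le0 divr_ge0// ltW.
have E0 x : 0 < E x by exact: expR_gt0.
have n phi j : test_fun phi -> I2 (fun x => - w2 x * E x * partial j phi x) =
    - I2 (fun x => w2 x * E x * partial j phi x).
  move=> tp; rewrite -(I2N (loci_integ_test (lociM lw2 cE) (test_partial j tp))).
  by congr I2; apply/funext => x; rewrite !mulNr.
have cr : wCR (fun x => w1 x * E x) (fun x => - w2 x * E x).
  move=> phi tp; have tpsi : test_fun (fun x => E x * phi x) := test_mull sE tp.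
  have [a1 a0] := gauge (-1) lw1 tp; have [c1 c0] := gauge (-1) lw2 tp.
  exact: (adjoint_alg a1 a0 c1 c0 (n phi 0 tp) (n phi 1 tp) (adj _ tpsi)).
have sqE (w : R * R -> R) : meas2 w -> integ (fun x => w x ^+ 2) ->
    meas2 (fun x => w x * E x) /\ integ (fun x => (w x * E x) ^+ 2).
  move=> mw iw; have m := meas2M mw mE; split=> //.
  apply: (integ_le _ _ iw); first exact: meas2M.
  move=> x; rewrite ger0_norm ?sqr_ge0// exprMn ler_piMr ?sqr_ge0//.
  by rewrite exprn_ile1 // ltW.
have sqs (f g : R * R -> R) : meas2 f -> meas2 g -> integ (fun x => f x ^+ 2) ->
    integ (fun x => g x ^+ 2) -> integ (fun x => (f x + g x) ^+ 2).
  move=> mf mg fi gi; apply: (integ_le _ _ (integD (integZ 2 fi) (integZ 2 gi))).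
    by apply: meas2M; exact: meas2D.
  by move=> x; rewrite ger0_norm ?sqr_ge0//; exact: sqrD_le.
have [m01 m02 i01 i02] := L2_sq Lg0; have [m11 m12 i11 i12] := L2_sq Lg1.
have i12' : integ (fun x => (- Im (PiA b 1 u x)) ^+ 2) by under eq_fun do rewrite sqrrN.
have iw1 : integ (fun x => w1 x ^+ 2) := sqs _ _ m01 (meas2N m12) i01 i12'.
have iw2 : integ (fun x => w2 x ^+ 2) := sqs _ _ m02 m11 i02 i11.
have iw2' : integ (fun x => (- w2 x) ^+ 2) by under eq_fun do rewrite sqrrN.
have [k1 k1'] := sqE _ lw1.1 iw1; have [k2 k2'] := sqE _ (meas2N lw2.1) iw2'.
apply: aep_sub (liouville_L2 k1 k2 k1' k2' cr) => x [z1 z2].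
have En0 : E x != 0 by rewrite gt_eqF.
split; first exact: (mulIf En0 (etrans z1 (esym (mul0r _)))).
by apply: oppr_inj; rewrite oppr0; exact: (mulIf En0 (etrans z2 (esym (mul0r _)))).
Qed.

Lemma ground_alg (p1 p0 v1 v0 q1 q0 z1 z0 X1 X0 Y1 Y0 r01 i01 r11 i11 : R) :
  p1 + 1 * v0 = X1 -> p0 - 1 * v1 = X0 -> q1 + 1 * z0 = Y1 -> q0 - 1 * z1 = Y0 ->
  r01 = - q0 - v0 /\ i01 = p0 - z0 -> r11 = - q1 - v1 /\ i11 = p1 - z1 ->
  r01 - i11 = 0 -> i01 + r11 = 0 -> X0 = Y1 /\ Y0 = - X1.
Proof. by move=> <- <- <- <- [-> ->] [-> ->] ? ?; split; lra. Qed.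

(** Now D u = 0, and the opposite gauge factor turns D into the Cauchy-Riemann
    operator. *)
Lemma ground_holomorphic u : landau_space b 0 u ->
  let G := gauss (1 * (b / 4)) in
  wCR (fun x => Re (u x) * G x) (fun x => Im (u x) * G x).
Proof.
move=> hu G phi tp; have hH : H1A b u by case: hu.
have Lu := hH.1; have [Lg0 h0] := PiA_spec 0 hH; have [Lg1 h1] := PiA_spec 1 hH.
have lu := L2_lociC Lu; have l0 := L2_lociC Lg0; have l1 := L2_lociC Lg1.
have van := annihilated hu.
have tpsi : test_fun (fun x => G x * phi x) := test_mull (smooth_gauss _) tp.
have z (w : R * R -> R) : loci w -> aep (fun x => w x = 0) -> pair w (fun x => G x * phi x) = 0.
  move=> lw ew; rewrite (pair_ae lw (loci_cst 0) tpsi ew).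
  have := pairNl (loci_cst 0) tpsi; rewrite oppr0; move: (pair _ _) => t; lra.
have v1 : aep (fun x => low1 (PiA b 0 u) (PiA b 1 u) x = 0).
  by apply: aep_sub van => x [].
have v2 : aep (fun x => low2 (PiA b 0 u) (PiA b 1 u) x = 0).
  by apply: aep_sub van => x [].
have e1 := z _ (lociB l0.1 l1.2) v1.
have e2 := z _ (lociD l0.2 l1.1) v2.
have f1 := esym (pair_low1 l0 l1 tpsi); have f2 := esym (pair_low2 l0 l1 tpsi).
have [a1 a0] := gauge 1 lu.1 tp; have [c1 c0] := gauge 1 lu.2 tp.
exact: (ground_alg a1 a0 c1 c0 (wdPi_pair lu l0 h0 tpsi) (wdPi_pair lu l1 h1 tpsi)
  (etrans f1 e1) (etrans f2 e2)).
Qed.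

(** Divide the smooth representative of u exp(b |x|^2 / 4) by the Gaussian,
    which has no zeros. *)
Lemma ground_smooth u : landau_space b 0 u -> exists v : R * R -> R[i],
  [/\ smooth (fun x => Re (v x)), smooth (fun x => Im (v x)), aep (fun x => u x = v x) &
    forall w0, (forall e : R, 0 < e -> exists w, [/\ w != w0, `|w - w0| <= e & v w = 0]) ->
      forall w, v w = 0].
Proof.
move=> hu; have cr := ground_holomorphic hu; have hH : H1A b u by case: hu.
have [l1 l2] := L2_loci hH.1.
move: cr; set G := gauss _ => /= cr.
have sG : smooth G := smooth_gauss _.
have G0 x : G x != 0 by rewrite gt_eqF// expR_gt0.
set f1 := (fun x => Re (u x) * G x) in cr *; set f2 := (fun x => Im (u x) * G x) in cr *.
have k1 : loci f1 := lociM l1 (smooth_continuous sG).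
have k2 : loci f2 := lociM l2 (smooth_continuous sG).
have sV := smoothV G0 sG.
exists (fun x => (regular f1 x * (G x)^-1) +i* (regular f2 x * (G x)^-1)); split.
- exact: (smoothM (smooth_regular k1) sV).
- exact: (smoothM (smooth_regular k2) sV).
- apply: aep_sub (regular_ae k1 k2 cr) => x [<- <-].
  by rewrite /f1 /f2 !mulfK//; case: (u x).
move=> w0 hz; have zero (p q c : R) : (p * c) +i* (q * c) = 0 -> c != 0 -> p = 0 /\ q = 0.
  move=> [/eqP + /eqP +] /negbTE c0; rewrite !mulf_eq0 c0 !orbF => /eqP h1 /eqP h2.
  by split.
have G0' x : (G x)^-1 != 0 by rewrite invr_eq0.
have uc := @unique_continuation _ f1 f2 w0 k1 k2 cr.
move=> w; have [|-> ->] := uc _ w; last by rewrite !mul0r.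
move=> e /hz[v [v1 v2 v3]]; exists v.
by have [z1 z2] := zero _ _ _ v3 (G0' v); split.
Qed.

End LowestLevel.

Local Open Scope complex_scope.


(** * A trace inequality on pieces of curves *)

Section OneVariable.
Context {R : realType}.
Implicit Types (f g k : R -> R).
Local Notation mu := (@lebesgue_measure R).

Lemma continuous_measurable1 f : continuous f ->
  measurable_fun (setT : set (measurableTypeR R)) f.
Proof. exact: continuous_measurable_fun. Qed.

Lemma is_derive_continuous f f' : (forall x : R, is_derive x 1 f (f' x)) -> continuous f.
Proof.
move=> df x; apply/differentiable_continuous/derivable1_diffP.
exact: (@ex_derive _ _ _ _ _ _ _ (df x)).
Qed.

Lemma integral_itv_le f (a b : R) : continuous f -> (forall x, 0 <= f x) ->
  (\int[mu]_(x in `[a, b]) (f x)%:E <= \int[mu]_x (f x)%:E)%E.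
Proof.
move=> cf f0; apply: ge0_subset_integral => //.
  by apply/measurable_EFinP; exact: continuous_measurable1.
by move=> x _; rewrite lee_fin.
Qed.

Lemma compact_integrable f (r : R) : continuous f -> (forall x, r < `|x| -> f x = 0) ->
  mu.-integrable setT (EFin \o f).
Proof.
move=> cf f0.
have i1 : mu.-integrable `[- r, r] (EFin \o f).
  by apply: continuous_compact_integrable; [exact: segment_compact|exact: continuous_subspaceT].
move: i1; rewrite integrable_mkcond//.
apply: eq_integrable => // x _; rewrite patchE; case: ifPn => //.
rewrite notin_setE /= in_itv /= -ler_norml => /negP; rewrite -ltNge => /f0.
by move=> ->.
Qed.

(** The increments of a primitive of g >= 0 are at most its total integral. *)
Lemma primitive g (r : R) : continuous g -> (forall x, 0 <= g x) ->
  (forall x, r < `|x| -> g x = 0) ->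
  exists2 k, (forall x : R, is_derive x 1 k (g x)) &
    forall a b, ((k b - k a)%:E <= \int[mu]_x (g x)%:E)%E.
Proof.
move=> cg g0 gr; have ig := compact_integrable cg gr.
pose k (x : R) := \int[mu]_(t in [set` `]-oo, x]]) g t.
have dk (x : R) : is_derive x 1 k (g x).
  have i1 : mu.-integrable [set` `]-oo, x + 1]] (EFin \o g).
    exact: integrableS ig.
  have xx1 : x < x + 1 by rewrite ltrDl.
  have [d e] := continuous_FTC1 xx1 i1 (ltNyr _) (cg x).
  exact: (DeriveDef d (etrans (esym (derive1E _ _)) e)).
exists k => // a b; have [ab|ba|->] := ltgtP a b.
- by rewrite -(ftc_interval ab cg dk); exact: integral_itv_le.
- apply: (@le_trans _ _ 0%E); last by apply: integral_ge0 => x _; rewrite lee_fin.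
  rewrite lee_fin -oppr_ge0 opprB -lee_fin -(ftc_interval ba cg dk).
  by apply: integral_ge0 => x _; rewrite lee_fin.
- by rewrite subrr; apply: integral_ge0 => x _; rewrite lee_fin.
Qed.

(** The derivative of the primitive of g along gam is g(gam) times the
    derivative of gam, whose absolute value is at least c; the sign e allows
    gam to decrease. An inequality is enough, which avoids the change of
    variables formula. *)
Lemma subst_bound g gam dgam (r c e a b : R) : continuous g -> (forall x, 0 <= g x) ->
  (forall x, r < `|x| -> g x = 0) -> (forall t : R, is_derive t 1 gam (dgam t)) ->
  continuous dgam -> a < b -> 0 < c -> e = 1 \/ e = -1 ->
  (forall t, a <= t <= b -> c <= e * dgam t) ->
  (c%:E * \int[mu]_(t in `[a, b]) (g (gam t))%:E <= \int[mu]_x (g x)%:E)%E.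
Proof.
move=> cg g0 gr dg cdg ab c0 ee hc.
have cgam := is_derive_continuous dg.
have [k dk kb] := primitive cg g0 gr.
have cgg : continuous (fun t => g (gam t)).
  by move=> t; apply: (continuous_comp (f := gam) (g := g) (cgam t)); exact: cg.
pose k' t := e * (g (gam t) * dgam t).
have ck' : continuous k'.
  by move=> t; apply: cvgM; [exact: cvg_cst|apply: cvgM; [exact: cgg|exact: cdg]].
have dek (t : R) : is_derive t 1 (fun t => e * k (gam t)) (k' t).
  have h := is_derive1_comp (dk (gam t)) (dg t).
  exact: (is_deriveZ e h).
rewrite -ge0_integralZl//; last 3 first.
- by apply/measurable_EFinP; apply: measurable_funTS; exact: continuous_measurable1.
- by move=> t _; rewrite lee_fin.
- by rewrite lee_fin ltW.
apply: (@le_trans _ _ (\int[mu]_(t in `[a, b]) (k' t)%:E)%E).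
  apply: le_integral => //.
  - apply: continuous_compact_integrable; first exact: segment_compact.
    apply: continuous_subspaceT => t.
    by apply: cvgM; [exact: cvg_cst|exact: cgg].
  - apply: continuous_compact_integrable; first exact: segment_compact.
    exact: continuous_subspaceT.
  - move=> t; rewrite inE /= in_itv /= => /hc h.
    by rewrite -EFinM lee_fin /k' mulrCA mulrC ler_wpM2l.
rewrite (ftc_interval ab ck' dek) -mulrBr.
by case: ee => ->; rewrite ?mul1r ?mulN1r ?opprB; exact: kb.
Qed.

(** A function of compact support is at most the integral of its derivative. *)
Lemma slice_bound k k' (Q : R -> R) (r y : R) : continuous k' -> continuous Q ->
  (forall x : R, is_derive x 1 k (k' x)) -> (forall x, r < `|x| -> k x = 0) ->
  (forall x, `|k' x| <= Q x) -> ((k y)%:E <= \int[mu]_x (Q x)%:E)%E.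
Proof.
move=> ck' cQ dk kr hQ; have Q0 x : 0 <= Q x := le_trans (normr_ge0 _) (hQ x).
pose a := Num.min (y - 1) (- `|r| - 1).
have ay : a < y by rewrite gt_min; apply/orP; left; lra.
have ka : k a = 0.
  apply: kr; have h : a <= - `|r| - 1 by rewrite ge_min lexx orbT.
  have := ler_norm r; have := ler_norm (- a); rewrite normrN; lra.
apply: le_trans (integral_itv_le a y cQ Q0).
rewrite -[k y]subr0 -{1}ka -(ftc_interval ay ck' dk).
apply: le_integral => //.
- apply: continuous_compact_integrable; first exact: segment_compact.
  exact: continuous_subspaceT.
- apply: continuous_compact_integrable; first exact: segment_compact.
  exact: continuous_subspaceT.
- by move=> t _; rewrite lee_fin (le_trans (ler_norm _)).
Qed.

End OneVariable.

Section Slices.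
Context {R : realType}.
Variable b : R.
Local Notation mu := (@lebesgue_measure R).
Implicit Types (q : R * R -> R) (psi : R * R -> R[i]).

(** The point with j-th coordinate x and other coordinate s. Both choices of
    the coordinate occur, according to the direction of the curve. *)
Definition slot (j : 'I_2) (x s : R) : R * R := if j == 0 then (x, s) else (s, x).
Definition other (j : 'I_2) : 'I_2 := if j == 0 then 1 else 0.
Definition coord (j : 'I_2) (x : R * R) : R := if j == 0 then x.1 else x.2.

Lemma slot_coord j x : x = slot j (coord j x) (coord (other j) x).
Proof. by rewrite /slot /coord /other; case: x => x y; case: (j == 0). Qed.

Lemma slot_continuous1 q j s : continuous q -> continuous (fun x => q (slot j x s)).
Proof.
rewrite /slot => cq; case: (j == 0); [exact: continuous_slice1|exact: continuous_slice2].
Qed.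

Lemma slot_continuous2 q j x : continuous q -> continuous (fun s => q (slot j x s)).
Proof.
rewrite /slot => cq; case: (j == 0); [exact: continuous_slice2|exact: continuous_slice1].
Qed.

Lemma slot_is_derive q j x (s : R) : smooth q ->
  is_derive s 1 (fun s => q (slot j x s)) (partial (other j) q (slot j x s)).
Proof.
rewrite /slot /other => sq; case: (j == 0).
  by apply: is_derive_slice2; exact: smooth_is_derive.
by apply: is_derive_slice1; exact: smooth_is_derive.
Qed.

Lemma slot_supp1 q j r x s : supp_box r q -> r < `|x| -> q (slot j x s) = 0.
Proof.
move=> hr rx; apply: (supp_box_eq0 hr); rewrite prod_normE lt_max /slot.
by case: (j == 0); rewrite rx ?orbT.
Qed.

Lemma slot_supp2 q j r x s : supp_box r q -> r < `|s| -> q (slot j x s) = 0.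
Proof.
move=> hr rx; apply: (supp_box_eq0 hr); rewrite prod_normE lt_max /slot.
by case: (j == 0); rewrite rx ?orbT.
Qed.

(** The integral along the lines transverse to the j-th axis, over a segment
    containing the support. *)
Definition marginal r j q (x : R) : R := \int[mu]_(s in `[- r, r]) q (slot j x s).

Lemma marginalE r j q x : continuous q -> supp_box r q ->
  (marginal r j q x)%:E = (\int[mu]_s (q (slot j x s))%:E)%E.
Proof.
move=> cq hr.
have i1 : mu.-integrable `[- r, r] (EFin \o (fun s => q (slot j x s))).
  apply: continuous_compact_integrable; first exact: segment_compact.
  by apply: continuous_subspaceT; exact: slot_continuous2.
rewrite /marginal /Rintegral fineK; last exact: integrable_fin_num.
rewrite integral_mkcond; apply: eq_integral => s _; rewrite patchE; case: ifPn => //.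
rewrite notin_setE /= in_itv /= -ler_norml => /negP; rewrite -ltNge => h.
by rewrite (slot_supp2 _ _ hr h).
Qed.

Lemma marginal_ge0 r j q x : (forall z, 0 <= q z) -> 0 <= marginal r j q x.
Proof. by move=> q0; apply: Rintegral_ge0. Qed.

Lemma marginal_supp r j q x : supp_box r q -> r < `|x| -> marginal r j q x = 0.
Proof.
move=> hr rx; rewrite /marginal; under eq_Rintegral do rewrite (slot_supp1 _ _ hr rx).
by rewrite Rintegral_cst// mul0r.
Qed.

Lemma marginal_continuous r j q : continuous q -> supp_box r q -> continuous (marginal r j q).
Proof.
move=> cq hr x.
have [M M0 hM] := continuous_bounded_box r cq.
have mI : measurable (`[- r, r] : set (measurableTypeR R)) by exact: measurable_itv.
have ig : mu.-integrable `[- r, r] (EFin \o (fun=> M : R)).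
  apply: continuous_compact_integrable; first exact: segment_compact.
  by apply: continuous_subspaceT => y; exact: cvg_cst.
have := @continuity_under_integral R _ _ mu (fun x s => q (slot j x s)) _ mI (x - 1) (x + 1)
  _ _ (fun=> M) ig _ x; apply.
- move=> y _; apply: continuous_compact_integrable; first exact: segment_compact.
  by apply: continuous_subspaceT; exact: slot_continuous2.
- by apply: aeW => s _ y _; exact: slot_continuous1.
- move=> y _; apply: aeW => s _; have [h|h] := leP `|slot j y s| r; first exact: hM.
  by rewrite (supp_box_eq0 hr h) normr0.
- by rewrite inE /= in_itv /= ltrBlDr ltrDl ltr01.
Qed.

Lemma marginal_mass r j q : continuous q -> supp_box r q -> (forall z, 0 <= q z) ->
  (\int[mu]_x (marginal r j q x)%:E = \int[leb2]_z (q z)%:E)%E.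
Proof.
move=> cq hr q0; under eq_integral do rewrite (marginalE _ _ cq hr).
have mq := meas2_EFin (continuous_meas2 cq).
have q0' z : (0 <= (q z)%:E)%E by rewrite lee_fin.
rewrite /slot; case: (j == 0).
  by rewrite (leb2_tonelli (continuous_meas2 cq) q0).
rewrite (leb2_tonelli (continuous_meas2 cq) q0).
exact: esym (@fubini_tonelli _ _ _ _ R mu mu _ mq q0').
Qed.

(** By the arithmetic-geometric inequality, a bound for 2 |psi| |Pi_j psi|,
    hence for the derivative of |psi|^2. Its integral is controlled by the
    magnetic Sobolev norm. *)
Definition energy j psi (x : R * R) : R := sqmod (psi x) + sqmod (cPi b j psi x).

Lemma test_sqmod psi : Ctest_fun psi -> test_fun (fun x => sqmod (psi x)).
Proof.
by move=> [t1 t2]; apply: testD; [exact: (test_mulr t1 (test_smooth t1))|exact: (test_mulr t2 (test_smooth t2))].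
Qed.

Lemma test_energy j psi : Ctest_fun psi -> test_fun (energy j psi).
Proof.
by move=> tp; apply: testD; apply: test_sqmod => //; exact: Ctest_cPi.
Qed.

(** The diamagnetic cancellation: the potential is real, so d_j |psi|^2 = 2 Re
    (conj(psi) d_j psi) = 2 Re (i conj(psi) Pi_j psi). *)
Lemma partial_sqmod j psi x : Ctest_fun psi ->
  `|partial j (fun x => sqmod (psi x)) x| <= energy j psi x.
Proof.
move=> [t1 t2]; have s1 := test_smooth t1; have s2 := test_smooth t2.
rewrite (partialD j (smoothM s1 s1) (smoothM s2 s2)) (partialM j s1 s1) (partialM j s2 s2).
rewrite /energy /sqmod /cPi /=.
move: (partial j _ x) (partial j _ x) (vpot b x j) => q p v; case: (psi x) => y z /=.
set P := q - v * y; set Q := - p - v * z.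
have -> : y * p + y * p + (z * q + z * q) = 2 * (z * P - y * Q) by rewrite /P /Q; ring.
rewrite ler_norml; apply/andP; split; rewrite -subr_ge0.
  rewrite (_ : _ - _ = (z + P) ^+ 2 + (y - Q) ^+ 2); last by ring.
  by rewrite addr_ge0 ?sqr_ge0.
rewrite (_ : _ - _ = (z - P) ^+ 2 + (y + Q) ^+ 2); last by ring.
by rewrite addr_ge0 ?sqr_ge0.
Qed.

Lemma energy_ge0 j psi x : 0 <= energy j psi x.
Proof. by apply: addr_ge0; exact: sqmod_ge0. Qed.

(** Suppose that the j-th coordinate moves along the curve with speed at least
    c in a fixed direction. At a point of the curve, |psi|^2 is at most the
    integral of its derivative along the line through that point in the other
    direction. Integrating over the curve, the j-th coordinate serves as a
    variable of integration at the cost of a factor 1/c, and Fubini gives an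
    integral over the plane. *)
Lemma trace_piece (j : 'I_2) psi (gam : R -> R * R) (dgam : R -> R) (c e s t : R) :
  Ctest_fun psi -> (forall x : R, is_derive x 1 (fun x => coord j (gam x)) (dgam x)) ->
  continuous dgam -> continuous gam -> s < t -> 0 < c -> e = 1 \/ e = -1 ->
  (forall x, s <= x <= t -> c <= e * dgam x) ->
  (c%:E * \int[mu]_(x in `[s, t]) (sqmod (psi (gam x)))%:E <=
    \int[leb2]_z (energy (other j) psi z)%:E)%E.
Proof.
move=> tp dg cdg cgam st c0 ee hc.
have te := test_energy (other j) tp; have ce := smooth_continuous (test_smooth te).
have tq := test_sqmod tp; have cq := smooth_continuous (test_smooth tq).
have /test_funP[_ [r hr]] := te; have /test_funP[_ [r' hr']] := tq.
have e0 z := energy_ge0 (other j) psi z.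
have m0 x := marginal_ge0 r j x e0.
have mc := marginal_continuous (j := j) ce hr.
have ms x (h : r < `|x|) := marginal_supp j hr h.
rewrite -(marginal_mass j ce hr e0).
apply: le_trans (subst_bound mc m0 ms dg cdg st c0 ee hc).
apply: lee_pmul => //; [by rewrite lee_fin ltW|by apply: integral_ge0 => x _; rewrite lee_fin sqmod_ge0|].
apply: ge0_le_integral => //.
- by move=> x _; rewrite lee_fin sqmod_ge0.
- by apply/measurable_EFinP; apply: measurable_funTS; apply: continuous_measurable1 => x;
    apply: (continuous_comp (f := gam) (g := fun z => sqmod (psi z)) (cgam x)); exact: cq.
- have cg := is_derive_continuous dg.
  apply/measurable_EFinP; apply: measurable_funTS; apply: continuous_measurable1 => x.
  exact: (continuous_comp (f := fun x => coord j (gam x)) (g := marginal r j _) (cg x) (mc _)).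
move=> x _; rewrite (marginalE _ _ ce hr) {1}(slot_coord j (gam x)).
have := @slice_bound R (fun s => sqmod (psi (slot j (coord j (gam x)) s)))
  (fun s => partial (other j) (fun x => sqmod (psi x)) (slot j (coord j (gam x)) s))
  (fun s => energy (other j) psi (slot j (coord j (gam x)) s)) r' (coord (other j) (gam x)).
apply.
- by apply: slot_continuous2; exact: smooth_continuous (smooth_partial (other j) (test_smooth tq)).
- by apply: slot_continuous2; exact: ce.
- by move=> y; apply: (@slot_is_derive (fun x => sqmod (psi x))); exact: test_smooth.
- by move=> y hy; exact: (slot_supp2 j (coord j (gam x)) hr' hy).
- move=> y; exact: partial_sqmod.
Qed.

End Slices.

Section TraceEnergy.
Context {R : realType}.
Variable b : R.
Implicit Types (u v phi : R * R -> R[i]) (j : 'I_2).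

Lemma H1A_sub phi u : Ctest_fun phi -> H1A b u -> H1A b (fun x => phi x - u x).
Proof.
move=> tp hu; have lp := Ctest_L2 tp.
have Lg j : L2 (fun x => cPi b j phi x - PiA b j u x).
  by apply: L2B; [exact: Ctest_L2 (Ctest_cPi b j tp)|exact: (PiA_spec j hu).1].
apply: (H1A_intro (L2B lp hu.1) Lg) => j.
apply: wdPiB; [exact: L2_lociC|exact: L2_lociC (Ctest_L2 (Ctest_cPi b j tp))|exact: L2_lociC hu.1| | |].
- exact: L2_lociC (PiA_spec j hu).1.
- by case: tp => t1 t2; apply: wdPi_smooth; exact: test_smooth.
- exact: (PiA_spec j hu).2.
Qed.

Lemma sqnormH1AE u : H1A b u -> sqnormH1A b u = (I2 (fun x => sqmod (u x)) +
  (I2 (fun x => sqmod (PiA b 0 u x)) + I2 (fun x => sqmod (PiA b 1 u x))))%:E.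
Proof.
move=> hu; have add3 (X Y Z : \bar R) (x y z : R) : X = x%:E -> Y = y%:E -> Z = z%:E ->
    (X + (Y + Z))%E = (x + (y + z))%:E by move=> -> -> ->.
transitivity (sqnormL2 u + (sqnormL2 (PiA b 0%R u) + sqnormL2 (PiA b 1%R u)))%E.
  exact: (congr1 (fun X => sqnormL2 u + X)%E (sum_I2 (fun j => sqnormL2 (PiA b j u)))).
exact: (add3 _ _ _ _ _ _ (sqnormL2E hu.1) (sqnormL2E (PiA_spec 0 hu).1) (sqnormL2E (PiA_spec 1 hu).1)).
Qed.

Lemma le_sum_I2 (F : 'I_2 -> R) j : (forall j, 0 <= F j) -> F j <= F 0 + F 1.
Proof.
move=> F0; case: j => -[|[|//]] i.
  by have -> : Ordinal i = 0 by [apply/val_inj]; rewrite lerDl.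
by have -> : Ordinal i = 1 by [apply/val_inj]; rewrite lerDr.
Qed.

Lemma PiA_le_H1A j u : H1A b u ->
  ((I2 (fun x => sqmod (u x)) + I2 (fun x => sqmod (PiA b j u x)))%:E <= sqnormH1A b u)%E.
Proof.
move=> hu; rewrite (sqnormH1AE hu) lee_fin lerD2l.
exact: (@le_sum_I2 (fun j => I2 (fun x => sqmod (PiA b j u x))) j
  (fun j => I2_ge0 (fun x => sqmod_ge0 (PiA b j u x)))).
Qed.

Lemma I2_sqmodB (u v w : R * R -> R[i]) : integ (fun x => sqmod (u x)) ->
  integ (fun x => sqmod (v x)) -> integ (fun x => sqmod (w x)) ->
  (forall x, w x = u x - v x) ->
  I2 (fun x => sqmod (w x)) <= 2 * I2 (fun x => sqmod (u x)) + 2 * I2 (fun x => sqmod (v x)).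
Proof.
move=> iu iv iw E; rewrite -(I2Z 2 iu) -(I2Z 2 iv) -(I2D (integZ 2 iu) (integZ 2 iv)).
apply: (le_I2 iw (integD (integZ 2 iu) (integZ 2 iv))) => x.
by rewrite E; apply: le_trans (sqmodD _ _) _; rewrite sqmodN.
Qed.

(** Two approximations of the same u are close in energy norm; this is how the
    trace inequality compares the traces obtained from two approximating
    sequences. *)
Lemma energy_le j phi phi' u : Ctest_fun phi -> Ctest_fun phi' -> H1A b u ->
  (\int[leb2]_z (energy b j (fun x => phi x - phi' x)%R z)%:E <=
   2%:E * sqnormH1A b (fun x => phi x - u x)%R + 2%:E * sqnormH1A b (fun x => phi' x - u x)%R)%E.
Proof.
move=> tp tp' hu; set D := (fun x => phi x - phi' x).
have tD : Ctest_fun D.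
  case: tp tp' => [t1 t2] [t1' t2']; split.
    by under eq_fun do rewrite raddfB; exact: testB.
  by under eq_fun do rewrite raddfB; exact: testB.
have hX := H1A_sub tp hu; have hX' := H1A_sub tp' hu.
set X := (fun x => phi x - u x) in hX *; set X' := (fun x => phi' x - u x) in hX' *.
have [lP wP] := PiA_spec j hX; have [lP' wP'] := PiA_spec j hX'.
have lD := Ctest_L2 tD; have lC := Ctest_L2 (Ctest_cPi b j tD).
have wD : wdPi b j D (cPi b j D).
  by case: tD => t1 t2; apply: wdPi_smooth; exact: test_smooth.
have DE : (fun x => X x - X' x) = D.
  by apply/funext => x; rewrite /X /X' /D opprB addrA subrK.
have w2 : wdPi b j D (fun x => PiA b j X x - PiA b j X' x).
  rewrite -DE; exact: (wdPiB (L2_lociC hX.1) (L2_lociC lP) (L2_lociC hX'.1) (L2_lociC lP') wP wP').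
have ae := wdPi_unique (L2_lociC lD) (L2_lociC lC) (L2_lociC (L2B lP lP')) wD w2.
have [_ iX] := (L2P _).1 hX.1; have [_ iX'] := (L2P _).1 hX'.1.
have [_ iP] := (L2P _).1 lP; have [_ iP'] := (L2P _).1 lP'.
have [_ iD] := (L2P _).1 lD; have [_ iC] := (L2P _).1 lC.
have [_ iB] := (L2P _).1 (L2B lP lP').
rewrite -(I2_EFin (test_integ (test_energy b j tD))).
apply: (@le_trans _ _ (2%:E * (I2 (fun x => sqmod (X x)) + I2 (fun x => sqmod (PiA b j X x)))%:E +
  2%:E * (I2 (fun x => sqmod (X' x)) + I2 (fun x => sqmod (PiA b j X' x)))%:E)%E); last first.
  by apply: leeD; apply: lee_wpmul2l => //; exact: PiA_le_H1A.
have alg (d c x p x' p' E : R) : E = d + c -> d <= 2 * x + 2 * x' -> c <= 2 * p + 2 * p' ->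
    (E%:E <= 2%:E * (x + p)%:E + 2%:E * (x' + p')%:E)%E.
  by move=> -> *; rewrite -!EFinM -EFinD lee_fin; lra.
have e1 := I2_sqmodB iX iX' iD (fun x => esym (congr1 (@^~ x) DE)).
have e2 : I2 (fun x => sqmod (cPi b j D x)) <=
    2 * I2 (fun x => sqmod (PiA b j X x)) + 2 * I2 (fun x => sqmod (PiA b j X' x)).
  apply: le_trans (I2_sqmodB iP iP' iB (fun x => erefl)).
  suff -> : I2 (fun x => sqmod (cPi b j D x)) = I2 (fun x => sqmod (PiA b j X x - PiA b j X' x)) by [].
  apply: (I2_ae (integ_meas iC) (integ_meas iB)).
  by apply: aep_sub ae => x ->.
exact: (alg _ _ _ _ _ _ _ (I2D iD iC) e1 e2).
Qed.

End TraceEnergy.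

Local Open Scope complex_scope.


(** * The curve and the traces of smooth functions *)

Section Curve.
Context {R : realType}.
Variables (Gamma : set (R * R)) (h : R * R -> R * R).
Hypothesis hG : C11_circle_diffeo Gamma h.
Local Notation mu := (@lebesgue_measure R).
Let gamma := angular h.
Let dgamma := derive1 gamma.

Lemma coord_cvg (T : Type) (F : set_system T) (f : T -> R * R) j l :
  f @ F --> l -> (fun t => coord j (f t)) @ F --> coord j l.
Proof.
rewrite /coord; case: (j == 0) => fl.
  exact: (cvg_comp f (fun z : R * R => z.1) fl cvg_fst).
exact: (cvg_comp f (fun z : R * R => z.2) fl cvg_snd).
Qed.

Lemma coord_continuous (f : R -> R * R) j : continuous f -> continuous (fun t => coord j (f t)).
Proof. by move=> cf t; apply: coord_cvg; exact: cf. Qed.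

Lemma gamma_is_derive j (t : R) : is_derive t 1 (fun t => coord j (gamma t)) (coord j (dgamma t)).
Proof.
have [_ /(_ t) d _ _] := hG.
have c := @coord_cvg _ _ _ j _ d.
have E : (fun x : R => coord j (x^-1 *: ((gamma \o shift t) (x *: 1) - gamma t))) =
  (fun x : R => x^-1 *: (((fun t => coord j (gamma t)) \o shift t) (x *: 1) - coord j (gamma t))).
  by apply/funext => x; rewrite /coord; case: (j == 0).
rewrite E in c; rewrite /dgamma derive1E.
apply: DeriveDef; last exact: (cvg_lim _ c).
by apply/cvg_ex; eexists; exact: c.
Qed.

Lemma gamma_continuous : continuous gamma.
Proof.
by move=> t; apply/differentiable_continuous/derivable1_diffP; have [_ + _ _] := hG; apply.
Qed.

Lemma dgamma_lipschitz : exists2 k : R, 0 < k & forall s t, `|dgamma s - dgamma t| <= k * `|s - t|.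
Proof.
have [_ _ [k hk] _] := hG; exists (`|k| + 1) => [|s t]; first by rewrite ltr_pwDr.
have /= := hk (s, t) (conj I I) => /le_trans; apply.
by rewrite ler_wpM2r// (le_trans (ler_norm k))// lerDl.
Qed.

Lemma dgamma_continuous : continuous dgamma.
Proof.
have [k k0 hk] := dgamma_lipschitz; move=> t; apply/cvgrPdist_le => e e0.
apply/nbhs_ballP; exists (e / k) => /=; first exact: divr_gt0.
move=> s /= hs; apply: le_trans (hk _ _) _.
by rewrite -ler_pdivlMl// mulrC ltW.
Qed.

Lemma dgamma_gt0 : exists2 m : R, 0 < m & forall t, 0 <= t <= 2 * pi -> m <= `|dgamma t|.
Proof.
have [_ _ _ n0] := hG.
have pi0 : 0 <= 2 * pi :> R by rewrite mulr_ge0 ?pi_ge0.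
have cn : {within `[0, 2 * pi], continuous (fun t => `|dgamma t|)}.
  apply: continuous_subspaceT => t.
  exact: (continuous_comp (f := dgamma) (g := Num.norm) (dgamma_continuous (x := t)) (@norm_continuous _ _ _)).
have [c _ hc] := EVT_min pi0 cn.
by exists `|dgamma c|; [rewrite normr_gt0; exact: n0|move=> t ht; apply: hc; rewrite in_itv].
Qed.

Lemma coord_norm (z : R * R) : exists j e, (e = 1 \/ e = -1) /\ `|z| = e * coord j z.
Proof.
rewrite prod_normE /coord /=.
have sgn (a : R) : exists2 e, e = 1 \/ e = -1 & `|a| = e * a.
  have [a0|a0] := leP 0 a; first by exists 1; [left|rewrite mul1r ger0_norm].
  by exists (-1); [right|rewrite mulN1r ltr0_norm].
have [e1 p1 q1] := sgn z.1; have [e2 p2 q2] := sgn z.2.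
have [hm|hm] := leP `|z.1| `|z.2|; first by exists 1, e2.
by exists 0, e1.
Qed.

Lemma coord_le_norm (z : R * R) (e : R) j : e = 1 \/ e = -1 -> `|e * coord j z| <= `|z|.
Proof.
move=> he; have -> : `|e * coord j z| = `|coord j z|.
  by case: he => ->; rewrite ?mul1r ?mulN1r ?normrN.
by rewrite prod_normE /coord le_max; case: (j == 0); rewrite lexx ?orbT.
Qed.

Lemma half_alg (m A B : R) : m <= B -> `|A - B| <= m / 2 -> m / 2 <= A.
Proof. by rewrite ler_norml => h1 /andP[h2 _]; lra. Qed.

(** The derivative of the parametrisation is Lipschitz and its norm has a
    positive minimum m on the period, so on intervals of a fixed length the
    coordinate realising the sup norm of the derivative at the centre keeps
    its sign and a speed at least m/2. Such intervals are those of the trace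
    inequality. *)
Lemma local_expansion : exists m d : R, [/\ 0 < m, 0 < d &
  forall t0, 0 <= t0 <= 2 * pi -> exists j e, (e = 1 \/ e = -1) /\
    forall t, `|t - t0| <= d -> m <= e * coord j (dgamma t)].
Proof.
have [m m0 hm] := dgamma_gt0; have [k k0 hk] := dgamma_lipschitz.
(* Within m / (2 k) of t0, the derivative changes by at most m/2. *)
exists (m / 2), (m / (2 * k)); split; [exact: divr_gt0|by rewrite divr_gt0// mulr_gt0|].
move=> t0 ht0; have [j [e [he e1]]] := coord_norm (dgamma t0).
exists j, e; split=> // t ht.
have h1 := hm _ ht0; rewrite e1 in h1.
have h2 : `|dgamma t - dgamma t0| <= m / 2.
  apply: le_trans (hk _ _) _; apply: le_trans (ler_wpM2l (ltW k0) ht) _.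
  by rewrite le_eqVlt; apply/orP; left; apply/eqP; field; exact: lt0r_neq0.
have := le_trans (coord_le_norm _ j he) h2.
have -> : coord j (dgamma t - dgamma t0) = coord j (dgamma t) - coord j (dgamma t0).
  by rewrite /coord; case: (j == 0).
rewrite mulrBr; exact: half_alg h1.
Qed.

Lemma gamma_comp_measurable (f : R * R -> R) (D : set (measurableTypeR R)) : continuous f ->
  measurable_fun D (fun t => f (gamma t)).
Proof.
move=> cf; apply: measurable_funTS; apply: continuous_measurable1 => t.
exact: (continuous_comp (f := gamma) (g := f) (gamma_continuous (x := t)) (cf _)).
Qed.

Lemma euclid_ge (z : R * R) : `|z| <= euclid z.
Proof.
rewrite prod_normE ge_max /euclid; apply/andP; split;
  rewrite -sqrtr_sqr ler_sqrt ?addr_ge0 ?sqr_ge0// ?lerDl ?lerDr sqr_ge0//.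
Qed.

Lemma speed_continuous : continuous (speed h).
Proof.
have dc j := coord_continuous (j := j) dgamma_continuous.
move=> t; apply: (continuous_comp (f := fun t => (coord 0 (dgamma t)) ^+ 2 + (coord 1 (dgamma t)) ^+ 2)
  (g := Num.sqrt)); last exact: sqrt_continuous.
by apply: cvgD; apply: cvgM; exact: dc.
Qed.

Lemma speed_ge0 t : 0 <= speed h t.
Proof. exact: sqrtr_ge0. Qed.

(** Arc length dominates m times the parameter. *)
Lemma arc_piece (g : R * R -> R) (m s t : R) : 0 < m ->
  (forall x, 0 <= x <= 2 * pi -> m <= `|dgamma x|) -> (forall x, 0 <= g x) ->
  measurable_fun (`[0, 2 * pi] : set (measurableTypeR R)) (fun x => g (gamma x)) ->
  0 <= s -> t <= 2 * pi ->
  (m%:E * \int[mu]_(x in `[s, t]) (g (gamma x))%:E <= arc_integral h (fun x => (g x)%:E))%E.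
Proof.
move=> m0 hm g0 mg s0 t2.
have sub : `[s, t] `<=` `[0, 2 * pi].
  move=> x /=; rewrite !in_itv /= => /andP[h1 h2].
  by rewrite (le_trans s0 h1) (le_trans h2 t2).
have mI : measurable (`[0, 2 * pi] : set (measurableTypeR R)) by exact: measurable_itv.
have mp : measurable_fun (`[0, 2 * pi] : set (measurableTypeR R)) (fun x => g (gamma x) * speed h x).
  apply: measurable_funM => //; apply: measurable_funTS.
  by apply: continuous_measurable1; exact: speed_continuous.
rewrite -ge0_integralZl//; last 3 first.
- by apply/measurable_EFinP; apply: measurable_funS mg.
- by move=> x _; rewrite lee_fin.
- by rewrite lee_fin ltW.
apply: (@le_trans _ _ (\int[mu]_(x in `[s, t]) (g (gamma x) * speed h x)%:E)%E).
  apply: ge0_le_integral => //.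
  - by move=> x _; rewrite lee_fin mulr_ge0// ltW.
  - have mm : measurable_fun (`[s, t] : set (measurableTypeR R)) (fun x => m * g (gamma x)).
      apply: measurable_funM; first exact: measurable_cst.
      exact: measurable_funS mg.
    exact: (measurable_EFinP _ _).2 mm.
  - by apply/measurable_EFinP; exact: measurable_funS mp.
  move=> x /sub /=; rewrite in_itv /= => /hm h1.
  rewrite -EFinM lee_fin mulrC ler_wpM2l//.
  exact: le_trans h1 (euclid_ge _).
rewrite /arc_integral; under [leRHS]eq_integral do rewrite -EFinM.
apply: ge0_subset_integral => //; first by apply/measurable_EFinP.
by move=> x _; rewrite lee_fin mulr_ge0// speed_ge0.
Qed.

(** The multiples of d in the parameter interval are at most d away from every
    point of it. *)
Lemma ae_local (P : R -> Prop) (d : R) : 0 < d ->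
  (forall t0, 0 <= t0 <= 2 * pi ->
    {ae @leb1 R, forall x, (`|x - t0| <= d /\ 0 <= x <= 2 * pi) -> P x}) ->
  {ae @leb1 R, forall x, (`[0, 2 * pi]%classic : set R) x -> P x}.
Proof.
move=> d0 hP.
have : {ae @leb1 R, forall x, forall n : nat, n%:R * d <= 2 * pi ->
    (`|x - n%:R * d| <= d /\ 0 <= x <= 2 * pi) -> P x}.
  apply: ae_foralln => n; have [nd|nd] := boolP (n%:R * d <= 2 * pi); last first.
    exact: aeW.
  have n0 : 0 <= n%:R * d <= 2 * pi by rewrite nd mulr_ge0 ?(ltW d0).
  have := hP _ n0; apply: (@filterS _ _ (ae_filter_ringOfSetsType (@leb1 R))).
  by move=> x hx _; exact: hx.
apply: (@filterS _ _ (ae_filter_ringOfSetsType (@leb1 R))) => x hx.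
rewrite /= in_itv /= => xI; have /andP[x0 x2] := xI.
have := truncn_itv (divr_ge0 x0 (ltW d0)); set n := Num.truncn _ => /andP[n1 n2].
rewrite ler_pdivlMr// in n1; rewrite ltr_pdivrMr// in n2.
apply: (hx n) => //; first exact: le_trans n1 x2.
split=> //; rewrite ger0_norm ?subr_ge0// lerBlDr.
by move: n2; rewrite -natr1 mulrDl mul1r addrC => /ltW.
Qed.

Lemma cvge0_near (X : nat -> \bar R) (e : R) : X @ \oo --> 0%E -> 0 < e ->
  \forall n \near \oo, (X n <= e%:E)%E.
Proof.
move=> /fine_cvgP[fX cX] e0; have h2 : \forall n \near \oo, (fine \o X) n <= e by apply: (cvgr_le 0 cX).
by apply: filterS2 fX h2 => n fn; rewrite -lee_fin /= fineK.
Qed.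

Lemma sqmod_sum3 (x y z : R[i]) :
  sqmod (x + y + z) <= 4 * (sqmod x + sqmod y + sqmod z).
Proof.
have h1 := sqmodD (x + y) z; have h2 := sqmodD x y; have h3 := sqmod_ge0 z; lra.
Qed.

Lemma Cmeasurable_sqmod (D : set (measurableTypeR R)) (f : R -> R[i]) : measurable D ->
  Cmeasurable D f -> measurable_fun D (fun x => sqmod (f x)).
Proof. by move=> mD [m1 m2]; apply: measurable_funD; apply: measurable_funM. Qed.

Lemma CmeasurableB (D : set (measurableTypeR R)) (f g : R -> R[i]) : measurable D ->
  Cmeasurable D f -> Cmeasurable D g -> Cmeasurable D (fun x => f x - g x).
Proof.
move=> mD [m1 m2] [n1 n2]; split; [under eq_fun do rewrite raddfB|under eq_fun do rewrite raddfB];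
  exact: measurable_funB.
Qed.

Lemma Ctest_gamma (D : set (measurableTypeR R)) (phi : R * R -> R[i]) : Ctest_fun phi ->
  Cmeasurable D (fun t => phi (gamma t)).
Proof.
by move=> [t1 t2]; split; apply: (@gamma_comp_measurable (fun x => _ (phi x)));
  exact: smooth_continuous (test_smooth _).
Qed.

Lemma arc_le_Hhalf (g : R * R -> R[i]) :
  (arc_integral h (fun x => (sqmod (g x))%:E) <= sqnormHhalf h g)%E.
Proof.
rewrite /sqnormHhalf leeDl//; apply: integral_ge0 => t _; apply: mule_ge0.
  apply: integral_ge0 => s _; apply: mule_ge0; rewrite lee_fin ?speed_ge0//.
  by rewrite divr_ge0 ?sqr_ge0// sqmod_ge0.
by rewrite lee_fin speed_ge0.
Qed.

Lemma local_interval (T t0 d : R) : 0 < T -> 0 < d -> 0 <= t0 <= T ->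
  exists s t, [/\ s < t, 0 <= s, t <= T, forall x, s <= x <= t -> `|x - t0| <= d &
    forall x, `|x - t0| <= d -> 0 <= x <= T -> s <= x <= t].
Proof.
move=> T0 d0 /andP[t00 t01].
exists (Num.max 0 (t0 - d)), (Num.min T (t0 + d)); split.
- rewrite gt_max !lt_min T0 (ltr_wpDl t00 d0) /=.
  by apply/andP; split; [apply: lt_le_trans t01; rewrite gtrBl|rewrite ltrBlDr -addrA ltrDl addr_gt0].
- by rewrite le_max lexx.
- by rewrite ge_min lexx.
- move=> x; rewrite ge_max le_min => /andP[/andP[_ h1] /andP[_ h2]].
  by rewrite ler_distl h1 h2.
- move=> x; rewrite ler_distl => /andP[h1 h2] /andP[h3 h4].
  by rewrite ge_max le_min h1 h2 h3 h4.
Qed.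

Lemma integral_sum3 (D : set (measurableTypeR R)) (c : R) (a1 a2 a3 : R -> R) :
  0 <= c -> measurable D ->
  measurable_fun D a1 -> measurable_fun D a2 -> measurable_fun D a3 ->
  (forall x, 0 <= a1 x) -> (forall x, 0 <= a2 x) -> (forall x, 0 <= a3 x) ->
  (\int[mu]_(x in D) (c * (a1 x + a2 x + a3 x))%:E =
   c%:E * (\int[mu]_(x in D) (a1 x)%:E + \int[mu]_(x in D) (a2 x)%:E +
           \int[mu]_(x in D) (a3 x)%:E))%E.
Proof.
move=> c0 mD m1 m2 m3 p1 p2 p3; under eq_integral do rewrite EFinM !EFinD.
have e1 := (measurable_EFinP _ _).2 m1; have e2 := (measurable_EFinP _ _).2 m2.
have e3 := (measurable_EFinP _ _).2 m3.
have e12 := emeasurable_funD e1 e2.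
rewrite ge0_integralZl//; last 2 first.
- exact: (emeasurable_funD e12 e3).
- by move=> x _; rewrite -!EFinD lee_fin !addr_ge0.
rewrite ge0_integralD//; last 2 first.
- by move=> x _; rewrite -EFinD lee_fin addr_ge0.
- by move=> x _; rewrite lee_fin.
by rewrite ge0_integralD// => x _; rewrite lee_fin.
Qed.

Lemma mul_sum3_le (c A B C X Y Z : \bar R) : (0 <= A -> 0 <= B -> 0 <= C ->
  c * A <= X -> c * B <= Y -> c * C <= Z -> c * (A + B + C) <= X + Y + Z)%E.
Proof.
move=> A0 B0 C0 hX hY hZ; rewrite ge0_muleDr ?adde_ge0// ge0_muleDr//.
exact: leeD (leeD hX hY) hZ.
Qed.

Lemma integral_eq0_ae (D : set (measurableTypeR R)) (f : R -> R) : measurable D ->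
  measurable_fun D f -> (forall x, 0 <= f x) -> (\int[mu]_(x in D) (f x)%:E = 0)%E ->
  {ae @leb1 R, forall x, D x -> f x = 0}.
Proof.
move=> mD mf f0 z; have mf' := (measurable_EFinP _ _).2 mf.
have : (\int[mu]_(x in D) `|(EFin \o f) x| = 0)%E.
  by rewrite -[RHS]z; apply: eq_integral => x _; rewrite gee0_abs// lee_fin.
move=> /(@ae_eq_integral_abs _ _ _ mu D mD (EFin \o f) mf').1.
apply: (@filterS _ _ (ae_filter_ringOfSetsType (@leb1 R))) => x hx Dx.
by have [] := hx Dx.
Qed.

(** On a short piece of curve, g - g' is compared with phi - phi', the
    difference of two test functions approximating u: the errors are small in
    L^2 of the curve, and phi - phi' is small there by the trace inequality,
    as both functions approximate u in the magnetic Sobolev norm. *)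
Lemma trace_unique b u g g' : is_trace h b u g -> is_trace h b u g' ->
  arc_ae h (fun x => g x = g' x).
Proof.
move=> [hu hg [phi [tphi c1 c2]]] [_ hg' [phi' [tphi' c1' c2']]].
have [m [d [m0 d0 hloc]]] := local_expansion.
have [mI mI0 mIle] := dgamma_gt0.
apply: (ae_local d0) => t0 ht0.
have pi0 : 0 < 2 * pi :> R by rewrite mulr_gt0 ?pi_gt0.
have [s [t [st s0 t2 st_d d_st]]] := local_interval pi0 d0 ht0.
have [j [e [he hj]]] := hloc _ ht0.
pose M := Num.min m mI; have M0 : 0 < M by rewrite lt_min m0.
pose f x := sqmod (g (gamma x) - g' (gamma x)).
have f0 x : 0 <= f x by exact: sqmod_ge0.
have mI' : measurable (`[0, 2 * pi] : set (measurableTypeR R)) by exact: measurable_itv.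
have mJ : measurable (`[s, t] : set (measurableTypeR R)) by exact: measurable_itv.
have sub : `[s, t] `<=` `[0, 2 * pi].
  move=> x /=; rewrite !in_itv /= => /andP[h1 h2].
  by rewrite (le_trans s0 h1) (le_trans h2 t2).
have mf : measurable_fun (`[0, 2 * pi] : set (measurableTypeR R)) f.
  by apply: Cmeasurable_sqmod => //; apply: CmeasurableB => //; [exact: hg.1|exact: hg'.1].
have mfJ : measurable_fun (`[s, t] : set (measurableTypeR R)) f by exact: measurable_funS mf.
suff z : (\int[mu]_(x in `[s, t]) (f x)%:E = 0)%E.
  have := integral_eq0_ae mJ mfJ f0 z.
  apply: (@filterS _ _ (ae_filter_ringOfSetsType (@leb1 R))) => x hx [xd xI].
  have xJ : (`[s, t]%classic : set R) x by rewrite /= in_itv; exact: d_st.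
  have /eqP := hx xJ; rewrite /f /sqmod paddr_eq0 ?sqr_ge0// !sqrf_eq0.
  by rewrite !raddfB /= !subr_eq0 => h2; apply/eqP; rewrite eq_complex.
(* The constant is 4 (1 + 1 + 4): three terms are added, with |x + y + z|^2 <=
   4 (|x|^2 + |y|^2 + |z|^2), and the energy of the difference of two
   approximations costs 4 eps. *)
have key (eps : R) : 0 < eps -> (M%:E * \int[mu]_(x in `[s, t]) (f x)%:E <= (24 * eps)%:E)%E.
  move=> eps0.
  have [n [h1 [h2 [h1' h2']]]] := @filter_ex _ _ _ _
    (filterI (cvge0_near c1 eps0) (filterI (cvge0_near c2 eps0)
    (filterI (cvge0_near c1' eps0) (cvge0_near c2' eps0)))).
  have tD : Ctest_fun (fun x => phi n x - phi' n x).
    by have [a1 a2] := tphi n; have [b1 b2] := tphi' n; split;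
      under eq_fun do rewrite raddfB; exact: testB.
  pose a1 x := sqmod (phi n (gamma x) - g (gamma x)).
  pose a2 x := sqmod (phi' n (gamma x) - g' (gamma x)).
  pose a3 x := sqmod (phi n (gamma x) - phi' n (gamma x)).
  have ma1 : measurable_fun (`[0, 2 * pi] : set (measurableTypeR R)) a1.
    by apply: Cmeasurable_sqmod => //; apply: CmeasurableB => //; [exact: Ctest_gamma|exact: hg.1].
  have ma2 : measurable_fun (`[0, 2 * pi] : set (measurableTypeR R)) a2.
    by apply: Cmeasurable_sqmod => //; apply: CmeasurableB => //; [exact: Ctest_gamma|exact: hg'.1].
  have ma3 : measurable_fun (`[0, 2 * pi] : set (measurableTypeR R)) a3.
    by apply: Cmeasurable_sqmod => //; apply: CmeasurableB => //; exact: Ctest_gamma.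
  have hM x : 0 <= x <= 2 * pi -> M <= `|dgamma x|.
    by move=> /mIle; apply: le_trans; rewrite ge_min lexx orbT.
  have b1 : (M%:E * \int[mu]_(x in `[s, t]) (a1 x)%:E <= eps%:E)%E.
    apply: le_trans (le_trans (arc_le_Hhalf _) h2).
    exact: (arc_piece M0 hM (fun x => sqmod_ge0 (phi n x - g x)) ma1 s0 t2).
  have b2 : (M%:E * \int[mu]_(x in `[s, t]) (a2 x)%:E <= eps%:E)%E.
    apply: le_trans (le_trans (arc_le_Hhalf _) h2').
    exact: (arc_piece M0 hM (fun x => sqmod_ge0 (phi' n x - g' x)) ma2 s0 t2).
  have b3 : (M%:E * \int[mu]_(x in `[s, t]) (a3 x)%:E <= (4 * eps)%:E)%E.
    have hc x : s <= x <= t -> M <= e * coord j (dgamma x).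
      by move=> /st_d/hj; apply: le_trans; rewrite ge_min lexx.
    have := trace_piece b tD (gamma_is_derive j) (coord_continuous (j := j) dgamma_continuous)
      gamma_continuous st M0 he hc.
    move=> /le_trans; apply; apply: (le_trans (energy_le (other j) (tphi n) (tphi' n) hu)).
    have -> : (4 * eps)%:E = (2%:E * eps%:E + 2%:E * eps%:E)%E.
      by rewrite -!EFinM -EFinD -mulrDl -natrD.
    have two0 : (0 <= 2%:E :> \bar R)%E by rewrite lee_fin.
    exact: leeD (lee_wpmul2l two0 h1) (lee_wpmul2l two0 h1').
  have M0' : (0 <= M%:E)%E by rewrite lee_fin ltW.
  have le1 : (\int[mu]_(x in `[s, t]) (f x)%:E <=
      4%:E * (\int[mu]_(x in `[s, t]) (a1 x)%:E + \int[mu]_(x in `[s, t]) (a2 x)%:E +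
           \int[mu]_(x in `[s, t]) (a3 x)%:E))%E.
    rewrite -(integral_sum3 (ler0n R 4) mJ (measurable_funS mI' sub ma1) (measurable_funS mI' sub ma2)
      (measurable_funS mI' sub ma3) (fun x => sqmod_ge0 _) (fun x => sqmod_ge0 _) (fun x => sqmod_ge0 _)).
    apply: ge0_le_integral => //.
    - by move=> x _; rewrite lee_fin.
    - exact: (measurable_EFinP _ _).2 mfJ.
    - apply/measurable_EFinP; apply: measurable_funM; first exact: measurable_cst.
      by apply: measurable_funD; [apply: measurable_funD|]; exact: measurable_funS (sub) _.
    move=> x _; rewrite lee_fin /f /a1 /a2 /a3.
    rewrite (_ : g _ - g' _ = - (phi n (gamma x) - g (gamma x)) + (phi' n (gamma x) - g' (gamma x)) +
      (phi n (gamma x) - phi' n (gamma x))); last by ring.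
    by apply: le_trans (sqmod_sum3 _ _ _) _; rewrite sqmodN.
  apply: (le_trans (lee_wpmul2l M0' le1)); rewrite muleCA.
  have n0 (k : R -> R[i]) : (0 <= \int[mu]_(x in `[s, t]) (sqmod (k x))%:E)%E.
    by apply: integral_ge0 => x _; rewrite lee_fin sqmod_ge0.
  have -> : (24 * eps)%:E = (4%:E * (eps%:E + eps%:E + (4 * eps)%:E))%E.
    by transitivity ((4 * (eps + eps + 4 * eps))%:E); [congr EFin; ring|].
  apply: lee_wpmul2l; first by rewrite lee_fin.
  exact: (mul_sum3_le (n0 _) (n0 _) (n0 _) b1 b2 b3).
apply/eqP; rewrite eq_le integral_ge0 ?andbT; last by move=> x _; rewrite lee_fin.
apply/lee_addgt0Pr => eps eps0; rewrite add0e.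
have e24 : 0 < M * eps / 24 by rewrite divr_gt0// mulr_gt0.
have := key _ e24; rewrite (_ : 24 * (M * eps / 24) = M * eps); last by field.
by rewrite EFinM lee_pmul2l// lte_fin.
Qed.

(** The integral of a nonnegative function is a supremum over simple functions
    below it, so monotonicity holds without measurability. This form applies
    to the iterated arc integral in the H^(1/2) norm, where measurability in
    the outer variable is not at hand. *)
Lemma le_integral_sup (D : set (measurableTypeR R)) (f g : R -> \bar R) :
  (forall x, D x -> (0 <= f x)%E) -> (forall x, D x -> (f x <= g x)%E) ->
  (\int[mu]_(x in D) f x <= \int[mu]_(x in D) g x)%E.
Proof.
move=> f0 fg; have g0 x : D x -> (0 <= g x)%E by move=> Dx; exact: le_trans (f0 _ Dx) (fg _ Dx).
rewrite (ge0_integralE _ f0) (ge0_integralE _ g0).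
apply: ereal_sup_le => _ [k /= hk <-]; exists k => //= x; apply: le_trans (hk x) _.
by rewrite !patchE; case: ifPn => // /set_mem; exact: fg.
Qed.

Lemma le_arc (f g : R * R -> \bar R) :
  (forall t, 0 <= t <= 2 * pi -> (0 <= f (gamma t))%E) ->
  (forall t, 0 <= t <= 2 * pi -> (f (gamma t) <= g (gamma t))%E) ->
  (arc_integral h f <= arc_integral h g)%E.
Proof.
move=> f0 fg; apply: le_integral_sup => t; rewrite /= in_itv /= => ht.
  by apply: mule_ge0; [exact: f0|rewrite lee_fin speed_ge0].
by apply: lee_wpmul2r; [rewrite lee_fin speed_ge0|exact: fg].
Qed.

Lemma arc_cst (c : R) : 0 <= c -> (0 <= arc_integral h (fun=> c%:E) < +oo)%E.
Proof.
move=> c0; apply/andP; split.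
  by apply: integral_ge0 => t _; rewrite mule_ge0 ?lee_fin ?speed_ge0.
have i1 : mu.-integrable `[0, 2 * pi] (EFin \o (fun t => c * speed h t)).
  apply: continuous_compact_integrable; first exact: segment_compact.
  apply: continuous_subspaceT => t.
  by apply: cvgM; [exact: cvg_cst|exact: speed_continuous].
exact: (@integrable_lty _ _ _ mu _ (measurable_itv `[0, 2 * pi]) _ i1).
Qed.

Lemma arc_bounded (f : R * R -> \bar R) (c : R) :
  (forall t, 0 <= t <= 2 * pi -> (0 <= f (gamma t) <= c%:E)%E) ->
  exists2 c' : R, 0 <= c' & (0 <= arc_integral h f <= c'%:E)%E.
Proof.
move=> hf; have c0 : 0 <= c.
  have pi0 : 0 <= 2 * pi :> R by rewrite mulr_ge0 ?pi_ge0.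
  have h0 : 0 <= (0 : R) <= 2 * pi by rewrite lexx.
  by have /andP[a1 a2] := hf 0 h0; rewrite -lee_fin (le_trans a1 a2).
have /andP[s0 s1] := arc_cst c0.
have fin : arc_integral h (fun=> c%:E) \is a fin_num by rewrite ge0_fin_numE.
exists (fine (arc_integral h (fun=> c%:E))); first exact: fine_ge0.
rewrite fineK//; apply/andP; split.
  apply: integral_ge0 => t; rewrite /= in_itv /= => /hf/andP[f0 _].
  by apply: mule_ge0 => //; rewrite lee_fin speed_ge0.
by apply: le_arc => t /hf/andP[].
Qed.

Lemma eq_arc (f g : R * R -> \bar R) :
  (forall t, 0 <= t <= 2 * pi -> f (gamma t) = g (gamma t)) ->
  arc_integral h f = arc_integral h g.
Proof.
move=> fg; apply: eq_integral => t; rewrite inE /= in_itv /= => ht.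
by rewrite fg.
Qed.

Lemma eq_Hhalf (g k : R * R -> R[i]) :
  (forall t, 0 <= t <= 2 * pi -> g (gamma t) = k (gamma t)) ->
  sqnormHhalf h g = sqnormHhalf h k.
Proof.
move=> gk; apply: (f_equal2 (fun x y => x + y)%E).
  by apply: eq_arc => t ht; rewrite gk.
by apply: eq_arc => t ht; apply: eq_arc => s hs; rewrite !gk.
Qed.

Lemma Hhalf0 : sqnormHhalf h (fun=> 0) = 0%E.
Proof.
have s0 : sqmod (0 : R[i]) = 0 by rewrite /sqmod /= expr0n addr0.
have z : arc_integral h (fun=> 0%E) = 0%E.
  by rewrite /arc_integral; apply: integral0_eq => t _; rewrite mul0e.
rewrite /sqnormHhalf subrr s0 z add0e -[RHS]z; apply: eq_arc => t ht.
by rewrite -[RHS]z; apply: eq_arc => s hs; rewrite mul0r.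
Qed.

Lemma gamma_bounded : exists N : nat, forall n, (N <= n)%N ->
  forall t, 0 <= t <= 2 * pi -> sq 0 (gamma t) <= n.+1%:R ^+ 2.
Proof.
have pi0 : 0 <= 2 * pi :> R by rewrite mulr_ge0 ?pi_ge0.
have cn : {within `[0, 2 * pi], continuous (fun t => sq 0 (gamma t))}.
  apply: continuous_subspaceT => t.
  exact: (continuous_comp (f := gamma) (g := sq 0) (gamma_continuous (x := t))
    (smooth_continuous (smooth_sq 0) (x := _))).
have [c _ hc] := EVT_max pi0 cn.
exists (Num.bound (sq 0 (gamma c))) => n Nn t ht.
have h1 : sq 0 (gamma t) <= sq 0 (gamma c) by apply: hc; rewrite in_itv.
apply: (le_trans h1); have h2 := archi_boundP (sq_ge0 0 (gamma c)).
apply: (le_trans (ltW h2)); apply: (@le_trans _ _ n.+1%:R).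
  by rewrite ler_nat; exact: leqW.
by rewrite expr2 ler_peMr// ler1n.
Qed.

Definition cutoff (n : nat) : R * R -> R := chi n.+1%:R 0.

Definition cut (n : nat) (v : R * R -> R[i]) (x : R * R) : R[i] := (cutoff n x)%:C * v x.

Lemma cut_test n v : smooth (fun x => Re (v x)) -> smooth (fun x => Im (v x)) ->
  Ctest_fun (cut n v).
Proof.
move=> s1 s2; have tc := test_chi (0 : R * R) (ltr0Sn R n).
split; rewrite /cut.
  under eq_fun do rewrite Re_mulc /= mul0r subr0.
  exact: test_mulr tc s1.
under eq_fun do rewrite Im_mulc /= mul0r addr0.
exact: test_mulr tc s2.
Qed.

Lemma cut_gamma v : exists N : nat, forall n, (N <= n)%N ->
  forall t, 0 <= t <= 2 * pi -> cut n v (gamma t) = v (gamma t).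
Proof.
have [N hN] := gamma_bounded; exists N => n Nn t ht.
by rewrite /cut /cutoff (chi_eq1 (ltr0Sn R n) (hN n Nn t ht)) mul1r.
Qed.

(** A smooth function agrees on the curve with a test function, which is
    bounded and Lipschitz; hence the difference quotient in the Slobodeckij
    seminorm is bounded and the curve has finite length. *)
Lemma Hhalf_smooth v : smooth (fun x => Re (v x)) -> smooth (fun x => Im (v x)) ->
  Hhalf h v.
Proof.
move=> s1 s2; split.
  by split; apply: (@gamma_comp_measurable (fun x => _ (v x))); exact: smooth_continuous.
have [N hN] := cut_gamma v; have tc := cut_test N s1 s2.
rewrite -(@eq_Hhalf (cut N v) v); last by move=> t; exact: hN.
move: tc; set w := cut N v => -[t1 t2].
have [M1 M10 b1] := test_bounded t1; have [M2 M20 b2] := test_bounded t2.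
have [L1 L10 d1] := test_lipschitz t1; have [L2' L20 d2] := test_lipschitz t2.
have sqb (a M : R) : `|a| <= M -> a ^+ 2 <= M ^+ 2.
  move=> aM; rewrite -(real_normK (num_real a)).
  by apply: lerXn2r => //; rewrite nnegrE // (le_trans (normr_ge0 a)).
rewrite /sqnormHhalf.
have [c1 c10 /andP[_ e1]] := @arc_bounded (fun x => (sqmod (w x))%:E) (M1 ^+ 2 + M2 ^+ 2)
  (fun t _ => introT andP (conj (sqmod_ge0 (w (gamma t)))
     (lerD (sqb _ _ (b1 (gamma t))) (sqb _ _ (b2 (gamma t)))))).
have quot x y : (0 <= (sqmod (w x - w y) / euclid (x - y) ^+ 2)%:E <= (L1 ^+ 2 + L2' ^+ 2)%:E)%E.
  rewrite !lee_fin divr_ge0 ?sqmod_ge0 ?sqr_ge0//=.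
  have [->|n0] := eqVneq (euclid (x - y)) 0.
    by rewrite expr0n invr0 mulr0 addr_ge0 ?sqr_ge0.
  have p0 : 0 < euclid (x - y) ^+ 2 by rewrite exprn_even_gt0.
  rewrite ler_pdivrMr// mulrDl -!exprMn /sqmod !raddfB /=.
  by apply: lerD; apply: sqb; [apply: le_trans (d1 x y) _|apply: le_trans (d2 x y) _];
    apply: ler_wpM2l => //; exact: euclid_ge.
have inner x := @arc_bounded (fun y => (sqmod (w x - w y) / euclid (x - y) ^+ 2)%:E) _
  (fun t _ => quot x (gamma t)).
have /andP[k0 k1] := arc_cst (addr_ge0 (sqr_ge0 L1) (sqr_ge0 L2')).
pose K := fine (arc_integral h (fun=> (L1 ^+ 2 + L2' ^+ 2)%:E)).
have Kf : arc_integral h (fun=> (L1 ^+ 2 + L2' ^+ 2)%:E) = K%:E.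
  by rewrite /K fineK// ge0_fin_numE.
have inner2 x : (0 <= arc_integral h (fun y => (sqmod (w x - w y) / euclid (x - y) ^+ 2)%:E) <= K%:E)%E.
  have [c' _ /andP[p0 _]] := inner x; rewrite p0 -Kf /=.
  by apply: le_arc => t _; have /andP[] := quot x (gamma t).
have [c2 c20 /andP[_ e2]] := @arc_bounded
  (fun x => arc_integral h (fun y => (sqmod (w x - w y) / euclid (x - y) ^+ 2)%:E)) K
  (fun t _ => inner2 (gamma t)).
by apply: le_lt_trans (leeD e1 e2) _; rewrite -EFinD ltry.
Qed.

Lemma cutoff_bounds : exists2 M : R, 0 <= M & forall n j x,
  (1 - cutoff n x) ^+ 2 <= 1 /\ partial j (cutoff n) x ^+ 2 <= M ^+ 2.
Proof.
have [M M0 hM] := @test_partial_chi_bound R; exists M => // n j x; split.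
  have a := chi_ge0 n.+1%:R 0 x; have b := chi_le1 n.+1%:R 0 x.
  by rewrite exprn_ile1// ?subr_ge0// gerBl.
rewrite -(real_normK (num_real (partial j _ x))); apply: lerXn2r; rewrite ?nnegrE//.
apply: le_trans (hM _ j x (ltr0Sn R n)) _.
by rewrite ler_pdivrMr// ler_peMr// ler1n.
Qed.

(** The gradients of the cutoffs are bounded uniformly in n. *)
Lemma cutoff_dominated j (p q : R * R -> R) : integ p -> integ q ->
  (forall x, 0 <= p x) -> (forall x, 0 <= q x) ->
  let F n x := 2 * (1 - cutoff n x) ^+ 2 * p x + 2 * partial j (cutoff n) x ^+ 2 * q x in
  exists2 g : R * R -> R, integ g & forall n, meas2 (F n) /\ forall x, `|F n x| <= g x.
Proof.
move=> ip iq p0 q0 F; have [M M0 hM] := cutoff_bounds.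
have mc n := smooth_meas2 (smooth_chi n.+1%:R (0 : R * R)).
have md n := smooth_meas2 (smooth_partial j (smooth_chi n.+1%:R (0 : R * R))).
exists (fun x => 2 * p x + 2 * M ^+ 2 * q x).
  exact: (integD (integZ 2 ip) (integZ (2 * M ^+ 2) iq)).
move=> n; split.
  apply: meas2D; apply: meas2M; [|exact: integ_meas| |exact: integ_meas];
    apply: meas2M; [exact: meas2_cst| |exact: meas2_cst|].
    by have h1 := meas2D (meas2_cst 1) (meas2N (mc n)); exact: (meas2M h1 h1).
  exact: (meas2M (md n) (md n)).
move=> x; have [c1 d1] := hM n j x.
rewrite ger0_norm; last by rewrite addr_ge0// mulr_ge0// mulr_ge0// sqr_ge0.
apply: lerD; apply: ler_wpM2r => //; last by rewrite ler_wpM2l.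
by rewrite ler_piMr.
Qed.

(** At every point, the cutoffs are eventually constant equal to 1 in a
    neighbourhood; dominated convergence. *)
Lemma cutoff_cvg j (p q : R * R -> R) : integ p -> integ q ->
  (forall x, 0 <= p x) -> (forall x, 0 <= q x) ->
  I2 (fun x => 2 * (1 - cutoff n x) ^+ 2 * p x + 2 * partial j (cutoff n) x ^+ 2 * q x)
    @[n --> \oo] --> (0 : R).
Proof.
move=> ip iq p0 q0; have [g ig hg] := cutoff_dominated j ip iq p0 q0.
have I20 : I2 (fun=> 0 : R) = 0.
  transitivity (I2 (fun x => 0 * p x)); last by rewrite (I2Z 0 ip) mul0r.
  by congr I2; apply/funext => x; rewrite mul0r.
rewrite -I20; apply: (@I2_cvg _ _ _ g).
- by move=> n; exact: (hg n).1.
- exact: meas2_cst.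
- apply: aep_all => x; apply: cvg_near_cst.
  exists (Num.bound (sq 0 x)) => // n /= hn.
  have hx : sq 0 x < n.+1%:R ^+ 2.
    apply: lt_le_trans (archi_boundP (sq_ge0 0 x)) _; apply: (@le_trans _ _ n.+1%:R).
      by rewrite ler_nat; exact: leqW.
    by rewrite expr2 ler_peMr// ler1n.
  rewrite /cutoff (chi_eq1 (ltr0Sn R n) (ltW hx)) (partial_chi_near j (ltr0Sn R n) hx).
  by rewrite subrr expr0n mulr0 !mul0r addr0.
- exact: ig.
- by move=> n; exact: (hg n).2.
Qed.

Lemma wdPi_ae b j (u u' g : R * R -> R[i]) : lociC u -> lociC u' -> lociC g ->
  aep (fun x => u x = u' x) -> wdPi b j u g -> wdPi b j u' g.
Proof.
move=> lu lu' [g1 g2] e [w1 w2]; have [v1 v2] := lociC_vpot b j lu.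
have [v1' v2'] := lociC_vpot b j lu'; have [[u1 u2] [u1' u2']] := (lu, lu').
split.
  apply: (wd_ae u2 u2' (lociD g1 v1) (lociD g1 v1') _ _ w1).
    by apply: aep_sub e => x ->.
  by apply: aep_sub e => x ->.
apply: (wd_ae u1 u1' (lociN (lociD g2 v2)) (lociN (lociD g2 v2')) _ _ w2).
  by apply: aep_sub e => x ->.
by apply: aep_sub e => x ->.
Qed.

Lemma lociC_gradmul j (c : R * R -> R) u g : smooth c -> lociC u -> lociC g ->
  lociC (gradmul j c u g).
Proof.
move=> sc [u1 u2] [g1 g2]; have c0 := smooth_continuous sc.
have c1 := smooth_continuous (smooth_partial j sc).
split; rewrite /gradmul /=; [exact: (lociD (lociM g1 c0) (lociM u2 c1))|].
exact: (lociB (lociM g2 c0) (lociM u1 c1)).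
Qed.

Lemma lociC_mul (c : R * R -> R) u : smooth c -> lociC u -> lociC (fun x => (c x)%:C * u x).
Proof.
move=> sc [u1 u2]; have c0 := smooth_continuous sc; split.
  under eq_fun do rewrite Re_mulc /= mul0r subr0 mulrC.
  exact: lociM.
under eq_fun do rewrite Im_mulc /= mul0r addr0 mulrC.
exact: lociM.
Qed.

Lemma sqmod_gradmul (c d : R) (u g : R[i]) :
  sqmod (((Re g * c + Im u * d) +i* (Im g * c - Re u * d)) - g) <=
  2 * (1 - c) ^+ 2 * sqmod g + 2 * d ^+ 2 * sqmod u.
Proof.
case: u => u1 u2; case: g => g1 g2; rewrite /sqmod /= -subr_ge0.
rewrite (_ : _ - _ = (g1 * (c - 1) - u2 * d) ^+ 2 + (g2 * (c - 1) + u1 * d) ^+ 2); last by ring.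
by rewrite addr_ge0 ?sqr_ge0.
Qed.

Lemma I2_sqmod_ae (X Y : R * R -> R[i]) (G : R * R -> R) : integ (fun x => sqmod (X x)) ->
  lociC Y -> integ G -> aep (fun x => X x = Y x) -> (forall x, sqmod (Y x) <= G x) ->
  I2 (fun x => sqmod (X x)) <= I2 G.
Proof.
move=> iX [[m1 _] [m2 _]] iG e YG.
have mY : meas2 (fun x => sqmod (Y x)) by apply: meas2D; exact: meas2M.
have e' : aep (fun x => sqmod (X x) = sqmod (Y x)) by apply: aep_sub e => x ->.
have iY := integ_ae iX mY e'.
by rewrite (I2_ae (integ_meas iX) mY e'); exact: le_I2.
Qed.

(** By the product rule the momentum of cut v - u is (cutoff - 1) Pi_j u - i
    (d_j cutoff) u, where v may be replaced by u almost everywhere. *)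
Lemma cut_H1A_le b u v n : H1A b u -> smooth (fun x => Re (v x)) ->
  smooth (fun x => Im (v x)) -> aep (fun x => u x = v x) ->
  let F j g := I2 (fun x => 2 * (1 - cutoff n x) ^+ 2 * sqmod (g x) +
    2 * partial j (cutoff n) x ^+ 2 * sqmod (u x)) in
  exists2 r : R, sqnormH1A b (fun x => cut n v x - u x) = r%:E &
    0 <= r <= F 0 u + (F 0 (PiA b 0 u) + F 1 (PiA b 1 u)).
Proof.
move=> hu s1 s2 uv F; have tc := cut_test n s1 s2.
have hX := H1A_sub tc hu; set X := (fun x => cut n v x - u x) in hX *.
have lu := L2_lociC hu.1; have lX := L2_lociC hX.1.
have sc : smooth (cutoff n) := smooth_chi _ _.
have iu := ((L2P _).1 hu.1).2; have iX := ((L2P _).1 hX.1).2.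
pose Y x := (cutoff n x)%:C * u x - u x.
have XY : aep (fun x => X x = Y x) by apply: aep_sub uv => x e; rewrite /X /Y /cut e.
have lY : lociC Y := lociCB (lociC_mul sc lu) lu.
have iF j (g : R * R -> R[i]) : integ (fun x => sqmod (g x)) ->
   integ (fun x => 2 * (1 - cutoff n x) ^+ 2 * sqmod (g x) +
    2 * partial j (cutoff n) x ^+ 2 * sqmod (u x)).
  move=> ig; have [d id hd] := cutoff_dominated j ig iu (fun x => sqmod_ge0 _) (fun x => sqmod_ge0 _).
  exact: integ_le (hd n).1 (hd n).2 id.
have part j : I2 (fun x => sqmod (PiA b j X x)) <= F j (PiA b j u).
  have [lg wg] := PiA_spec j hu; have [lP wP] := PiA_spec j hX.
  have lgC := L2_lociC lg.
  have lgm := lociC_gradmul j sc lu lgC.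
  have w1 := wdPiB (lociC_mul sc lu) lgm lu lgC (wdPiM lu lgC sc wg) wg.
  have XY' : aep (fun x => Y x = X x) by apply: aep_sub XY => x.
  have w2 := wdPi_ae lY lX (lociCB lgm lgC) XY' w1.
  have e := wdPi_unique lX (L2_lociC lP) (lociCB lgm lgC) wP w2.
  have [_ ig] := (L2P _).1 lg.
  apply: (I2_sqmod_ae ((L2P _).1 lP).2 (lociCB lgm lgC) (iF j _ ig) e) => x.
  exact: sqmod_gradmul.
have partX : I2 (fun x => sqmod (X x)) <= F 0 u.
  apply: (I2_sqmod_ae iX lY (iF 0 _ iu) XY) => x.
  rewrite /Y -[X in _ - X]mul1r -mulrBl sqmodM.
  have -> : sqmod ((cutoff n x)%:C - 1) = (1 - cutoff n x) ^+ 2.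
    by rewrite /sqmod /= subr0 expr0n addr0 -sqrrN opprB.
  have := mulr_ge0 (sqr_ge0 (1 - cutoff n x)) (sqmod_ge0 (u x)).
  have := mulr_ge0 (sqr_ge0 (partial 0 (cutoff n) x)) (sqmod_ge0 (u x)).
  rewrite -2!mulrA; move: (_ * sqmod _) (_ * sqmod _) => A B; lra.
rewrite (sqnormH1AE hX); eexists; first by reflexivity.
have n0 (g : R * R -> R[i]) : 0 <= I2 (fun x => sqmod (g x)).
  by apply: I2_ge0 => x; exact: sqmod_ge0.
apply/andP; split; first exact: (addr_ge0 (n0 X) (addr_ge0 (n0 _) (n0 _))).
exact: (lerD partX (lerD (part 0) (part 1))).
Qed.

Lemma sum3_cvg0 (r1 r2 r3 : nat -> R) : r1 n @[n --> \oo] --> (0 : R) ->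
  r2 n @[n --> \oo] --> (0 : R) -> r3 n @[n --> \oo] --> (0 : R) ->
  r1 n + (r2 n + r3 n) @[n --> \oo] --> (0 : R).
Proof. by move=> c1 c2 c3; have := cvgD c1 (cvgD c2 c3); rewrite !addr0; apply. Qed.

(** The cutoffs of the smooth representative are test functions, converge to u
    in the magnetic Sobolev norm, and coincide with it on the bounded curve
    from some rank on. *)
Lemma smooth_is_trace b u v : H1A b u -> smooth (fun x => Re (v x)) ->
  smooth (fun x => Im (v x)) -> aep (fun x => u x = v x) -> is_trace h b u v.
Proof.
move=> hu s1 s2 uv; split=> //; first exact: Hhalf_smooth.
exists (fun n => cut n v); split.
- by move=> n; exact: cut_test.
- have lu := L2_lociC hu.1.
  have [_ iu] := (L2P _).1 hu.1.
  pose F j n := I2 (fun x => 2 * (1 - cutoff n x) ^+ 2 * sqmod (PiA b j u x) +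
    2 * partial j (cutoff n) x ^+ 2 * sqmod (u x)).
  pose F2 n := I2 (fun x => 2 * (1 - cutoff n x) ^+ 2 * sqmod (u x) +
    2 * partial 0 (cutoff n) x ^+ 2 * sqmod (u x)).
  have iP j := ((L2P _).1 (PiA_spec j hu).1).2.
  have cF j : F j n @[n --> \oo] --> (0 : R).
    exact: (@cutoff_cvg j _ _ (iP j) iu (fun x => sqmod_ge0 _) (fun x => sqmod_ge0 _)).
  have cF2 : F2 n @[n --> \oo] --> (0 : R).
    exact: (@cutoff_cvg 0 _ _ iu iu (fun x => sqmod_ge0 _) (fun x => sqmod_ge0 _)).
  have bound n := cut_H1A_le n hu s1 s2 uv.
  pose r n := fine (sqnormH1A b (fun x => cut n v x - u x)).
  have rE n : sqnormH1A b (fun x => cut n v x - u x) = (r n)%:E.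
    by rewrite /r; have [q -> _] := bound n.
  have r_le n : 0 <= r n <= F2 n + (F 0 n + F 1 n).
    by rewrite /r; have [q -> hq] := bound n.
  under eq_fun do rewrite rE.
  apply: cvg_EFin; first exact: nearW.
  apply: (squeeze_cvgr (f := fun=> 0) (h := fun n => F2 n + (F 0 n + F 1 n))).
  - exact: nearW.
  - exact: cvg_cst.
  - exact: (sum3_cvg0 cF2 (cF 0) (cF 1)).
- have [N hN] := cut_gamma v.
  apply: cvg_near_cst; exists N => // n /= Nn.
  rewrite -Hhalf0; apply: eq_Hhalf => t ht.
  by rewrite hN// subrr.
Qed.

(** The trace is some function satisfying the defining property, and the
    restriction of the smooth representative is one; uniqueness identifies
    them. *)
Lemma trace_smooth b u v : H1A b u -> smooth (fun x => Re (v x)) ->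
  smooth (fun x => Im (v x)) -> aep (fun x => u x = v x) ->
  is_trace h b u (trace h b u) /\ arc_ae h (fun x => trace h b u x = v x).
Proof.
move=> hu s1 s2 uv; have hv := smooth_is_trace hu s1 s2 uv.
have ht : [set g | is_trace h b u g] (trace h b u) by apply: xgetPex; exists v.
by split=> //; exact: trace_unique ht hv.
Qed.

End Curve.

Local Open Scope complex_scope.


(** * Null functions belong to the kernel *)

Section NullFunctions.
Context {R : realType}.
Variable b : R.
Implicit Types u v g : R * R -> R[i].

Lemma Ctest0 : Ctest_fun (fun=> 0 : R[i]).
Proof. by split; exact: test0. Qed.

Lemma cPi0 j : cPi b j (fun=> 0) = fun=> 0.
Proof.
apply/funext => x; apply/eqP; rewrite eq_complex /cPi /= !partial_cst.
by rewrite !mulr0 !oppr0 !addr0 !eqxx.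
Qed.

Lemma null_wdPi u j : L2_zero u -> wdPi b j u (fun=> 0).
Proof.
move=> [lu u0]; have l0 := L2_lociC (Ctest_L2 Ctest0).
apply: (@wdPi_ae _ b j (fun=> 0)) => //; first exact: L2_lociC.
  by apply: (aep_sub _ u0) => x ->.
have [t1 t2] := Ctest0; have := wdPi_smooth b j (test_smooth t1) (test_smooth t2).
by rewrite cPi0.
Qed.

Lemma null_H1A u : L2_zero u -> H1A b u.
Proof.
move=> hu; apply: (@H1A_intro _ _ _ (fun _ _ => 0)); first exact: hu.1.
  by move=> j; exact: Ctest_L2 Ctest0.
by move=> j; exact: null_wdPi.
Qed.

Lemma null_PiA u j : L2_zero u -> L2_zero (PiA b j u).
Proof. by move=> hu; exact: (PiA_ae hu.1 (Ctest_L2 Ctest0) (null_wdPi j hu)). Qed.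

Lemma inner_null u v : L2_zero u -> L2 v -> inner u v = 0.
Proof.
move=> [lu u0] lv; have [m1 m2 _ _] := L2_sq lu; have [n1 n2 _ _] := L2_sq lv.
have z : I2 (fun=> 0 : R) = 0 by rewrite /I2 /Rintegral integral0.
have zero (f : R * R -> R) : meas2 f -> aep (fun x => f x = 0) -> I2 f = 0.
  by move=> mf f0; rewrite (I2_ae mf (meas2_cst 0) f0) z.
rewrite /inner; change (Cintegral leb2 setT ?f) with (I2 (fun x => Re (f x)) +i* I2 (fun x => Im (f x))).
rewrite (zero (fun x => Re _)) ?(zero (fun x => Im _)) //.
- under eq_fun do rewrite Im_mulconj.
  by apply: meas2D; [exact: meas2M|apply: meas2N; exact: meas2M].
- by apply: (aep_sub _ u0) => x ->; rewrite mul0r.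
- under eq_fun do rewrite Re_mulconj.
  by apply: meas2D; exact: meas2M.
- by apply: (aep_sub _ u0) => x ->; rewrite mul0r.
Qed.

Lemma null_scale u (c : R) : L2_zero u -> L2_zero (fun x => c%:C * u x).
Proof.
move=> [lu u0]; split; last by apply: (aep_sub _ u0) => x ->; rewrite mulr0.
apply: (@L2M _ u (fun=> c%:C) (sqmod c%:C)) => //.
by split; exact: meas2_cst.
Qed.

(** Null functions have null magnetic gradients, so every term of the
    variational identity vanishes. *)
Lemma null_landau u : L2_zero u -> landau_space b 0 u.
Proof.
move=> hu; have hs := null_scale (landau_level b 0) hu.
split; [exact: null_H1A|exact: hs.1|move=> v hv].
rewrite (inner_null hs hv.1); apply: (etrans (landau_formE b u v)).
have add0 (X Y : R[i]) : X = 0 -> Y = 0 -> X + Y = 0 by move=> -> ->; rewrite addr0.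
exact: (add0 _ _ (inner_null (null_PiA 0 hu) (PiA_spec 0 hv).1)
  (inner_null (null_PiA 1 hu) (PiA_spec 1 hv).1)).
Qed.

Lemma zero_L2_zero : @L2_zero R (fun=> 0).
Proof. by split; [exact: Ctest_L2 Ctest0|exact: aeW]. Qed.

End NullFunctions.

(** * Zeros of a function on a non-null part of the curve *)

Section Zeros.
Context {R : realType}.
Variables (Gamma : set (R * R)) (h : R * R -> R * R).
Hypothesis hG : C11_circle_diffeo Gamma h.
Let gamma := angular h.

(** A subset of a compact interval without cluster point is finite, hence
    null. *)
Lemma cluster_of_nonnull (Z : R -> Prop) :
  ~ {ae @leb1 R, forall t, (`[0, 2 * pi]%classic : set R) t -> ~ Z t} ->
  exists2 t0, 0 <= t0 <= 2 * pi &
    forall e : R, 0 < e -> exists t, [/\ Z t, t != t0 & `|t - t0| < e].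
Proof.
move=> hZ; apply: contrapT => no; apply: hZ.
have isol t0 : exists e : R, 0 < e /\ ((`[0, 2 * pi]%classic : set R) t0 ->
    forall t, Z t -> `|t - t0| < e -> t = t0).
  have [I0|I0] := pselect ((`[0, 2 * pi]%classic : set R) t0); last by exists 1.
  apply: contrapT => hn; apply: no; exists t0; first by move: I0; rewrite /= in_itv.
  move=> e e0; apply: contrapT => hn'; apply: hn; exists e; split=> // _ t Zt te.
  by apply: contrapT => tt0; apply: hn'; exists t; split=> //; apply/eqP.
have [e he] := choice isol.
have cI : compact (`[0, 2 * pi]%classic : set R) by exact: segment_compact.
rewrite compact_cover in cI.
have [] := cI R (`[0, 2 * pi]%classic : set R) (fun t0 => ball t0 (e t0)).
- by move=> t0 _; exact: ball_open.
- by move=> t It; exists t => //; exact: ballxx (he t).1.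
move=> D sD; have := finite_fset D; set S := (X in finite_set X) => finS.
rewrite -/S => cov.
have cS : countable S by exact: finite_set_countable.
have S0 : (@leb1 R).-negligible (S : set (measurableTypeR R)).
  exists S; split=> //; last exact: countable_lebesgue_measure0.
  exact: countable_measurable.
apply: (negligibleS _ S0) => t /= /not_implyP[It /contrapT Zt].
have [t0 t0D] := cov t It; rewrite -ball_normE /ball_ /= => tb.
have I0 : (`[0, 2 * pi]%classic : set R) t0 by have := sD _ t0D; rewrite inE.
suff -> : t = t0 by [].
rewrite distrC in tb; exact: (he t0).2 I0 t Zt tb.
Qed.

(** The mean value theorem for the coordinate that moves with nonzero speed. *)
Lemma gamma_local_inj t0 : 0 <= t0 <= 2 * pi -> exists2 d : R, 0 < d &
  forall t, t != t0 -> `|t - t0| <= d -> gamma t != gamma t0.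
Proof.
move=> ht0; have [m [d [m0 d0 hloc]]] := local_expansion hG.
have [j [e [he hj]]] := hloc _ ht0; exists d => // t tt0 td.
have main (a c : R) : a < c -> (forall x, a <= x <= c -> `|x - t0| <= d) ->
    coord j (gamma a) != coord j (gamma c).
  move=> ac hx; have cg := coord_continuous (j := j) (gamma_continuous hG).
  have [x + E] := MVT_segment (ltW ac) (fun x _ => gamma_is_derive hG j x) (continuous_subspaceT cg).
  rewrite in_itv /= => /hx/hj hm; rewrite eq_sym -subr_eq0 E mulf_neq0//; last by rewrite subr_eq0 gt_eqF.
  by apply: contraTneq (lt_le_trans m0 hm) => ->; rewrite mulr0 ltxx.
have near_t0 (x y : R) : `|t - t0| <= d -> (t0 <= x <= t) || (t <= x <= t0) -> `|x - t0| <= d.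
  rewrite !ler_distl => /andP[h1 h2] /orP[] /andP[h3 h4]; apply/andP; split; lra.
have [lt|gt|eq] := ltgtP t t0; last by rewrite eq eqxx in tt0.
  have := main _ _ lt (fun x hx => near_t0 x 0 td (introT orP (or_intror hx))).
  by apply: contraNN => /eqP ->.
have := main _ _ gt (fun x hx => near_t0 x 0 td (introT orP (or_introl hx))).
by apply: contraNN => /eqP ->.
Qed.

Lemma zeros_cluster (v : R * R -> R[i]) :
  ~ {ae @leb1 R, forall t, (`[0, 2 * pi]%classic : set R) t -> v (gamma t) <> 0} ->
  exists w0, forall e : R, 0 < e -> exists w, [/\ w != w0, `|w - w0| <= e & v w = 0].
Proof.
move=> /cluster_of_nonnull[t0 ht0 acc]; exists (gamma t0) => e e0.
have [d d0 inj] := gamma_local_inj ht0.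
have /cvgrPdist_le/(_ e e0)/nbhs_ballP[d' /= d'0 hd'] := gamma_continuous hG (x := t0).
have dd0 : 0 < Num.min d d' by rewrite lt_min d0.
have [t [Zt tt0]] := acc _ dd0; rewrite lt_min => /andP[td td'].
exists (gamma t); split=> //; first by apply: inj => //; exact: ltW.
rewrite distrC in td'; rewrite distrC; exact: (hd' t td').
Qed.

End Zeros.

Lemma ae1_and (R : realType) (P Q S : R -> Prop) : (forall t, P t -> Q t -> S t) ->
  {ae @leb1 R, forall t, P t} -> {ae @leb1 R, forall t, Q t} -> {ae @leb1 R, forall t, S t}.
Proof.
move=> PQS aP aQ; have := @filterI _ _ (ae_filter_ringOfSetsType (@leb1 R)) _ _ aP aQ.
by apply: (@filterS _ _ (ae_filter_ringOfSetsType (@leb1 R))) => t [? ?]; exact: PQS.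
Qed.

(** * The quadratic form and the kernel *)

Section Main.
Context {R : realType}.
Variables (b : R) (b0 : 0 < b) (Gamma : set (R * R)) (h : R * R -> R * R).
Hypothesis hG : C11_circle_diffeo Gamma h.
Variables (p : R) (hp : 1 < p) (ups : R * R -> R).
Hypothesis hLp : LpGamma h p ups.
Local Notation mu := (@lebesgue_measure R).
Local Notation J := (`[0, 2 * pi]%classic : set (measurableTypeR R)).
Let gamma := angular h.

Lemma trace_arc_measurable u g : is_trace h b u g -> Cmeasurable J (g \o gamma).
Proof. by case=> _ []. Qed.

Lemma le_1_powR (a : R) : 0 <= a -> a <= 1 + a `^ p.
Proof.
move=> a0; have [a1|/ltW a1] := leP a 1; first by rewrite (le_trans a1)// lerDl powR_ge0.
apply: (@le_trans _ _ (a `^ p)); last by rewrite lerDr.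
by rewrite -[leLHS]powRr1// ler_powR// ltW.
Qed.

Lemma speed_gt0 t : 0 <= t <= 2 * pi -> 0 < speed h t.
Proof.
move=> ht; have [m m0 hm] := dgamma_gt0 hG.
exact: lt_le_trans (lt_le_trans m0 (hm t ht)) (euclid_ge _).
Qed.

(** The weight is in L^p, hence in L^1 because |x| <= 1 + |x|^p and the curve
    has finite length; a continuous factor is bounded on the curve. *)
Lemma weighted_finite (f : R -> R) : continuous f -> (forall t, 0 <= f t) ->
  (\int[mu]_(t in J) (`|ups (gamma t)| * f t * speed h t)%:E < +oo)%E.
Proof.
move=> cf f0; have mJ : measurable J by exact: measurable_itv.
have pi0 : 0 <= 2 * pi :> R by rewrite mulr_ge0 ?pi_ge0.
have [c _ hc] := EVT_max pi0 (continuous_subspaceT cf).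
have B0 : 0 <= f c by [].
have [mups fin] := hLp.
have s0 t : 0 <= speed h t := speed_ge0 h t.
have ms : measurable_fun J (speed h).
  by apply: measurable_funTS; apply: continuous_measurable1; exact: (speed_continuous hG).
have mabs : measurable_fun J (fun t => `|ups (gamma t)|).
  exact: (measurableT_comp _ mups).
have mp : measurable_fun J (fun t => `|ups (gamma t)| `^ p).
  exact: (measurableT_comp (measurable_powR p) mabs).
have /andP[_ fin1] := arc_cst hG (@ler01 R).
pose G t : \bar R := ((1 * speed h t)%:E + (`|ups (gamma t)| `^ p * speed h t)%:E)%E.
apply: (@le_lt_trans _ _ (\int[mu]_(t in J) ((f c)%:E * G t))%E).
  apply: le_integral_sup => t; rewrite /= in_itv /= => ht.
    by rewrite lee_fin mulr_ge0// mulr_ge0.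
  rewrite /G -EFinD -EFinM lee_fin -mulrDl mulrA ler_wpM2r// mulrC.
  apply: ler_pM => //; last exact: le_1_powR.
  by apply: hc; rewrite in_itv.
have mG1 : measurable_fun J (fun t => (1 * speed h t)%:E).
  by apply/measurable_EFinP; apply: measurable_funM => //; exact: measurable_cst.
have mG2 : measurable_fun J (fun t => (`|ups (gamma t)| `^ p * speed h t)%:E).
  by apply/measurable_EFinP; exact: measurable_funM.
rewrite ge0_integralZl//; last 2 first.
- exact: emeasurable_funD.
- by move=> t _; rewrite /G adde_ge0// lee_fin mulr_ge0// powR_ge0.
rewrite ge0_integralD//; last 2 first.
- by move=> t _; rewrite lee_fin mulr_ge0.
- by move=> t _; rewrite lee_fin mulr_ge0// powR_ge0.
apply: lte_mul_pinfty; [by rewrite lee_fin|by []|].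
apply: lte_add_pinfty; [exact: fin1|exact: fin].
Qed.

Hypothesis ups0 : arc_ae h (fun x => 0 <= ups x).

(** The integrand is nonnegative almost everywhere. Its finiteness is
    essential: a real-valued integral of a nonnegative function is also 0 when
    the function has infinite integral. *)
Lemma form_diag_zero (tau v : R * R -> R[i]) : continuous (fun x => sqmod (v x)) ->
  Cmeasurable J (tau \o gamma) -> arc_ae h (fun x => tau x = v x) ->
  arc_Cintegral h (fun x => (ups x)%:C * tau x * (tau x)^*) = 0 ->
  {ae @leb1 R, forall t, J t -> `|ups (gamma t)| * sqmod (v (gamma t)) * speed h t = 0}.
Proof.
move=> cv mtau tauv int0; have mJ : measurable J by exact: measurable_itv.
have cg : continuous (fun t => sqmod (v (gamma t))).
  by move=> t; exact: (continuous_comp (f := gamma) (g := fun x => sqmod (v x))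
    (gamma_continuous hG (x := t)) (cv _)).
have ms : measurable_fun J (speed h).
  by apply: measurable_funTS; apply: continuous_measurable1; exact: (speed_continuous hG).
have [mups _] := hLp.
pose k t := ups (gamma t) * sqmod (tau (gamma t)) * speed h t.
pose k0 t := `|ups (gamma t)| * sqmod (v (gamma t)) * speed h t.
have k00 t : 0 <= k0 t by rewrite mulr_ge0 ?speed_ge0// mulr_ge0// sqmod_ge0.
have mk : measurable_fun J k.
  by apply: measurable_funM => //; apply: measurable_funM => //; exact: Cmeasurable_sqmod.
have mk0 : measurable_fun J k0.
  apply: measurable_funM => //; apply: measurable_funM; first exact: (measurableT_comp _ mups).
  by apply: measurable_funTS; exact: continuous_measurable1.
apply: (integral_eq0_ae mJ mk0 k00).
have fin := weighted_finite cg (fun t => sqmod_ge0 (v (gamma t))).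
have E : (\int[mu]_(t in J) (k t)%:E = \int[mu]_(t in J) (k0 t)%:E)%E.
  apply: ae_eq_integral => //; [exact/measurable_EFinP|exact/measurable_EFinP|].
  apply: (@ae1_and _ (fun t => J t -> tau (gamma t) = v (gamma t))
    (fun t => J t -> 0 <= ups (gamma t)) _ _ tauv ups0) => t h1 h2 Jt.
  by rewrite /= /k /k0 (h1 Jt) ger0_norm// (h2 Jt).
have k0fin : (\int[mu]_(t in J) (k0 t)%:E)%E \is a fin_num.
  by rewrite ge0_fin_numE//; apply: integral_ge0 => t _; rewrite lee_fin.
have r0 : \int[mu]_(t in J) k t = 0.
  have : \int[mu]_(t in J) Re ((ups (gamma t))%:C * tau (gamma t) * (tau (gamma t))^* *
    (speed h t)%:C) = 0 by case: int0.
  move=> H; rewrite -[RHS]H; apply: eq_Rintegral => t _; rewrite /k.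
  by case: (tau (gamma t)) => y z; rewrite /sqmod /=; ring.
by rewrite -(fineK k0fin) -E; congr EFin.
Qed.

Lemma form_null (tau tau' : R * R -> R[i]) : Cmeasurable J (tau \o gamma) ->
  Cmeasurable J (tau' \o gamma) -> arc_ae h (fun x => tau x = 0) ->
  arc_Cintegral h (fun x => (ups x)%:C * tau x * (tau' x)^*) = 0.
Proof.
move=> [m1 m2] [n1 n2] t0; have mJ : measurable J by exact: measurable_itv.
have ms : measurable_fun J (speed h).
  by apply: measurable_funTS; apply: continuous_measurable1; exact: (speed_continuous hG).
have [mups _] := hLp.
have zero (f : R -> R) : measurable_fun J f ->
    (forall t, tau (gamma t) = 0 -> f t = 0) -> \int[mu]_(t in J) f t = 0.
  move=> mf hf; rewrite /Rintegral (@ae_eq_integral _ _ _ mu J (cst 0%E)) ?integral0//.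
    exact/measurable_EFinP.
  apply: (@ae1_and _ (fun t => J t -> tau (gamma t) = 0) xpredT _ _ t0) => [t h1 _ Jt|].
    by rewrite /= hf// h1.
  exact: aeW.
rewrite /arc_Cintegral /Cintegral; apply/eqP; rewrite eq_complex /=; apply/andP; split; apply/eqP.
  apply: zero => [|t ->]; last by rewrite mulr0 !mul0r.
  rewrite (_ : (fun t => _) = fun t => ups (gamma t) *
    (Re (tau (gamma t)) * Re (tau' (gamma t)) + Im (tau (gamma t)) * Im (tau' (gamma t))) * speed h t).
    by apply: measurable_funM => //; apply: measurable_funM => //; apply: measurable_funD; exact: measurable_funM.
  by apply/funext => t; case: (tau _) => ? ?; case: (tau' _) => ? ? /=; ring.
apply: zero => [|t ->]; last by rewrite mulr0 !mul0r.
rewrite (_ : (fun t => _) = fun t => ups (gamma t) *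
  (Im (tau (gamma t)) * Re (tau' (gamma t)) - Re (tau (gamma t)) * Im (tau' (gamma t))) * speed h t).
  by apply: measurable_funM => //; apply: measurable_funM => //; apply: measurable_funB; exact: measurable_funM.
by apply/funext => t; case: (tau _) => ? ?; case: (tau' _) => ? ? /=; ring.
Qed.

End Main.

Theorem theorem3p6 (R : realType) (b : R) (hb : 0 < b)
    (Gamma : set (R * R)) (h : R * R -> R * R)
    (hGamma : C11_circle_diffeo Gamma h)
    (p : R) (hp : 1 < p) (ups : R * R -> R) (hLp : LpGamma h p ups)
    (hge0 : arc_ae h (fun x => 0 <= ups x))
    (hneq0 : ~ arc_ae h (fun x => ups x = 0)) :
  toeplitz_ker h b ups 0 = L2_zero.
Proof.
have z2 := @zero_L2_zero R.
apply/seteqP; split => u.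
  move=> [hu _ hq]; have hH : H1A b u by case: hu.
  have [v [s1 s2 uv uc]] := ground_smooth hb hu.
  have [tr e] := trace_smooth hGamma hH s1 s2 uv.
  have cv : continuous (fun x => sqmod (v x)).
    by apply: smooth_continuous; apply: smoothD; apply: smoothM.
  (* The kernel equation is used with u itself as second argument of the form. *)
  have q0 := etrans (hq u hu) (inner_null z2 hH.1).
  have ae := form_diag_zero hGamma hp hLp hge0 cv (trace_arc_measurable tr) e q0.
  (* If v were nonzero almost everywhere on the curve, the weight would vanish
     almost everywhere. *)
  have [|w0 hw0] := zeros_cluster hGamma (v := v).
    move=> nz; apply: hneq0; apply: ae1_and nz ae => t h1 h2 Jt.
    have vt := h1 Jt; have := h2 Jt => /eqP.
    have sp : speed h t != 0 by rewrite gt_eqF// (speed_gt0 hGamma).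
    rewrite !mulf_eq0 (negbTE sp) orbF normr_eq0 => /orP[/eqP //|].
    rewrite /sqmod paddr_eq0 ?sqr_ge0// !sqrf_eq0 => h3; case: vt.
    by apply/eqP; rewrite eq_complex.
  have v0 := uc w0 hw0.
  split; first exact: hH.1.
  by apply: aep_sub uv => x ->.
move=> hu; split; [exact: null_landau|exact: null_landau|move=> v hv].
have hH : H1A b v by case: hv.
rewrite (inner_null z2 hH.1).
have [w [s1 s2 vw _]] := ground_smooth hb hv.
have [tr _] := trace_smooth hGamma hH s1 s2 vw.
have s0 := @smooth_cst R 0.
have [tu eu] := trace_smooth hGamma (null_H1A b hu) (v := fun=> 0) s0 s0 hu.2.
exact: (form_null hGamma hLp (trace_arc_measurable tu) (trace_arc_measurable tr) eu).
Qed.
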